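(* Suppose Assumption 1 holds and let $(\sigma_n)$ be a positive sequence with $\sigma_n\to0$. Then $\lim_{n\to\infty}\sigma_n^{-6}\mathbb{E}[\rho_n^2]=\theta^2$, where $\theta^2\in[0,\infty)$ is given by $$\theta^2=\mu_6\Big\{\tfrac{1}{144}A_\phi+\big(\tfrac14+\mathfrak g\big)^2B_\phi-\tfrac16\big(\tfrac14+\mathfrak g\big)C_\phi\Big\}+\mu_4\Big\{\tfrac16\big(\tfrac12+\mathfrak g\big)C_\phi-2\big(\tfrac14+\mathfrak g\big)\big(\tfrac12+\mathfrak g\big)B_\phi\Big\}+\big(\tfrac12+\mathfrak g\big)^2B_\phi .$$ Moreover, if $\theta>0$ and $\lim_{n\to\infty}n^{1/6}\sigma_n=\ell\in(0,\infty)$, then $$\sum_{i=1}^n\rho_n(X_{n,i},Y_{n,i})\Rightarrow N\!\left(-\tfrac12\ell^6\theta^2,\ \ell^6\theta^2\right)\quad (n\to\infty)$$ in distribution.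
   Context: Let $\phi:\mathbb{R}\to\mathbb{R}$ be such that $\pi(x)=e^{\phi(x)}$ is a probability density on $\mathbb{R}$. A balancing function is $g:[0,\infty)\to[0,\infty)$ with $g(0)=0$ and $g(t)=tg(1/t)$ for $t>0$; normalize $g(1)=1$ and set $b(x)=\log g(e^x)$, $\mathfrak g=g''(1)$. Let $\mu$ be a centred symmetric probability distribution on $\mathbb{R}$ and $\mu_k=\int z^k\mu(dz)$. For $\sigma>0$ let $Z_\sigma(x)=\int g(e^{\sigma z\phi'(x)})\mu(dz)$ and let $Q_\sigma(x,\cdot)$ be the law of $x+\sigma W$ where $W$ has distribution $Z_\sigma(x)^{-1}g(e^{\sigma w\phi'(x)})\mu(dw)$ (first-order locally-balanced proposal). For $X\sim\pi$, $Y\sim Q_{\sigma_n}(X,\cdot)$, the log-Metropolis–Hastings variable is $\rho_n=\rho_n(X,Y)=\log\frac{\pi(dy)Q_{\sigma_n}(y,dx)}{\pi(dx)Q_{\sigma_n}(x,dy)}$ on the symmetric set where this Radon–Nikodym derivative is positive and finite, and $\rho_n=0$ otherwise; explicitly there $\rho_n(x,y)=\phi(y)-\phi(x)+b(\phi'(y)(x-y))-b(\phi'(x)(y-x))+\log Z_{\sigma_n}(x)-\log Z_{\sigma_n}(y)$. In dimension $n$, $X_n=(X_{n,1},\dots,X_{n,n})\sim\prod_i\pi(x_i)dx_i$ and $Y_n$ has law $\prod_iQ_{\sigma_n}(X_{n,i},dy_i)$, so the $\rho_n(X_{n,i},Y_{n,i})$ are i.i.d. copies of $\rho_n$. Write $A_\phi=\mathbb{E}_\pi[(\phi''')^2]$,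 $B_\phi=\mathbb{E}_\pi[(\phi'\phi'')^2]$, $C_\phi=\mathbb{E}_\pi[\phi'\phi''\phi''']$. Assumption 1: there are constants $H\in(0,1)$, $\gamma>0$, $\beta\ge0$, $\epsilon>0$ such that (i) $\phi\in\mathcal{C}^{3+H}(\mathbb{R})$ and for each $f\in\{\phi''',\ \phi''\phi',\ (\phi')^3,\ \phi''|\phi'|^{1+\beta}\}$ one has $\int|f(x)|^{2+\epsilon}(1+|\phi'(x)|^\beta)\pi(x)dx<\infty$ and $|f(x+\delta)-f(x)|\le K(x)\max(|\delta|^H,|\delta|^\gamma)$ for all $x,\delta$, for a function $K$ with $\int K(x)^2(1+|\phi'(x)|^\beta)\pi(x)dx<\infty$; (ii) $b\in\mathcal{C}^3(\mathbb{R})$ with $b',b'',b'''$ bounded; (iii) $\int z^2\mu(dz)=1$, $\int|z|^\xi\mu(dz)<\infty$ with $\xi=\max(6+3\epsilon,2+2H,2+2\gamma)$, and for some $C_\mu>0$ and all $a\in\mathbb{R}$, $\int e^{b(az)}|z|^\xi\mu(dz)\le C_\mu(1+|a|^\beta)\int e^{b(az)}\mu(dz)<\infty$. *)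

(* Defs.v *)
From HB Require Import structures.
From mathcomp Require Import all_boot all_order all_algebra.
From mathcomp Require Import all_classical all_reals all_analysis.
Set Implicit Arguments. Unset Strict Implicit. Unset Printing Implicit Defensive.
Import Order.TTheory GRing.Theory Num.Theory.
Import numFieldNormedType.Exports.
Local Open Scope classical_set_scope.
Local Open Scope ring_scope.

Definition dens (R : realType) (phi : R -> R) (x : R) : R := expR (phi x).

Definition bfun (R : realType) (g : R -> R) (x : R) : R := ln (g (expR x)).

Definition frakg (R : realType) (g : R -> R) : R := ((derive1n 2 g)) 1.

Definition balancing (R : realType) (g : R -> R) : Prop :=
  [/\ forall t, 0 <= t -> 0 <= g t, g 0 = 0,
      forall t, 0 < t -> g t = t * g t^-1 & g 1 = 1].

Definition moment (R : realType) (mu : probability R R) (k : nat) : R :=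
  fine (\int[mu]_z (z ^+ k)%:E)%E.

Definition Zs (R : realType) (phi g : R -> R) (mu : probability R R)
  (s x : R) : R :=
  fine (\int[mu]_z (g (expR (s * z * (derive1n 1 phi) x)))%:E)%E.

(** explicit log-Metropolis-Hastings ratio *)
Definition rho (R : realType) (phi g : R -> R) (mu : probability R R)
  (s x y : R) : R :=
  phi y - phi x + bfun g ((derive1n 1 phi) y * (x - y)) - bfun g ((derive1n 1 phi) x * (y - x))
  + ln (Zs phi g mu s x) - ln (Zs phi g mu s y).

(** E[h(X,Y)] for X ~ pi, Y ~ Q_s(X,.) : Y = X + s W, W ~ Z_s(X)^-1 g(e^{s w phi'(X)}) mu(dw) *)
Definition pairE (R : realType) (phi g : R -> R) (mu : probability R R)
  (s : R) (h : R -> R -> \bar R) : \bar R :=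
  (\int[lebesgue_measure]_x ((dens phi x)%:E *
     \int[mu]_w (h x (x + s * w)%R *
        (g (expR (s * w * (derive1n 1 phi) x)) / Zs phi g mu s x)%:E)))%E.

(** sumE s k f t = E[ f(t + sum_{i=1}^k rho_s(X_i, Y_i)) ] for i.i.d. pairs
    (X_i, Y_i) ~ pi(dx) Q_s(x, dy), written as an iterated integral (Fubini). *)
Fixpoint sumE (R : realType) (phi g : R -> R) (mu : probability R R)
  (s : R) (k : nat) (f : R -> R) (t : R) : R :=
  match k with
  | 0 => f t
  | k'.+1 => fine (pairE phi g mu s
                (fun x y => (sumE phi g mu s k' f (t + rho phi g mu s x y))%:E))
  end.

Definition piE (R : realType) (phi : R -> R) (f : R -> R) : R :=
  fine (\int[lebesgue_measure]_x ((f x * dens phi x)%:E))%E.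

Definition Aphi (R : realType) (phi : R -> R) : R :=
  piE phi (fun x => ((derive1n 3 phi) x) ^+ 2).
Definition Bphi (R : realType) (phi : R -> R) : R :=
  piE phi (fun x => ((derive1n 1 phi) x * (derive1n 2 phi) x) ^+ 2).
Definition Cphi (R : realType) (phi : R -> R) : R :=
  piE phi (fun x => (derive1n 1 phi) x * (derive1n 2 phi) x * (derive1n 3 phi) x).

Definition theta2 (R : realType) (phi g : R -> R) (mu : probability R R) : R :=
  let gg := frakg g in
  moment mu 6 * (Aphi phi / 144 + (4^-1 + gg) ^+ 2 * Bphi phi
                 - 6^-1 * (4^-1 + gg) * Cphi phi)
  + moment mu 4 * (6^-1 * (2^-1 + gg) * Cphi phi
                   - 2 * (4^-1 + gg) * (2^-1 + gg) * Bphi phi)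
  + (2^-1 + gg) ^+ 2 * Bphi phi.

Definition C3H (R : realType) (phi : R -> R) (H : R) : Prop :=
  [/\ forall x, derivable phi x 1, forall x, derivable (derive1n 1 phi) x 1,
      forall x, derivable (derive1n 2 phi) x 1, continuous (derive1n 3 phi) &
      forall M : R, exists C : R, forall x y, `|x| <= M -> `|y| <= M ->
        `|(derive1n 3 phi) x - (derive1n 3 phi) y| <= C * `|x - y| `^ H].

Definition Assumption1 (R : realType) (phi g : R -> R) (mu : probability R R)
  : Prop :=
  exists H gamma beta eps : R,
  [/\ 0 < H < 1, 0 < gamma, 0 <= beta, 0 < eps &
  let w := fun x => 1 + `|(derive1n 1 phi) x| `^ beta in
  let xi := Num.max (6 + 3 * eps) (Num.max (2 + 2 * H) (2 + 2 * gamma)) in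
  [/\
   C3H phi H,
   (forall f : R -> R,
     f = (derive1n 3 phi) \/ f = (fun x => (derive1n 2 phi) x * (derive1n 1 phi) x) \/
     f = (fun x => (derive1n 1 phi) x ^+ 3) \/
     f = (fun x => (derive1n 2 phi) x * `|(derive1n 1 phi) x| `^ (1 + beta)) ->
     lebesgue_measure.-integrable setT
        (fun x => (`|f x| `^ (2 + eps) * w x * dens phi x)%:E) /\
     exists K : R -> R,
       lebesgue_measure.-integrable setT
         (fun x => (K x ^+ 2 * w x * dens phi x)%:E) /\
       forall x delta, `|f (x + delta) - f x| <=
                       K x * Num.max (`|delta| `^ H) (`|delta| `^ gamma)),
   [/\ forall x, derivable (bfun g) x 1, forall x, derivable (derive1n 1 (bfun g)) x 1,
       forall x, derivable (derive1n 2 (bfun g)) x 1, continuous (derive1n 3 (bfun g)) &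
       exists M : R, forall x, [/\ `|(derive1n 1 (bfun g)) x| <= M,
                                  `|(derive1n 2 (bfun g)) x| <= M &
                                  `|(derive1n 3 (bfun g)) x| <= M]] &
   [/\ (\int[mu]_z (z ^+ 2)%:E = 1)%E,
       mu.-integrable setT (fun z => (`|z| `^ xi)%:E) &
       exists Cmu : R, 0 < Cmu /\ forall a : R,
         (\int[mu]_z (expR (bfun g (a * z)) * `|z| `^ xi)%:E
           <= (Cmu * (1 + `|a| `^ beta))%:E * \int[mu]_z (expR (bfun g (a * z)))%:E)%E
         /\ (\int[mu]_z (expR (bfun g (a * z)))%:E < +oo)%E]]].

(* Main.v *)
Require Import Defs.
From HB Require Import structures.
From mathcomp Require Import all_boot all_order all_algebra.
From mathcomp Require Import all_classical all_reals all_analysis.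
From mathcomp Require Import measurable_realfun ring lra.
Set Implicit Arguments. Unset Strict Implicit. Unset Printing Implicit Defensive.
Import Order.TTheory GRing.Theory Num.Theory.
Import numFieldNormedType.Exports.
Local Open Scope classical_set_scope.
Local Open Scope ring_scope.

(* Put h = s w and y = x + h, and write b(u) = u/2 + c(u); the balancing identity
   g(t) = t g(1/t) says that c is even. The linear parts of b turn phi(y) - phi(x) into the
   error of the trapezoidal rule for phi', and what remains of rho are increments of the even
   functions c and log Z between nearby points. Hence rho / s^3 converges pointwise to
   w^3 (b''(0) phi' phi'' - phi''' / 12) - (b''(0) + 1/4) phi' phi'' w, and the moment
   conditions (Jensen's inequality for log Z) dominate rho^2 / s^6, which gives
   E[rho^2] ~ theta^2 s^6.
   Reversibility, E[k(rho) e^rho] = E[k(-rho)], applied to a truncation k of r/2, yields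
   E[rho] = - E[rho^2] / 2 + o(s^6). The central limit theorem then follows by Lindeberg
   replacement: the law of a sum of i.i.d. copies is an iterate of an averaging operator,
   compared term by term with the Gaussian semigroup on functions whose second order Taylor
   remainder is controlled; a nonnegative continuous test function is approximated from below
   by Lipschitz functions of bounded support, themselves smoothed by a Gaussian. *)

(** * Averaging operators and Lindeberg replacement *)

(** The hypotheses control increments of products such as phi' phi'', not of phi' and phi''
    separately. What saves the third order is evenness: an even function with derivative O(t)
    changes between u and v by at most a multiple of |v^2 - u^2|, so small increments of c and of
    log Z pass through (phi')^2 and |phi'|^(2 + beta), whose derivatives are multiples of phi' phi''
    and of phi' phi'' |phi'|^beta. For log Z the weight e^b must first be replaced by its even part:
    this leaves Z unchanged because mu is symmetric, and the logarithm of that even part has second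
    derivative b''(0) + 1/4 at 0. Hence the two constants b''(0) = 1/4 + g''(1) and b''(0) + 1/4 =
    1/2 + g''(1) of the variance. Limits under the tilt are taken after a cut at |a| z^2 <= 1, with
    a = s phi'(x): inside, the tilt is bounded; outside, the powers of |z| between 6 and xi pay for
    it. The remaining part |s w| > 1 carries, after division by s^6, a factor s^(xi - 6), which
    makes it vanish. *)

Section integration.
Context {d : measure_display} {T : measurableType d} {R : realType}.
Variable m : {measure set T -> \bar R}.
Implicit Types f g : T -> R.

Lemma integrable_dom f g : measurable_fun setT f -> (forall x, `|f x| <= g x) ->
  m.-integrable setT (EFin \o g) -> m.-integrable setT (EFin \o f).
Proof.
move=> mf fg; apply: le_integrable => //; first exact/measurable_EFinP.
by move=> x _ /=; rewrite lee_fin (le_trans (fg x))// ler_norm.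
Qed.

Lemma integrable_meas f : m.-integrable setT (EFin \o f) -> measurable_fun setT f.
Proof. by move=> /integrableP[/measurable_EFinP]. Qed.

Lemma integrable_scale k f : m.-integrable setT (EFin \o f) ->
  m.-integrable setT (EFin \o (fun x => k * f x)).
Proof. by move=> /(integrableZl measurableT k). Qed.

Lemma dominated_Rintegral (f_ : nat -> T -> R) f g :
  (forall n, measurable_fun setT (f_ n)) -> m.-integrable setT (EFin \o g) ->
  (forall x, f_ n x @[n --> \oo] --> f x) -> (forall n x, `|f_ n x| <= g x) ->
  m.-integrable setT (EFin \o f) /\
  (\int[m]_x f_ n x @[n --> \oo] --> \int[m]_x f x).
Proof.
move=> mf_ ig cf bf.
have mf : measurable_fun setT f.
  by apply: (measurable_fun_cvg mf_) => x _; exact: cf.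
have [|||||H1 _ H2] := @dominated_convergence _ _ _ m setT measurableT
    (fun n => EFin \o f_ n) (EFin \o f) (EFin \o g) => //.
- by move=> n; exact/measurable_EFinP.
- exact/measurable_EFinP.
- by apply: aeW => x _; apply/fine_cvgP; split=> //=; [exact: nearW|exact: cf].
- by apply: aeW => x n _ /=; rewrite lee_fin.
split=> //; rewrite /Rintegral; apply: fine_cvg.
by rewrite fineK ?integrable_fin_num.
Qed.

End integration.

Section averaging.
Context {d : measure_display} {T : measurableType d} {R : realType}.
Variables (m : {sigma_finite_measure set T -> \bar R}) (q r : T -> R).
Hypotheses (q0 : forall p, 0 <= q p) (iq : m.-integrable setT (EFin \o q)).
Hypothesis mr : measurable_fun setT r.

Implicit Types f g : R -> R.

Definition bdd_meas (f : R -> R) :=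
  measurable_fun setT f /\ exists M, forall x, `|f x| <= M.

(* [E (f (t + r))] when the underlying point has density [q] with respect to [m]: the [n]-th
   iterate is the expectation of [f] at [t] plus a sum of [n] independent copies of [r]. *)
Definition avg (f : R -> R) (t : R) := \int[m]_p (f (t + r p) * q p).

Let mq : measurable_fun setT q. Proof. exact: integrable_meas iq. Qed.

Lemma avg_integrable f t : bdd_meas f ->
  m.-integrable setT (EFin \o (fun p => f (t + r p) * q p)).
Proof.
move=> [mf [M fM]]; apply: (@integrable_dom _ _ _ _ _ (fun p => M * q p)).
- apply: measurable_funM => //; apply: measurableT_comp => //.
  exact: measurable_funD.
- by move=> p; rewrite normrM (ger0_norm (q0 p)) ler_wpM2r.
- exact: integrable_scale.
Qed.

Lemma avg_bound f M t : measurable_fun setT f -> (forall x, `|f x| <= M) ->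
  `|avg f t| <= M * \int[m]_p q p.
Proof.
move=> mf fM; have ifq : bdd_meas f by split=> //; exists M.
apply: le_trans (le_normr_Rintegral _ _) _ => //; first exact: avg_integrable.
rewrite -RintegralZl//; apply: le_Rintegral => //.
- by apply: (@integrable_norm _ _ _ m); exact: avg_integrable.
- exact: integrable_scale.
- by move=> p _; rewrite normrM (ger0_norm (q0 p)) ler_wpM2r.
Qed.

Lemma avgB f g t : bdd_meas f -> bdd_meas g ->
  avg f t - avg g t = avg (fun x => f x - g x) t.
Proof.
move=> bf bg; rewrite /avg -RintegralB//; try exact: avg_integrable.
by apply: eq_Rintegral => p _; rewrite mulrBl.
Qed.

Lemma le_avg f g t : bdd_meas f -> bdd_meas g -> (forall x, f x <= g x) ->
  avg f t <= avg g t.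
Proof.
move=> bf bg fg; apply: le_Rintegral => //; try exact: avg_integrable.
by move=> p _; rewrite ler_wpM2r.
Qed.

Lemma avg_bdd_meas f : bdd_meas f -> bdd_meas (avg f).
Proof.
move=> bf; have [mf [M fM]] := bf.
split; last first.
  by exists (M * \int[m]_p q p) => t; exact: avg_bound.
(* Adding the bound [M] makes the integrand nonnegative, so that Tonelli gives measurability in [t];
   the constant is subtracted afterwards. *)
pose F (z : R * T) := ((f (z.1 + r z.2) + M) * q z.2)%:E.
have F0 z : (0 <= F z)%E.
  by rewrite lee_fin mulr_ge0// -lerBlDr sub0r; have := fM (z.1 + r z.2);
     rewrite ler_norml => /andP[].
have mF : measurable_fun setT F.
  apply/measurable_EFinP; apply: measurable_funM.
    apply: measurable_funD => //; apply: measurableT_comp => //.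
    by apply: measurable_funD => //; exact: measurableT_comp.
  exact: measurableT_comp.
have := measurable_fun_fubini_tonelli_F (m2 := m) F mF F0.
move=> mG.
rewrite (_ : avg f = fun t => fine (fubini_F m F t) - M * \int[m]_p q p).
  apply: measurable_funB => //.
  by apply: measurableT_comp mG => //; exact: measurable_fine.
apply/funext => t; rewrite /fubini_F /F /=.
rewrite -RintegralZl// -[fine _]/(\int[m]_p _) -RintegralB//.
- by apply: eq_Rintegral => p _; rewrite mulrDl addrK.
- have := integrableD measurableT (avg_integrable t bf)
    (integrable_scale M iq).
  apply: eq_integrable => // p _ /=.
  by rewrite mulrDl EFinD.
- exact: integrable_scale.
Qed.

End averaging.

Section bounded_measurable.
Context {R : realType}.
Implicit Types f g : R -> R.

Lemma bdd_measD f g : bdd_meas f -> bdd_meas g -> bdd_meas (fun x => f x + g x).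
Proof.
move=> [mf [M fM]] [mg [N gN]]; split; first exact: measurable_funD.
by exists (M + N) => x; rewrite (le_trans (ler_normD _ _))// lerD.
Qed.

Lemma bdd_measZ k f : bdd_meas f -> bdd_meas (fun x => k * f x).
Proof.
move=> [mf [M fM]]; split; first exact: measurable_funM.
by exists (`|k| * M) => x; rewrite normrM ler_wpM2l.
Qed.

Lemma bdd_measB f g : bdd_meas f -> bdd_meas g -> bdd_meas (fun x => f x - g x).
Proof.
move=> bf /(@bdd_measZ (-1)) /(bdd_measD bf).
by under eq_fun do rewrite mulN1r.
Qed.

Lemma bdd_meas_shift s f : bdd_meas f -> bdd_meas (fun x => f (x + s)).
Proof.
move=> [mf [M fM]]; split; last by exists M.
by apply: measurableT_comp => //; exact: measurable_funD.
Qed.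

(* The remainder of the order-2 Taylor expansion is controlled by [tcut],
   cubic near the origin and quadratic at infinity. *)
Definition tcut (r : R) := Num.min (`|r| ^+ 3) (r ^+ 2).

Lemma tcut_ge0 r : 0 <= tcut r.
Proof. by rewrite /tcut le_min exprn_ge0//= sqr_ge0. Qed.

Lemma tcut_le r : tcut r <= r ^+ 2.
Proof. by rewrite /tcut ge_min lexx orbT. Qed.

Lemma tcut_le3 r : tcut r <= `|r| ^+ 3.
Proof. by rewrite /tcut ge_min lexx. Qed.

Lemma measurable_tcut : measurable_fun setT tcut.
Proof.
by apply: measurable_minr => //; apply: measurable_funX; exact: normr_measurable.
Qed.

Definition taylor2 C (h h1 h2 : R -> R) :=
  [/\ measurable_fun setT h, measurable_fun setT h1 & measurable_fun setT h2] /\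
  [/\ forall x, `|h x| <= C, forall x, `|h1 x| <= C, forall x, `|h2 x| <= C &
   forall t s, `|h (t + s) - (h t + s * h1 t + s ^+ 2 / 2 * h2 t)| <= C * tcut s].

End bounded_measurable.

Section averaging_taylor.
Context {d : measure_display} {T : measurableType d} {R : realType}.
Variables (m : {sigma_finite_measure set T -> \bar R}) (q r : T -> R).
Hypotheses (q0 : forall p, 0 <= q p) (iq : m.-integrable setT (EFin \o q)).
Hypothesis mr : measurable_fun setT r.
Implicit Types f g : R -> R.
Local Notation avg := (avg m q r).

Lemma avgZ k f t : bdd_meas f -> avg (fun x => k * f x) t = k * avg f t.
Proof.
move=> bf; rewrite /avg -RintegralZl//; last exact: avg_integrable.
by apply: eq_Rintegral => p _; rewrite mulrA.
Qed.

Lemma avgD f g t : bdd_meas f -> bdd_meas g ->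
  avg (fun x => f x + g x) t = avg f t + avg g t.
Proof.
move=> bf bg; rewrite /avg -RintegralD//; try exact: avg_integrable.
by apply: eq_Rintegral => p _; rewrite mulrDl.
Qed.

Lemma avg_shift f s t : avg (fun x => f (x + s)) t = avg f (t + s).
Proof. by apply: eq_Rintegral => p _; rewrite addrAC. Qed.

(** Averaging is linear and commutes with translations, so the Taylor inequality may be integrated.
    The mass of [q] is left general: besides probability densities, an arbitrary nonnegative
    integrable function takes the role of [q] in the smoothing step. *)
Lemma taylor2_avg C h h1 h2 : taylor2 C h h1 h2 ->
  taylor2 (C * \int[m]_p q p) (avg h) (avg h1) (avg h2).
Proof.
move=> [[mh mh1 mh2] [bh bh1 bh2 th]].
have Bh : bdd_meas h by split=> //; exists C.
have Bh1 : bdd_meas h1 by split=> //; exists C.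
have Bh2 : bdd_meas h2 by split=> //; exists C.
split; first by split; apply avg_bdd_meas.
split; try by move=> t; exact: avg_bound.
move=> t s.
have B12 := bdd_measD (bdd_measD Bh (bdd_measZ s Bh1)) (bdd_measZ (s ^+ 2 / 2) Bh2).
rewrite -(avgZ s)// -(avgZ (s ^+ 2 / 2))// -avg_shift -!avgD//;
  try by repeat (first [assumption | exact: bdd_measZ | apply: bdd_measD]).
rewrite avgB//; last exact: bdd_meas_shift.
rewrite [leRHS]mulrAC; apply: avg_bound => //.
by case: (bdd_measB (bdd_meas_shift s Bh) B12).
Qed.

Hypothesis q1 : \int[m]_p q p = 1.
Hypothesis r2 : m.-integrable setT (EFin \o (fun p => r p ^+ 2 * q p)).

Let mq : measurable_fun setT q. Proof. exact: integrable_meas iq. Qed.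

Lemma integrable_first_moment : m.-integrable setT (EFin \o (fun p => r p * q p)).
Proof.
apply: (@integrable_dom _ _ _ _ _ (fun p => q p + r p ^+ 2 * q p)).
- exact: measurable_funM.
- move=> p; rewrite normrM (ger0_norm (q0 p)) -{2}(mul1r (q p)) -mulrDl.
  rewrite ler_wpM2r// -[leRHS]addrC -(real_normK (num_real (r p))).
  by have := sqr_ge0 (`|r p| - 1); nra.
- have := integrableD measurableT iq r2; exact: eq_integrable.
Qed.

Lemma integrable_tcut : m.-integrable setT (EFin \o (fun p => tcut (r p) * q p)).
Proof.
apply: (integrable_dom _ _ r2).
  by apply: measurable_funM => //; apply: measurableT_comp => //; exact: measurable_tcut.
move=> p; rewrite ger0_norm ?mulr_ge0 ?tcut_ge0//.
by rewrite ler_wpM2r// tcut_le.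
Qed.

Lemma avg_expansion C h h1 h2 t : taylor2 C h h1 h2 ->
  `|avg h t - (h t + h1 t * (\int[m]_p (r p * q p))
                   + h2 t / 2 * (\int[m]_p (r p ^+ 2 * q p)))|
  <= C * \int[m]_p (tcut (r p) * q p).
Proof.
move=> [[mh mh1 mh2] [bh bh1 bh2 th]].
have Bh : bdd_meas h by split=> //; exists C.
have i1 := integrable_first_moment.
have ia := avg_integrable q0 iq mr t Bh.
have j0 := integrable_scale (h t) iq.
have j1 := integrable_scale (h1 t) i1.
have j2 := integrable_scale (h2 t / 2) r2.
have j01 : m.-integrable setT (EFin \o (fun p => h t * q p + h1 t * (r p * q p))).
  by have := integrableD measurableT j0 j1; exact: eq_integrable.
have j012 : m.-integrable setT (EFin \o (fun p => h t * q p + h1 t * (r p * q p)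
    + h2 t / 2 * (r p ^+ 2 * q p))).
  by have := integrableD measurableT j01 j2; exact: eq_integrable.
have -> : h t + h1 t * (\int[m]_p (r p * q p))
    + h2 t / 2 * (\int[m]_p (r p ^+ 2 * q p)) =
    \int[m]_p (h t * q p + h1 t * (r p * q p) + h2 t / 2 * (r p ^+ 2 * q p)).
  by rewrite (RintegralD measurableT j01 j2) (RintegralD measurableT j0 j1)
     !RintegralZl// q1 mulr1.
rewrite -RintegralB//.
apply: le_trans (le_normr_Rintegral _ _) _ => //.
  by have := integrableB measurableT ia j012; exact: eq_integrable.
rewrite -RintegralZl//; last exact: integrable_tcut.
apply: le_Rintegral => //.
- apply: (@integrable_norm _ _ _ m).
  by have := integrableB measurableT ia j012; exact: eq_integrable.
- exact/integrable_scale/integrable_tcut.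
move=> p _.
rewrite (_ : _ - _ = (h (t + r p) -
  (h t + r p * h1 t + r p ^+ 2 / 2 * h2 t)) * q p); last by ring.
by rewrite normrM (ger0_norm (q0 p)) mulrA ler_wpM2r.
Qed.

End averaging_taylor.

Section iterated_averaging.
Context {d : measure_display} {T : measurableType d} {R : realType}.
Variables (m : {sigma_finite_measure set T -> \bar R}) (q r : T -> R).
Hypotheses (q0 : forall p, 0 <= q p) (iq : m.-integrable setT (EFin \o q)).
Hypotheses (mr : measurable_fun setT r) (q1 : \int[m]_p q p = 1).
Implicit Types f g : R -> R.
Local Notation A := (avg m q r).

Lemma iter_avg_bdd_meas k f : bdd_meas f -> bdd_meas (iter k A f).
Proof. by move=> bf; elim: k => // k IH; exact: avg_bdd_meas. Qed.

Lemma iter_avg_le k f g t : bdd_meas f -> bdd_meas g -> (forall x, f x <= g x) ->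
  iter k A f t <= iter k A g t.
Proof.
move=> bf bg fg; elim: k t => // k IH t; rewrite !iterS.
by apply: le_avg => //; exact: iter_avg_bdd_meas.
Qed.

Lemma iter_avg_close k f g e t : bdd_meas f -> bdd_meas g ->
  (forall x, `|f x - g x| <= e) -> `|iter k A f t - iter k A g t| <= e.
Proof.
move=> bf bg fg; elim: k t => // k IH t; rewrite !iterS.
have Bf := iter_avg_bdd_meas k bf; have Bg := iter_avg_bdd_meas k bg.
rewrite avgB// -[e]mulr1 -[X in _ <= _ * X]q1; apply: avg_bound => //.
by case: (bdd_measB Bf Bg).
Qed.

Lemma bdd_meas_cst c : bdd_meas (fun=> c : R).
Proof. by split; [exact: measurable_cst|exists `|c|]. Qed.

Lemma iter_avg_addc k f c t : bdd_meas f ->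
  iter k A (fun x => f x + c) t = iter k A f t + c.
Proof.
move=> bf; elim: k t => // k IH t; rewrite !iterS.
rewrite (_ : iter k A (fun x => f x + c) = fun x => iter k A f x + c); last exact/funext.
rewrite avgD//; last exact: bdd_meas_cst.
  by rewrite [X in _ + X]/avg RintegralZl// q1 mulr1.
exact: iter_avg_bdd_meas.
Qed.

Lemma iter_avgN k f t : bdd_meas f -> iter k A (fun x => - f x) t = - iter k A f t.
Proof.
move=> bf; elim: k t => // k IH t; rewrite !iterS.
rewrite (_ : iter k A (fun x => - f x) = fun x => -1 * iter k A f x); last first.
  by apply/funext => x; rewrite IH mulN1r.
by rewrite avgZ ?mulN1r//; exact: iter_avg_bdd_meas.
Qed.

End iterated_averaging.

Section lindeberg.
Context {d d' : measure_display} {T : measurableType d} {T' : measurableType d'}.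
Context {R : realType}.
Variables (m : {sigma_finite_measure set T -> \bar R}) (q r : T -> R).
Hypotheses (q0 : forall p, 0 <= q p) (iq : m.-integrable setT (EFin \o q)).
Hypotheses (mr : measurable_fun setT r) (q1 : \int[m]_p q p = 1).
Hypothesis r2 : m.-integrable setT (EFin \o (fun p => r p ^+ 2 * q p)).
Variables (m' : {sigma_finite_measure set T' -> \bar R}) (q' r' : T' -> R).
Hypotheses (q'0 : forall p, 0 <= q' p) (iq' : m'.-integrable setT (EFin \o q')).
Hypotheses (mr' : measurable_fun setT r') (q'1 : \int[m']_p q' p = 1).
Hypothesis r'2 : m'.-integrable setT (EFin \o (fun p => r' p ^+ 2 * q' p)).

(** Telescoping: one step of [r] is exchanged for one step of [r'] at a time, each exchange costing
    the same amount by the two second order expansions. The bound keeps the differences of the first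
    and second moments, so the two laws need not match exactly. *)
Lemma lindeberg C h h1 h2 k t : taylor2 C h h1 h2 ->
  `|iter k (avg m q r) h t - iter k (avg m' q' r') h t| <=
  k%:R * (C * (`|\int[m]_p (r p * q p) - \int[m']_p (r' p * q' p)|
    + `|\int[m]_p (r p ^+ 2 * q p) - \int[m']_p (r' p ^+ 2 * q' p)|
    + \int[m]_p (tcut (r p) * q p) + \int[m']_p (tcut (r' p) * q' p))).
Proof.
set D := (X in _ * X); move=> th.
have C0 : 0 <= C by case: th => _ [+ _ _ _] => /(_ 0); apply: le_trans.
have Bh : bdd_meas h by case: th => [[? _ _] [? _ _ _]]; split=> //; exists C.
have step h' h1' h2' x : taylor2 C h' h1' h2' ->
    `|avg m q r h' x - avg m' q' r' h' x| <= D.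
  move=> th'.
  have e1 := avg_expansion q0 iq mr q1 r2 x th'.
  have e2 := avg_expansion q'0 iq' mr' q'1 r'2 x th'.
  case: th' => _ [_ /(_ x) b1 /(_ x) b2 _].
  set a := avg m q r h' x in e1 *; set a' := avg m' q' r' h' x in e2 *.
  rewrite /D; move: e1 e2.
  set M1 := \int[m]_p (r p * q p); set M1' := \int[m']_p (r' p * q' p).
  set M2 := \int[m]_p (r p ^+ 2 * q p); set M2' := \int[m']_p (r' p ^+ 2 * q' p).
  set t1 := \int[m]_p _; set t2 := \int[m']_p _ => e1 e2.
  rewrite (_ : a - a' = (a - (h' x + h1' x * M1 + h2' x / 2 * M2))
    - (a' - (h' x + h1' x * M1' + h2' x / 2 * M2'))
    + h1' x * (M1 - M1') + h2' x / 2 * (M2 - M2')); last by ring.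
  rewrite (le_trans (ler_normD _ _))//.
  rewrite (_ : C * _ = C * t1 + C * t2 + C * `|M1 - M1'| + C * `|M2 - M2'|);
    last by ring.
  apply: lerD; last first.
    rewrite !normrM ler_wpM2r// normfV (ger0_norm (ler0n _ 2)).
    by have := normr_ge0 (h2' x); move: b2; lra.
  rewrite (le_trans (ler_normD _ _))// lerD//; last by rewrite normrM ler_wpM2r.
  by rewrite (le_trans (ler_normB _ _))// lerD.
(* The constant [C] does not grow along the iteration because [q'] has mass 1. *)
have tk j : exists h1' h2', taylor2 C (iter j (avg m' q' r') h) h1' h2'.
  elim: j => [|j [g1 [g2 IH]]]; first by exists h1, h2.
  by do 2 eexists; have := taylor2_avg q'0 iq' mr' IH; rewrite q'1 mulr1; exact.
elim: k t => [|k IH] t /=; first by rewrite subrr normr0 mul0r.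
have [g1 [g2 tg]] := tk k.
have Bk : bdd_meas (iter k (avg m' q' r') h).
  by case: tg => [[? _ _] [? _ _ _]]; split=> //; exists C.
have BAk := iter_avg_bdd_meas q0 iq mr k Bh.
(* The intermediate term applies the first operator once to the [k]-th iterate of the second: the
   difference on one side is an average of the induction hypothesis, on the other a single
   exchange. *)
rewrite -(subrKA (avg m q r (iter k (avg m' q' r') h) t)) avgB//.
rewrite (le_trans (ler_normD _ _))// -natr1 mulrDl mul1r lerD//; last exact: step tg.
rewrite -[leRHS]mulr1 -[X in _ <= _ * X]q1; apply: avg_bound => //.
  by case: (bdd_measB BAk Bk).
Qed.

End lindeberg.

(** * Integration on the real line and the Gaussian semigroup *)

Section invariant_measure.
Context {d : measure_display} {T : measurableType d} {R : realType}.
Variables (m : {measure set T -> \bar R}) (phi : T -> T).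
Hypothesis mphi : measurable_fun setT phi.
Hypothesis phiE : forall A, measurable A -> m (phi @^-1` A) = m A.

Lemma ge0_integral_invariant (f : T -> \bar R) :
  measurable_fun setT f -> (forall x, 0 <= f x)%E ->
  (\int[m]_x f (phi x) = \int[m]_x f x)%E.
Proof.
move=> mf f0; rewrite -[LHS](@ge0_integral_pushforward _ _ _ _ _ _ mphi m setT f)//.
by apply: eq_measure_integral => A mA _; rewrite /= /pushforward phiE.
Qed.

Lemma integrable_invariant (f : T -> R) :
  m.-integrable setT (EFin \o f) -> m.-integrable setT (EFin \o (f \o phi)).
Proof.
move=> /integrableP[mf fi]; apply/integrableP; split.
  by apply/measurable_EFinP; apply: measurableT_comp => //; exact/measurable_EFinP.
by rewrite /= (@ge0_integral_invariant (fun x => `|(f x)%:E|)%E)//; exact: measurableT_comp.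
Qed.

Lemma Rintegral_invariant (f : T -> R) : m.-integrable setT (EFin \o f) ->
  \int[m]_x f (phi x) = \int[m]_x f x.
Proof.
move=> fi; rewrite /Rintegral; congr fine.
have mf : measurable_fun setT (EFin \o f) by case/integrableP : fi.
have fiphi := integrable_invariant fi.
rewrite -[LHS](@integral_pushforward _ _ _ _ _ _ mphi m setT (EFin \o f))//.
by apply: eq_measure_integral => A mA _; rewrite /= /pushforward phiE.
Qed.

End invariant_measure.

Section lebesgue_invariance.
Context {R : realType}.
Local Notation lebesgue := (@lebesgue_measure R).

Lemma lebesgue_measure_translate (c : R) (A : set R) : measurable A ->
  lebesgue ((fun x => x + c) @^-1` A) = lebesgue A.
Proof.
move=> mA.
have mc : measurable_fun [set: measurableTypeR R]
   ((fun x => x + c) : measurableTypeR R -> measurableTypeR R).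
  exact: measurable_funD.
suff : pushforward lebesgue ((fun x => x + c) : _ -> measurableTypeR R) A = lebesgue A by [].
apply/esym/lebesgue_measure_unique => //= _ [[a b]] _ <-.
rewrite /pushforward/=.
rewrite (_ : _ @^-1` _ = `](a - c), (b - c)]%classic); last first.
  by apply/seteqP; split=> x /=; rewrite !in_itv/= ltrBlDr lerBrDr.
rewrite !lebesgue_measure_itv/= !lte_fin ltrD2r.
by rewrite -!EFinB opprB addrA subrK.
Qed.

Lemma lebesgue_measure_opp (A : set R) : measurable A ->
  lebesgue ((fun x => - x) @^-1` A) = lebesgue A.
Proof. exact: lebesgue_measureN. Qed.

Lemma Rintegral_translate c (f : R -> R) : lebesgue.-integrable setT (EFin \o f) ->
  \int[lebesgue]_x f (x + c) = \int[lebesgue]_x f x.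
Proof.
move=> fi; apply: (@Rintegral_invariant _ (measurableTypeR R) _ lebesgue (fun x => x + c) _ _ f) => //.
  exact: measurable_funD.
exact: lebesgue_measure_translate.
Qed.

Lemma integrable_translate c (f : R -> R) : lebesgue.-integrable setT (EFin \o f) ->
  lebesgue.-integrable setT (EFin \o (fun x => f (x + c))).
Proof.
apply: (@integrable_invariant _ (measurableTypeR R) _ lebesgue (fun x => x + c)).
  exact: measurable_funD.
exact: lebesgue_measure_translate.
Qed.

End lebesgue_invariance.

Section normal_density.
Context {R : realType}.
Local Notation lebesgue := (@lebesgue_measure R).
Local Notation npdf := (@normal_pdf R).

Lemma normal_pdf_center (m s x : R) : s != 0 -> npdf m s x = npdf 0 s (x - m).
Proof. by move=> s0; rewrite !normal_pdfE// /normal_fun subr0. Qed.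

Lemma normal_pdf_even (s x : R) : s != 0 -> npdf 0 s (- x) = npdf 0 s x.
Proof. by move=> s0; rewrite !normal_pdfE// /normal_fun !subr0 sqrrN. Qed.

Lemma Rintegral_normal_pdf (m s : R) : \int[lebesgue]_x npdf m s x = 1.
Proof. by rewrite /Rintegral integral_normal_pdf. Qed.

(** Completing the square: if [x] and [z - x] are independent normal variables, the joint density of
    [x] and [z] factors as the density of the sum [z] times the conditional density of [x] given
    [z]. *)
Lemma normal_pdf_mul (m1 m2 s1 s2 s x z : R) : 0 < s1 -> 0 < s2 -> 0 < s ->
  s ^+ 2 = s1 ^+ 2 + s2 ^+ 2 ->
  npdf m2 s2 (z - x) * npdf m1 s1 x =
  npdf (m1 + m2) s z *
  npdf (m1 + s1 ^+ 2 / s ^+ 2 * (z - m1 - m2)) (s1 * s2 / s) x.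
Proof.
move=> s1p s2p sp sE.
have c0 : 0 < s1 * s2 / s by rewrite divr_gt0// mulr_gt0.
rewrite !normal_pdfE ?gt_eqF// mulrACA [in RHS]mulrACA; congr (_ * _).
  rewrite /normal_peak -!invfM; congr (_^-1).
  rewrite -!sqrtrM; try by rewrite pmulrn_lge0// mulr_ge0 ?sqr_ge0 ?pi_ge0.
  congr (Num.sqrt _); rewrite !mulr2n; field.
  exact: lt0r_neq0.
rewrite /normal_fun -!expRD; congr expR.
rewrite !mulr2n !exprMn exprVn sE.
field.
have p1 : 0 < s1 ^+ 2 by rewrite exprn_gt0.
have p2 : 0 < s2 ^+ 2 by rewrite exprn_gt0.
have p12 : 0 < (s1 * s2) ^+ 2 by rewrite exprn_gt0// mulr_gt0.
by rewrite !lt0r_neq0// !addr_gt0.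
Qed.

(** With v = |u| / s, doubling the deviation leaves a spare factor exp(-3 v^2 / 8), which absorbs
    v^k. The constant is 32 for this absorption times 2 for the ratio of the peaks. Domination by
    another normal density serves at once for integrability, moments and decay. *)
Lemma normal_pdf_cubic (s u : R) (k : nat) : 0 < s -> (k <= 3)%N ->
  `|u| ^+ k * npdf 0 s u <= 64 * s ^+ k * npdf 0 (2 * s) u.
Proof.
move=> s0 k3.
have s20 : 0 < 2 * s by rewrite mulr_gt0.
rewrite !normal_pdfE ?gt_eqF// /normal_peak.
rewrite (_ : (2 * s) ^+ 2 * pi *+ 2 = 2 ^+ 2 * (s ^+ 2 * pi *+ 2)); last first.
  by rewrite exprMn -!mulrnAr !mulrA.
rewrite sqrtrM ?sqr_ge0// sqrtr_sqr (ger0_norm (ler0n _ 2)) invfM.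
set P := (Num.sqrt _)^-1.
have P0 : 0 <= P by rewrite invr_ge0 sqrtr_ge0.
rewrite /normal_fun !subr0.
pose v := `|u| / s.
have v0 : 0 <= v by rewrite divr_ge0// ltW.
have uE : `|u| = v * s by rewrite divfK// gt_eqF.
have u2E : u ^+ 2 = v ^+ 2 * s ^+ 2 by rewrite -exprMn -uE real_normK ?num_real.
have -> : - u ^+ 2 / (s ^+ 2 *+ 2) = - (3 / 8 * v ^+ 2) + - (v ^+ 2 / 8).
  by rewrite u2E -mulr_natr; field; exact: lt0r_neq0.
have -> : - u ^+ 2 / ((2 * s) ^+ 2 *+ 2) = - (v ^+ 2 / 8).
  by rewrite u2E exprMn -mulr_natr; field; exact: lt0r_neq0.
rewrite expRD uE exprMn; set E := expR (- (v ^+ 2 / 8)).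
have E0 : 0 <= E by exact: expR_ge0.
have sk0 : 0 <= s ^+ k by rewrite exprn_ge0// ltW.
rewrite (_ : v ^+ k * s ^+ k * _ = v ^+ k * expR (- (3 / 8 * v ^+ 2)) * (s ^+ k * P * E));
  last by ring.
rewrite (_ : 64 * s ^+ k * _ = 32 * (s ^+ k * P * E)); last by field.
rewrite ler_wpM2r ?mulr_ge0//.
rewrite expRN ler_pdivrMr ?expR_gt0//.
(* Squaring 1 + x <= exp x yields a polynomial of degree four in [v], enough for [k <= 3]. *)
have -> : expR (3 / 8 * v ^+ 2) = expR (3 / 16 * v ^+ 2) ^+ 2.
  by rewrite -expRM_natl; congr expR; rewrite -mulr_natl; field.
have h1 : 1 + 3 / 16 * v ^+ 2 <= expR (3 / 16 * v ^+ 2) by exact: expR_ge1Dx.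
apply: (@le_trans _ _ (32 * (1 + 3 / 16 * v ^+ 2) ^+ 2)); last first.
  by rewrite ler_pM2l// lerXn2r ?nnegrE ?expR_ge0// addr_ge0// mulr_ge0// sqr_ge0.
case: k k3 {sk0} => [|[|[|[|]]]]//= _; rewrite ?expr0 ?expr1; nra.
Qed.

Lemma integrable_normal_moment (s : R) (k : nat) : 0 < s -> (k <= 3)%N ->
  lebesgue.-integrable setT (EFin \o (fun u => u ^+ k * npdf 0 s u)).
Proof.
move=> s0 k3.
apply: (@integrable_dom _ (measurableTypeR R) _ lebesgue _ (fun u => 64 * s ^+ k * npdf 0 (2 * s) u)).
- by apply: measurable_funM => //; exact: measurable_normal_pdf.
- move=> u; rewrite normrM normrX (ger0_norm (normal_pdf_ge0 _ _ _)).
  exact: normal_pdf_cubic.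
- exact/integrable_scale/integrable_normal_pdf.
Qed.

Lemma normal_first_moment (s : R) : 0 < s ->
  \int[lebesgue]_u (u * npdf 0 s u) = 0.
Proof.
move=> s0; have i1 := integrable_normal_moment s0 (isT : (1 <= 3)%N).
have : \int[lebesgue]_u (- u * npdf 0 s (- u)) = \int[lebesgue]_u (u * npdf 0 s u).
  apply: (@Rintegral_invariant _ (measurableTypeR R) _ lebesgue -%R _ _ (fun u => u * npdf 0 s u)) => //.
  exact: lebesgue_measure_opp.
under eq_Rintegral do rewrite normal_pdf_even ?gt_eqF// -[- _]mulN1r -mulrA.
by rewrite RintegralZl//; lra.
Qed.

End normal_density.

(** * Derivatives and the mean value theorem in one variable *)

Section real_derivatives.
Context {R : realType}.
Implicit Types (f g : R -> R) (x a b k : R).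

Lemma is_deriveDf f g x a b : is_derive x 1 f a -> is_derive x 1 g b ->
  is_derive x 1 (fun y => f y + g y) (a + b).
Proof. exact: is_deriveD. Qed.

Lemma is_deriveBf f g x a b : is_derive x 1 f a -> is_derive x 1 g b ->
  is_derive x 1 (fun y => f y - g y) (a - b).
Proof. exact: is_deriveB. Qed.

Lemma is_deriveMf f g x a b : is_derive x 1 f a -> is_derive x 1 g b ->
  is_derive x 1 (fun y => f y * g y) (a * g x + f x * b).
Proof.
move=> df dg.
have H : is_derive x 1 (fun y => f y * g y) (f x *: b + g x *: a) := is_deriveM df dg.
apply: (is_derive_eq H); by rewrite /GRing.scale/=; ring.
Qed.

Lemma is_deriveZf f x a k : is_derive x 1 f a -> is_derive x 1 (fun y => k * f y) (k * a).
Proof. exact: is_deriveZ. Qed.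

Lemma is_deriveCf f g x a b : is_derive (g x) 1 f a -> is_derive x 1 g b ->
  is_derive x 1 (fun y => f (g y)) (a * b).
Proof. exact: is_derive1_comp. Qed.

Lemma is_derive_idf x : is_derive x 1 (fun y : R => y) 1.
Proof. exact: is_derive_id. Qed.

Lemma is_derive_cstf x k : is_derive x 1 (fun _ : R => k) 0.
Proof. exact: is_derive_cst. Qed.

Lemma is_derive_sqrf x : is_derive x 1 (fun y : R => y ^+ 2) (2 * x).
Proof.
have H : is_derive x 1 (fun y : R => y ^+ 2) _ :=
  is_deriveMf (is_derive_idf x) (is_derive_idf x).
by apply: (is_derive_eq H); ring.
Qed.

Lemma is_derive_continuous f x a : is_derive x 1 f a -> {for x, continuous f}.
Proof.
by move=> df; apply/differentiable_continuous/derivable1_diffP; exact: (@ex_derive _ _ _ _ _ _ _ df).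
Qed.

Lemma derivable_is_derive1 f x : derivable f x 1 -> is_derive x 1 f (derive1 f x).
Proof. by move=> df; rewrite derive1E; exact: derivableP. Qed.

Lemma is_derive1E f x a : is_derive x 1 f a -> derive1 f x = a.
Proof. by move=> df; rewrite derive1E; exact: (@derive_val _ _ _ _ _ _ _ df). Qed.

Lemma mean_value01 f (df : R -> R) x (h : R) : (forall y : R, is_derive y 1 f (df y)) ->
  exists2 u, 0 <= u <= 1 & f (x + h) - f x = h * df (x + u * h).
Proof.
move=> d; have cf : continuous f by move=> y; exact: is_derive_continuous (d y).
have [h0|h0|->] := ltgtP h 0; last first.
- by exists 0; rewrite ?lexx ?ler01// mulr0 !addr0 subrr mul0r.
- have le1 : x <= x + h by rewrite lerDl ltW.
  have [c] := MVT_segment le1 (fun y _ => d y) (continuous_subspaceT cf).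
  rewrite in_itv/= => /andP[c1 c2] E; exists ((c - x) / h).
    by rewrite divr_ge0 ?subr_ge0 ?(ltW h0)//= ler_pdivrMr// mul1r lerBlDl.
  by rewrite E divfK ?gt_eqF// subrKC; ring.
have le1 : x + h <= x by rewrite gerDl ltW.
have [c] := MVT_segment le1 (fun y _ => d y) (continuous_subspaceT cf).
rewrite in_itv/= => /andP[c1 c2] E; exists ((c - x) / h).
  rewrite ler_ndivrMr// mul1r -mulrNN -invrN divr_ge0 ?oppr_ge0 ?subr_le0 ?(ltW h0)//=.
  by rewrite lerBrDl.
by rewrite divfK ?lt_eqF// subrKC -opprB E; ring.
Qed.

Lemma mean_value f (df : R -> R) x (h : R) : (forall y : R, is_derive y 1 f (df y)) ->
  exists2 u, `|u| <= `|h| & f (x + h) - f x = h * df (x + u).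
Proof.
move=> /(mean_value01 x h)[u /andP[u0 u1] ->]; exists (u * h) => //.
by rewrite normrM ger0_norm// ler_piMl.
Qed.

End real_derivatives.

Section normal_moments.
Context {R : realType}.
Local Notation lebesgue := (@lebesgue_measure R).
Local Notation npdf := (@normal_pdf R).

Lemma is_derive_normal_pdf (s x : R) : 0 < s ->
  is_derive x 1 (npdf 0 s) (- (x / s ^+ 2) * npdf 0 s x).
Proof.
move=> s0; have sn : s != 0 by rewrite gt_eqF.
rewrite normal_pdfE//.
pose u y : R := - (y ^+ 2) / (s ^+ 2 *+ 2).
rewrite (_ : (fun x0 => normal_peak s * normal_fun 0 s x0) =
  (fun y => normal_peak s * expR (u y))); last first.
  by apply/funext => y; rewrite /normal_fun subr0.
have du : is_derive x 1 u (- (x / s ^+ 2)).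
  rewrite (_ : u = fun y => - (s ^+ 2 *+ 2)^-1 * y ^+ 2); last first.
    by apply/funext => y; rewrite /u mulrC mulrN mulNr.
  have H := is_deriveZf (- (s ^+ 2 *+ 2)^-1) (is_derive_sqrf x).
  apply: (is_derive_eq H); rewrite mulr2n; field.
  by rewrite sn/= lt0r_neq0// addr_gt0// exprn_gt0.
have H := is_deriveZf (normal_peak s) (is_deriveCf (is_derive_expR (u x)) du).
by apply: (is_derive_eq H); rewrite /normal_fun subr0 /u; ring.
Qed.

(** With p the normal density, the derivative of -s^2 u p(u) is (u^2 - s^2) p(u). Its integral over
    [-n - 1, n + 1] is therefore a boundary term, which tends to 0 by the cubic bound. *)
Lemma normal_second_moment (s : R) : 0 < s ->
  \int[lebesgue]_u (u ^+ 2 * npdf 0 s u) = s ^+ 2.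
Proof.
move=> s0; have sn : s != 0 by rewrite gt_eqF.
have i2 := integrable_normal_moment s0 (isT : (2 <= 3)%N).
have i0 := integrable_scale (s ^+ 2) (integrable_normal_pdf 0 s).
pose k (u : R) := u ^+ 2 * npdf 0 s u - s ^+ 2 * npdf 0 s u.
have ik : lebesgue.-integrable setT (EFin \o k).
  by have := integrableB measurableT i2 i0; exact: eq_integrable.
suff k0 : \int[lebesgue]_u k u = 0.
  move: k0; rewrite /k RintegralB// RintegralZl ?integrable_normal_pdf//.
  by rewrite Rintegral_normal_pdf mulr1 => /eqP; rewrite subr_eq0 => /eqP.
pose F (u : R) := - s ^+ 2 * (u * npdf 0 s u).
have dF (u : R) : is_derive u 1 F (k u).
  have := is_derive_normal_pdf u s0 => dp.
  have H := is_deriveZf (- s ^+ 2) (is_deriveMf (is_derive_idf u) dp).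
  by apply: (is_derive_eq H); rewrite /k; field.
have cF : continuous F.
  by move=> u; exact: is_derive_continuous (dF u).
have ck : continuous k => [u|].
  have cp := @continuous_normal_pdf _ 0 s sn u.
  apply: cvgB; apply: cvgM => //; first exact: exprn_continuous.
  exact: cvg_cst.
have ftc (n : nat) : \int[lebesgue]_u (k u * \1_`[- n.+1%:R, n.+1%:R] u) =
    F n.+1%:R - F (- n.+1%:R).
  have nn : (- n.+1%:R : R) < n.+1%:R.
    by rewrite (@lt_trans _ _ 0)// ?oppr_lt0 ltr0n.
  rewrite /Rintegral.
  have -> : (\int[lebesgue]_u (k u * \1_`[(- n.+1%:R)%R, n.+1%:R%R] u)%:E =
    \int[lebesgue]_(u in `[(- n.+1%:R)%R, n.+1%:R%R]) (k u)%:E)%E.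
    rewrite [RHS]integral_mkcond; apply: eq_integral => u _.
    rewrite patchE indicE; case: (_ \in _) => /=; first by rewrite mulr1.
    by rewrite mulr0.
  rewrite (continuous_FTC2 (F := F))//.
  - exact/continuous_subspaceT.
  - split.
    + by move=> u _; exact: (@ex_derive _ _ _ _ _ _ _ (dF u)).
    + exact/cvg_at_right_filter/cF.
    + exact/cvg_at_left_filter/cF.
  - by move=> u _; exact: is_derive1E.
have [||||_ L] := @dominated_Rintegral _ _ _ lebesgue
    (fun n u => k u * \1_`[- n.+1%:R, n.+1%:R] u) k (fun u => `|k u|).
- by move=> n; apply: measurable_funM; [exact: continuous_measurable_fun|exact: measurable_indic].
- exact: integrable_norm.
- move=> u; rewrite -[X in _ --> X]mulr1; apply: cvgM; first exact: cvg_cst.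
  apply: cvg_near_cst; near=> n.
  rewrite indicE mem_set//= in_itv/= -ler_norml.
  near: n; exists (Num.trunc `|u|) => // n /=.
  move=> un; rewrite (le_trans (ltW (truncnS_gt _)))// ler_nat; exact: un.
- move=> n u; rewrite normrM ler_piMr// ger0_norm ?indicE//.
  by case: (_ \in _).
have {}L : (F n.+1%:R - F (- n.+1%:R)) @[n --> \oo] --> \int[lebesgue]_u k u.
  by move: L; rewrite -(funext ftc).
suff L0 : (F n.+1%:R - F (- n.+1%:R)) @[n --> \oo] --> (0 : R).
  exact: (cvg_unique _ L L0).
apply/cvgr0Pnorm_le => e e0.
pose C : R := s ^+ 2 * (2 * (64 * s ^+ 3 * normal_peak (2 * s))).
have C0 : 0 <= C.
  by rewrite !mulr_ge0 ?sqr_ge0 ?exprn_ge0 ?ltW// normal_peak_gt0// mulf_neq0.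
near=> n.
have nE : F n.+1%:R - F (- n.+1%:R) = - s ^+ 2 * (2 * (n.+1%:R * npdf 0 s n.+1%:R)).
  by rewrite /F normal_pdf_even//; ring.
rewrite nE mulNr normrN ger0_norm; last first.
  apply: mulr_ge0; first exact: sqr_ge0.
  by apply: mulr_ge0 => //; apply: mulr_ge0; rewrite ?ler0n ?normal_pdf_ge0.
have := @normal_pdf_cubic _ s n.+1%:R 3 s0 isT.
rewrite (ger0_norm (ler0n _ _)) => h3.
have h4 : n.+1%:R ^+ 3 * npdf 0 s n.+1%:R <= 64 * s ^+ 3 * normal_peak (2 * s).
  apply: (le_trans h3); apply: ler_wpM2l.
    by rewrite mulr_ge0// exprn_ge0// ltW.
  by apply: normal_pdf_ub; rewrite mulf_neq0.
have N0 : 0 < n.+1%:R :> R by rewrite ltr0n.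
have h5 : n.+1%:R * npdf 0 s n.+1%:R <= 64 * s ^+ 3 * normal_peak (2 * s) / n.+1%:R.
  rewrite ler_pdivlMr// (le_trans _ h4)//.
  rewrite mulrAC -expr2 ler_wpM2r ?normal_pdf_ge0// ler_weXn2l//.
  by rewrite ler1n.
apply: (@le_trans _ _ (C / n.+1%:R)).
  rewrite /C -[leRHS]mulrA ler_wpM2l ?sqr_ge0// -[leRHS]mulrA ler_wpM2l//.
rewrite ler_pdivrMr// mulrC -ler_pdivrMr//.
near: n; exists (Num.trunc (C / e)) => // n /=.
move=> un; rewrite (le_trans (ltW (truncnS_gt _)))// ler_nat ltnS; exact: un.
Unshelve. all: by end_near. Qed.

End normal_moments.

Section real_fubini.
Context {d1 d2 : measure_display} {T1 : measurableType d1} {T2 : measurableType d2}.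
Context {R : realType}.
Variables (m1 : {sigma_finite_measure set T1 -> \bar R}).
Variables (m2 : {sigma_finite_measure set T2 -> \bar R}) (F : T1 * T2 -> R).
Hypothesis iF : (m1 \x m2)%E.-integrable setT (EFin \o F).

Lemma Rintegral_fubini :
  (forall x, m2.-integrable setT (EFin \o (fun y => F (x, y)))) ->
  (forall y, m1.-integrable setT (EFin \o (fun x => F (x, y)))) ->
  \int[m1]_x (\int[m2]_y F (x, y)) = \int[m2]_y (\int[m1]_x F (x, y)).
Proof.
move=> i2 i1; rewrite /Rintegral; congr fine.
transitivity (\int[m1]_x \int[m2]_y (F (x, y))%:E)%E.
  by apply: eq_integral => x _; rewrite fineK//; exact: integrable_fin_num (i2 x).
rewrite (Fubini iF); apply: eq_integral => y _.
by rewrite fineK//; exact: integrable_fin_num (i1 y).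
Qed.

End real_fubini.

Section normal_semigroup.
Context {R : realType}.
Local Notation lebesgue := (@lebesgue_measure R).
Local Notation npdf := (@normal_pdf R).

(** In the double integral over the first increment [x] and the sum [z], the factorisation
    [normal_pdf_mul] leaves a conditional density in [x], which integrates to 1. *)
Lemma avg_normal_conv (m1 m2 s1 s2 s : R) f t : 0 < s1 -> 0 < s2 -> 0 < s ->
  s ^+ 2 = s1 ^+ 2 + s2 ^+ 2 -> bdd_meas f ->
  avg lebesgue (npdf m1 s1) id (avg lebesgue (npdf m2 s2) id f) t =
  avg lebesgue (npdf (m1 + m2) s) id f t.
Proof.
move=> s1p s2p sp sE bf; have [mf [M fM]] := bf.
pose F (p : R * R) := f (t + p.2) * (npdf m2 s2 (p.2 - p.1) * npdf m1 s1 p.1).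
pose c z := m1 + s1 ^+ 2 / s ^+ 2 * (z - m1 - m2).
have FE x z : F (x, z) = f (t + z) * npdf (m1 + m2) s z *
    npdf (c z) (s1 * s2 / s) x.
  by rewrite /F/= (normal_pdf_mul m1 m2 x z s1p s2p sp sE) mulrA.
have mF : measurable_fun setT F.
  apply: measurable_funM.
    by apply: measurableT_comp => //; exact: measurable_funD.
  apply: measurable_funM.
    apply: (measurableT_comp (measurable_normal_pdf m2 s2)).
    exact: measurable_funB.
  by apply: (measurableT_comp (measurable_normal_pdf m1 s1)).
have i1 z : lebesgue.-integrable setT (EFin \o (fun x => F (x, z))).
  rewrite (_ : (fun x => F (x, z)) = fun x => f (t + z) * npdf (m1 + m2) s z *
    npdf (c z) (s1 * s2 / s) x); last by apply/funext => x; rewrite FE.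
  exact/integrable_scale/integrable_normal_pdf.
have i2 x : lebesgue.-integrable setT (EFin \o (fun z => F (x, z))).
  apply: (@integrable_dom _ (measurableTypeR R) _ lebesgue _
     (fun z => M * npdf m1 s1 x * npdf m2 s2 (z + - x))).
  - exact: (measurableT_comp mF (measurable_pair1 x)).
  - move=> z; rewrite /F/= normrM [X in _ * X]ger0_norm; last first.
      by rewrite mulr_ge0 ?normal_pdf_ge0.
    by rewrite -mulrA [npdf m1 s1 x * _]mulrC ler_wpM2r ?mulr_ge0 ?normal_pdf_ge0.
  - apply: integrable_scale; apply: (@integrable_translate _ (- x) (npdf m2 s2)).
    exact: integrable_normal_pdf.
have iF : (lebesgue \x lebesgue)%E.-integrable setT (EFin \o F).
  apply/integrable21ltyP; first exact/measurable_EFinP.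
  apply: (@le_lt_trans _ _ (\int[lebesgue]_z (M * npdf (m1 + m2) s z)%:E)%E).
    apply: ge0_le_integral => //.
    - by move=> z _; apply: integral_ge0.
    - have mF' : measurable_fun setT (fun p => `|(F p)%:E|)%E.
        by apply: measurableT_comp => //; exact/measurable_EFinP.
      exact: (measurable_fun_fubini_tonelli_G (m1 := lebesgue) _ mF' (fun=> abse_ge0 _)).
    - by apply/measurable_EFinP; apply: measurable_funM => //; exact: measurable_normal_pdf.
    - move=> z _.
      under eq_integral => x _.
        rewrite [X in `|X|%E]/= FE abse_EFin normrM (ger0_norm (normal_pdf_ge0 _ _ _)) EFinM.
        over.
      rewrite integralZl//; last exact: integrable_normal_pdf.
      rewrite integral_normal_pdf mule1 lee_fin normrM.
      by rewrite (ger0_norm (normal_pdf_ge0 _ _ _)) ler_wpM2r// normal_pdf_ge0.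
  have := integrable_scale M (integrable_normal_pdf (m1 + m2) s).
  by move=> /integrable_lty; exact.
transitivity (\int[lebesgue]_x (\int[lebesgue]_z F (x, z))).
  apply: eq_Rintegral => x _ /=.
  rewrite /avg -(@Rintegral_translate _ x (fun z => F (x, z)))//.
  rewrite mulrC -RintegralZl//; last first.
    apply: (avg_integrable (m := lebesgue)) => //.
    - exact: normal_pdf_ge0.
    - exact: integrable_normal_pdf.
  by apply: eq_Rintegral => y _; rewrite /F/= addrK addrA addrAC; ring.
rewrite (Rintegral_fubini iF)//; apply: eq_Rintegral => z _.
under eq_Rintegral do rewrite FE.
by rewrite RintegralZl ?integrable_normal_pdf// Rintegral_normal_pdf mulr1.
Qed.

(** The count starts at [k.+1]: the 0-th iterate would be a point mass, which has no density. *)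
Lemma iter_avg_normal (m s : R) k f t : 0 < s -> bdd_meas f ->
  iter k.+1 (avg lebesgue (npdf m s) id) f t =
  avg lebesgue (npdf (k.+1%:R * m) (Num.sqrt k.+1%:R * s)) id f t.
Proof.
move=> s0 bf; elim: k t => [|k IH] t; first by rewrite /= sqrtr1 !mul1r.
rewrite iterS (_ : iter k.+1 _ _ =
  avg lebesgue (npdf (k.+1%:R * m) (Num.sqrt k.+1%:R * s)) id f); last exact/funext.
have q0 (j : nat) : 0 < Num.sqrt j.+1%:R * s by rewrite mulr_gt0// sqrtr_gt0.
have e : (Num.sqrt k.+2%:R * s) ^+ 2 = s ^+ 2 + (Num.sqrt k.+1%:R * s) ^+ 2.
  by rewrite !exprMn !sqr_sqrtr// -[k.+2%:R]natr1; ring.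
rewrite (avg_normal_conv m (k.+1%:R * m) t s0 (q0 k) (q0 k.+1) e bf).
by rewrite -[k.+2%:R]natr1 mulrDl mul1r addrC.
Qed.

End normal_semigroup.

Section taylor_normal.
Context {R : realType}.
Local Notation lebesgue := (@lebesgue_measure R).
Local Notation npdf := (@normal_pdf R).

(** The mean value theorem applied down to [h3] gives the cubic bound, applied down to [h2] the
    quadratic one. The factor 2 arises in the latter, where the increment and the second order term
    are bounded separately. *)
Lemma taylor2_of_derivatives C (h h1 h2 h3 : R -> R) :
  (forall x : R, is_derive x 1 h (h1 x)) -> (forall x : R, is_derive x 1 h1 (h2 x)) ->
  (forall x : R, is_derive x 1 h2 (h3 x)) ->
  (forall x, `|h x| <= C) -> (forall x, `|h1 x| <= C) ->
  (forall x, `|h2 x| <= C) -> (forall x, `|h3 x| <= C) ->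
  taylor2 (2 * C) h h1 h2.
Proof.
move=> d1 d2 d3 b b1 b2 b3.
have C0 : 0 <= C by exact: le_trans (b 0).
have mc (f df : R -> R) : (forall x : R, is_derive x 1 f (df x)) -> measurable_fun setT f.
  by move=> d; apply: continuous_measurable_fun => x; exact: is_derive_continuous (d x).
split; first by split; apply: mc.
have w x : x <= C -> x <= 2 * C by lra.
split=> [x|x|x|t s]; try exact: w.
rewrite /tcut minr_pMr ?mulr_ge0// le_min; apply/andP; split.
  pose k y := h (t + y) - (h t + y * h1 t + y ^+ 2 / 2 * h2 t).
  pose k1 y := h1 (t + y) - (h1 t + y * h2 t).
  have dk (y : R) : is_derive y 1 k (k1 y).
    have dt : is_derive y 1 (fun y => t + y) (0 + 1) :=
      is_deriveDf (is_derive_cstf y t) (is_derive_idf y).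
    have H : is_derive y 1 k _ := is_deriveBf (is_deriveCf (d1 (t + y)) dt)
      (is_deriveDf (is_deriveDf (is_derive_cstf y (h t))
        (is_deriveMf (is_derive_idf y) (is_derive_cstf y (h1 t))))
        (is_deriveMf (is_deriveMf (is_derive_sqrf y) (is_derive_cstf y 2^-1))
          (is_derive_cstf y (h2 t)))).
    by apply: (is_derive_eq H); rewrite /k1; field.
  have k0 : k 0 = 0 by rewrite /k addr0 expr0n /= !mul0r !addr0 subrr.
  have [u us] := mean_value 0 s dk; rewrite !add0r k0 subr0 => E0.
  have [v vu] := mean_value t u d2; move=> E1.
  have [w' wv] := mean_value t v d3; move=> E2.
  rewrite -/(k s) E0 /k1 opprD addrA E1 -mulrBr E2.
  rewrite !normrM (_ : 2 * C * _ = `|s| * (`|s| * (`|s| * (2 * C)))); last by ring.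
  rewrite ler_wpM2l// ler_pM ?mulr_ge0// ler_pM//; first exact: le_trans us.
  exact: w.
have [u us] := mean_value t s d1.
have [v vu] := mean_value t u d2.
move=> E1 E2.
rewrite (_ : _ - _ = s * (u * h2 (t + v)) - s ^+ 2 / 2 * h2 t); last first.
  by rewrite -E1 mulrBr -E2; ring.
have A : `|s * (u * h2 (t + v))| <= s ^+ 2 * C.
  by rewrite -(real_normK (num_real s)) !normrM expr2 -mulrA ler_wpM2l// ler_pM.
have B : `|s ^+ 2 / 2 * h2 t| <= s ^+ 2 * C.
  rewrite normrM normf_div (ger0_norm (sqr_ge0 s)) (ger0_norm (ler0n _ 2)) -mulrA ler_wpM2l ?sqr_ge0//.
  by have := b2 t; have := normr_ge0 (h2 t); lra.
rewrite (le_trans (ler_normB _ _))//.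
rewrite (_ : 2 * C * _ = s ^+ 2 * C + s ^+ 2 * C); last by ring.
exact: lerD.
Qed.

(** Up to order three, each derivative is a polynomial of degree at most 3 times the density, hence
    bounded by [normal_pdf_cubic]. *)
Lemma taylor2_normal_pdf (s : R) : 0 < s ->
  exists C h1 h2, taylor2 C (npdf 0 s) h1 h2.
Proof.
move=> s0; have sn : s != 0 by rewrite gt_eqF.
pose B k := 64 * s ^+ k * normal_peak (2 * s).
have Bk k u : (k <= 3)%N -> `|u ^+ k * npdf 0 s u| <= B k.
  move=> k3; rewrite normrM normrX (ger0_norm (normal_pdf_ge0 _ _ _)).
  apply: (le_trans (normal_pdf_cubic u s0 k3)); apply: ler_wpM2l.
    by rewrite mulr_ge0// exprn_ge0// ltW.
  by apply: normal_pdf_ub; rewrite mulf_neq0.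
pose h1 u := - (u / s ^+ 2) * npdf 0 s u.
pose h2 u := (u ^+ 2 / s ^+ 4 - (s ^+ 2)^-1) * npdf 0 s u.
pose h3 u := (3 * u / s ^+ 4 - u ^+ 3 / s ^+ 6) * npdf 0 s u.
have d0 u := is_derive_normal_pdf u s0.
have d1 (u : R) : is_derive u 1 h1 (h2 u).
  have H : is_derive u 1 (fun u => - (s ^+ 2)^-1 * (u * npdf 0 s u)) _ :=
    is_deriveZf (- (s ^+ 2)^-1) (is_deriveMf (is_derive_idf u) (d0 u)).
  rewrite (_ : h1 = fun u => - (s ^+ 2)^-1 * (u * npdf 0 s u)); last first.
    by apply/funext => y; rewrite /h1; field.
  by apply: (is_derive_eq H); rewrite /h2; field.
have d2 (u : R) : is_derive u 1 h2 (h3 u).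
  have H : is_derive u 1 h2 _ := is_deriveMf (is_deriveBf (is_deriveMf
    (is_derive_sqrf u) (is_derive_cstf u (s ^+ 4)^-1)) (is_derive_cstf u (s ^+ 2)^-1)) (d0 u).
  by apply: (is_derive_eq H); rewrite /h3; field.
pose i := s^-1.
pose C := B 0 + `|i ^+ 2| * B 1 + (`|i ^+ 4| * B 2 + `|i ^+ 2| * B 0)
  + (`|3 * i ^+ 4| * B 1 + `|i ^+ 6| * B 3).
have B0 k : (k <= 3)%N -> 0 <= B k by move=> k3; apply: le_trans (Bk k 0 k3).
have p0 := B0 0%N isT; have p1 := B0 1%N isT; have p2 := B0 2%N isT; have p3 := B0 3%N isT.
have a1 : 0 <= `|i ^+ 2| * B 1 by rewrite mulr_ge0.
have a2 : 0 <= `|i ^+ 4| * B 2 by rewrite mulr_ge0.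
have a3 : 0 <= `|i ^+ 2| * B 0 by rewrite mulr_ge0.
have a4 : 0 <= `|3 * i ^+ 4| * B 1 by rewrite mulr_ge0.
have a5 : 0 <= `|i ^+ 6| * B 3 by rewrite mulr_ge0.
exists (2 * C), h1, h2; apply: (taylor2_of_derivatives d0 d1 d2).
- by move=> u; have := Bk 0%N u isT; rewrite expr0 mul1r /C; lra.
- move=> u; rewrite [X in `|X|](_ : _ = - (i ^+ 2 * (u ^+ 1 * npdf 0 s u))).
    rewrite normrN normrM; apply: (@le_trans _ _ (`|i ^+ 2| * B 1)).
      by rewrite ler_wpM2l// Bk.
    by rewrite /C; lra.
  by rewrite /i; field.
- move=> u; rewrite [X in `|X|](_ : _ = i ^+ 4 * (u ^+ 2 * npdf 0 s u) -
    i ^+ 2 * (u ^+ 0 * npdf 0 s u)).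
    apply: (le_trans (ler_normB _ _)); rewrite normrM [X in _ + X]normrM.
    apply: (@le_trans _ _ (`|i ^+ 4| * B 2 + `|i ^+ 2| * B 0)).
      by rewrite lerD// ler_wpM2l// Bk.
    by rewrite /C; lra.
  by rewrite /h2 /i; field.
- move=> u; rewrite [X in `|X|](_ : _ = 3 * i ^+ 4 * (u ^+ 1 * npdf 0 s u) -
    i ^+ 6 * (u ^+ 3 * npdf 0 s u)).
    apply: (le_trans (ler_normB _ _)); rewrite normrM [X in _ + X]normrM.
    apply: (@le_trans _ _ (`|3 * i ^+ 4| * B 1 + `|i ^+ 6| * B 3)).
      by rewrite lerD// ler_wpM2l// Bk.
    by rewrite /C; lra.
  by rewrite /h3 /i; field.
Qed.

End taylor_normal.

(** * The central limit theorem for triangular arrays *)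

Section lipschitz_approximation.
Context {R : realType}.
Local Notation lebesgue := (@lebesgue_measure R).
Variables (F : R -> R) (M : R).
Hypotheses (F0 : forall x, 0 <= F x) (FM : forall x, F x <= M) (cF : continuous F).

(** The Pasch-Hausdorff envelope, that is, the largest [k]-Lipschitz minorant of [F]. *)
Definition infconv (k t : R) := inf [set F s + k * `|t - s| | s in [set: R]].

Let infconv_has_inf k t : 0 <= k -> has_inf [set F s + k * `|t - s| | s in [set: R]].
Proof.
move=> k0; split; first by exists (F 0 + k * `|t - 0|); exists 0.
by exists 0 => _ [s _ <-]; rewrite addr_ge0// mulr_ge0.
Qed.

Lemma infconv_le k t s : 0 <= k -> infconv k t <= F s + k * `|t - s|.
Proof. by move=> k0; apply: ge_inf; [case: (infconv_has_inf t k0)|exists s]. Qed.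

Lemma le_infconv k t y : 0 <= k -> (forall s, y <= F s + k * `|t - s|) -> y <= infconv k t.
Proof.
move=> k0 ys; apply: lb_le_inf; first by case: (infconv_has_inf t k0).
by move=> _ [s _ <-].
Qed.

(** The tent of height [k] confines the support to [-k, k], which makes the minorant integrable for
    Lebesgue measure, as the smoothing below requires. Being 1-Lipschitz, the tent leaves the
    Lipschitz constant at most [k + 1]. *)
Definition lip_approx (k t : R) := Num.min (infconv k t) (Num.max 0 (k - `|t|)).

Lemma lip_approx_ge0 k t : 0 <= k -> 0 <= lip_approx k t.
Proof.
move=> k0; rewrite /lip_approx le_min le_max lexx/= andbT.
by apply: le_infconv => // s; rewrite addr_ge0// mulr_ge0.
Qed.

Lemma lip_approx_le k t : 0 <= k -> lip_approx k t <= F t.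
Proof.
move=> k0; rewrite /lip_approx ge_min; apply/orP; left.
by apply: le_trans (infconv_le t t k0) _; rewrite subrr normr0 mulr0 addr0.
Qed.

Lemma lip_approx_lipschitz k t t' : 0 <= k ->
  lip_approx k t <= lip_approx k t' + (k + 1) * `|t - t'|.
Proof.
move=> k0; rewrite {2}/lip_approx addr_minl le_min; apply/andP; split.
  rewrite /lip_approx ge_min; apply/orP; left; rewrite -lerBlDr.
  apply: le_infconv => // s; rewrite lerBlDr (le_trans (infconv_le t s k0))//.
  rewrite -addrA lerD2l.
  have := ler_normD (t - t') (t' - s); rewrite subrKA => h.
  have := normr_ge0 (t - t'); have := ler_wpM2l k0 h; lra.
rewrite /lip_approx ge_min; apply/orP; right.
have h : `|t'| - `|t| <= `|t - t'| by rewrite distrC; exact: lerB_dist.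
rewrite ge_max; have := normr_ge0 (t - t') => n0.
have kn : 0 <= k * `|t - t'| by rewrite mulr_ge0.
have m0 : 0 <= Num.max 0 (k - `|t'|) by rewrite le_max lexx.
have m1 : k - `|t'| <= Num.max 0 (k - `|t'|) by rewrite le_max lexx orbT.
by apply/andP; split; lra.
Qed.

(** Within distance [d] of [t] continuity keeps [F s] near [F t]; beyond it the penalty [n * d]
    eventually exceeds the upper bound [M]. The tent stops mattering at [t] once n exceeds M +
    |t|. *)
Lemma lip_approx_cvg t : lip_approx n%:R t @[n --> \oo] --> F t.
Proof.
apply/cvgrPdist_le => e e0.
have [d /= d0 Fd] : exists2 d, 0 < d & forall s, `|t - s| < d -> `|F t - F s| < e.
  by have /cvgrPdist_lt/(_ e e0)/nbhs_ballP[d d0 Fd] := @cF t; exists d.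
near=> n.
have n0 : 0 <= n%:R :> R by [].
rewrite ger0_norm ?subr_ge0 ?lip_approx_le//.
rewrite lerBlDr addrC -lerBlDr /lip_approx le_min; apply/andP; split.
  apply: le_infconv => // s.
  have [tsd|dts] := ltP `|t - s| d.
    have := Fd _ tsd; rewrite ltr_norml => /andP[_ h].
    have : 0 <= n%:R * `|t - s| by rewrite mulr_ge0.
    lra.
  have : M <= n%:R * d.
    rewrite -ler_pdivrMr//; near: n; exists (Num.trunc (M / d)).+1 => // n /= h.
    by rewrite (le_trans (ltW (truncnS_gt _)))// ler_nat.
  have := ler_wpM2l n0 dts; have := FM t; have := F0 s; lra.
have : M + `|t| <= n%:R.
  near: n; exists (Num.trunc (M + `|t|)).+1 => // n /= h.
  by rewrite (le_trans (ltW (truncnS_gt _)))// ler_nat.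
rewrite le_max => h; apply/orP; right; have := FM t; lra.
Unshelve. all: by end_near. Qed.

Lemma lip_approx_measurable k : 0 <= k -> measurable_fun setT (lip_approx k).
Proof.
move=> k0; apply: continuous_measurable_fun => t; apply/cvgrPdist_le => e e0.
have k1 : 0 < k + 1 by lra.
near=> s.
have st : (k + 1) * `|t - s| <= e.
  rewrite mulrC -ler_pdivlMr//; near: s.
  by apply: cvgr_dist_le; [exact: cvg_id|exact: divr_gt0].
have := lip_approx_lipschitz t s k0; have := lip_approx_lipschitz s t k0.
rewrite [`|s - t|]distrC => h1 h2; rewrite ler_norml; apply/andP; split; lra.
Unshelve. all: by end_near. Qed.

Lemma lip_approx_integrable k : 0 <= k ->
  lebesgue.-integrable setT (EFin \o lip_approx k).
Proof.
move=> k0; apply: (@integrable_dom _ (measurableTypeR R) _ lebesgue _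
  (fun t => k * \1_`[- k, k] t)).
- exact: lip_approx_measurable.
- move=> t; rewrite ger0_norm ?lip_approx_ge0// /lip_approx ge_min; apply/orP; right.
  rewrite ge_max mulr_ge0//= indicE.
  have [tk|tk] := boolP (t \in _); first by rewrite mulr1 gerBl.
  rewrite mulr0 subr_le0 leNgt; apply: contra tk => tk.
  by rewrite inE/= in_itv/= -ler_norml ltW.
- apply: integrable_scale.
  exact: (@integrable_indic_itv R (- k) k true false).
Qed.

End lipschitz_approximation.

(** * Gaussian smoothing of integrable Lipschitz functions *)

Section gaussian_smoothing.
Context {R : realType}.
Local Notation lebesgue := (@lebesgue_measure R).
Local Notation npdf := (@normal_pdf R).
Variables (g : R -> R) (L M : R).
Hypotheses (g0 : forall x, 0 <= g x) (ig : lebesgue.-integrable setT (EFin \o g)).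
Hypotheses (gM : forall x, g x <= M) (gL : forall x y, g x <= g y + L * `|x - y|).
Hypothesis L0 : 0 <= L.

Let mg : measurable_fun setT g. Proof. exact: (integrable_meas ig). Qed.

(** The convolution of [g] with a normal density, with the roles exchanged: the density is the
    averaged function and [g] the weight, so that the Taylor bounds of the density pass to the
    convolution by [taylor2_avg]. *)
Definition smooth (s t : R) := avg lebesgue g (fun z => - z) (npdf 0 s) t.

Lemma taylor2_smooth s : 0 < s -> exists C h1 h2, taylor2 C (smooth s) h1 h2.
Proof.
move=> s0; have [C [h1 [h2 th]]] := taylor2_normal_pdf s0.
have mo : measurable_fun setT (fun z : R => - z) by exact: oppr_measurable.
have th' := taylor2_avg (m := lebesgue) g0 ig mo th.
by do 3 eexists; apply: th'.
Qed.

Lemma smooth_near s t : 0 < s -> `|smooth s t - g t| <= L * s.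
Proof.
move=> s0; have sn : s != 0 by rewrite gt_eqF.
have i0 := integrable_normal_pdf 0 s.
have i2 := integrable_normal_moment s0 (isT : (2 <= 3)%N).
have -> : smooth s t = \int[lebesgue]_u (g (u + t) * npdf 0 s u).
  rewrite /smooth /avg.
  rewrite -(@Rintegral_translate _ t (fun z => npdf 0 s (t + - z) * g z)).
    apply: eq_Rintegral => u _; rewrite mulrC opprD addrA addrAC subrr add0r.
    by rewrite normal_pdf_even.
  apply: (avg_integrable (m := lebesgue) (q := g) (r := fun z => - z)) => //; first exact: oppr_measurable.
  split; first exact: measurable_normal_pdf.
  exists (normal_peak s) => u; rewrite ger0_norm ?normal_pdf_ge0//.
  exact: normal_pdf_ub.
have igp : lebesgue.-integrable setT (EFin \o (fun u => g (u + t) * npdf 0 s u)).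
  apply: (@integrable_dom _ (measurableTypeR R) _ lebesgue _ (fun u => M * npdf 0 s u)).
  - apply: measurable_funM; last exact: measurable_normal_pdf.
    by apply: measurableT_comp => //; exact: measurable_funD.
  - move=> u; rewrite ger0_norm ?mulr_ge0 ?normal_pdf_ge0//.
    by rewrite ler_wpM2r ?normal_pdf_ge0.
  - exact: integrable_scale.
have igt := integrable_scale (g t) i0.
have -> : g t = \int[lebesgue]_u (g t * npdf 0 s u).
  by rewrite RintegralZl// Rintegral_normal_pdf mulr1.
rewrite -RintegralB//.
have ij : lebesgue.-integrable setT (EFin \o
    (fun u => g (u + t) * npdf 0 s u - g t * npdf 0 s u)).
  by have := integrableB measurableT igp igt; exact: eq_integrable.
apply: le_trans (le_normr_Rintegral _ _) _ => //.
(* The weights come from |u| <= s / 2 + u^2 / (2 s), that is (|u| - s)^2 >= 0; integrated, they give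
   exactly L s without an absolute first moment. *)
have ik0 := integrable_scale (L * (s / 2)) i0.
have ik2 := integrable_scale (L / (2 * s)) i2.
have ik : lebesgue.-integrable setT (EFin \o (fun u => L * (s / 2) * npdf 0 s u
    + L / (2 * s) * (u ^+ 2 * npdf 0 s u))).
  by have := integrableD measurableT ik0 ik2; exact: eq_integrable.
apply: (@le_trans _ _ (\int[lebesgue]_u (L * (s / 2) * npdf 0 s u
    + L / (2 * s) * (u ^+ 2 * npdf 0 s u)))); last first.
  rewrite RintegralD// !RintegralZl// normal_second_moment// Rintegral_normal_pdf.
  by rewrite le_eqVlt; apply/orP; left; apply/eqP; field.
apply: le_Rintegral => //; first exact: integrable_norm.
move=> u _; rewrite -mulrBl normrM (ger0_norm (normal_pdf_ge0 _ _ _)).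
rewrite mulrA -mulrDl ler_wpM2r ?normal_pdf_ge0//.
have gu : `|g (u + t) - g t| <= L * `|u|.
  have := gL (u + t) t; have := gL t (u + t).
  rewrite addrK [`|t - _|]distrC addrK => h1 h2.
  by rewrite ler_norml; apply/andP; split; lra.
apply: (le_trans gu).
rewrite -[L / _ * _]mulrA -mulrDr ler_wpM2l// -(real_normK (num_real u)).
rewrite -subr_ge0 (_ : _ - _ = (`|u| - s) ^+ 2 / (2 * s)); last by field.
by rewrite divr_ge0 ?sqr_ge0// mulr_ge0// ltW.
Qed.

End gaussian_smoothing.

Section shifted_normal_moments.
Context {R : realType}.
Local Notation lebesgue := (@lebesgue_measure R).
Local Notation npdf := (@normal_pdf R).
Variables (a s : R).
Hypothesis s0 : 0 < s.

Let sn : s != 0. Proof. by rewrite gt_eqF. Qed.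

Let i0 := integrable_normal_pdf 0 s.
Let i1 : lebesgue.-integrable setT (EFin \o (fun u => u * npdf 0 s u)) :=
  integrable_normal_moment s0 (isT : (1 <= 3)%N).
Let i2 := integrable_normal_moment s0 (isT : (2 <= 3)%N).
Let i3 := integrable_normal_moment s0 (isT : (3 <= 3)%N).

Let j1 : lebesgue.-integrable setT (EFin \o (fun u => (u + a) * npdf 0 s u)).
Proof.
have := integrableD measurableT i1 (integrable_scale a i0).
by apply: eq_integrable => // u _ /=; rewrite mulrDl.
Qed.

Let j2 : lebesgue.-integrable setT (EFin \o (fun u => (u + a) ^+ 2 * npdf 0 s u)).
Proof.
have K : lebesgue.-integrable setT
    (EFin \o (fun u => 2 * a * (u * npdf 0 s u) + a ^+ 2 * npdf 0 s u)).
  have := integrableD measurableT (integrable_scale (2 * a) i1) (integrable_scale (a ^+ 2) i0).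
  exact: eq_integrable.
have := integrableD measurableT i2 K.
by apply: eq_integrable => // u _ /=; rewrite -EFinD; congr (_%:E); ring.
Qed.

Let back (f : R -> R) : lebesgue.-integrable setT (EFin \o (fun u => f (u + a) * npdf 0 s u)) ->
  lebesgue.-integrable setT (EFin \o (fun u => f u * npdf a s u)) /\
  \int[lebesgue]_u (f u * npdf a s u) = \int[lebesgue]_u (f (u + a) * npdf 0 s u).
Proof.
move=> fi; have E u : f u * npdf a s u = f (u - a + a) * npdf 0 s (u - a).
  by rewrite subrK normal_pdf_center.
split.
  have := integrable_translate (- a) fi.
  by apply: eq_integrable => // u _ /=; rewrite E.
rewrite -(Rintegral_translate (- a) fi).
by apply: eq_Rintegral => u _; rewrite E.
Qed.

Lemma integrable_normal_sqr :
  lebesgue.-integrable setT (EFin \o (fun u => u ^+ 2 * npdf a s u)).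
Proof. by case: (back (f := fun u => u ^+ 2) j2). Qed.

Lemma normal_mean : \int[lebesgue]_u (u * npdf a s u) = a.
Proof.
have [_ ->] := back (f := id) j1.
under eq_Rintegral do rewrite mulrDl.
rewrite RintegralD//; last exact: integrable_scale.
by rewrite RintegralZl// normal_first_moment// Rintegral_normal_pdf mulr1 add0r.
Qed.

Lemma normal_sqr : \int[lebesgue]_u (u ^+ 2 * npdf a s u) = s ^+ 2 + a ^+ 2.
Proof.
have [_ ->] := back (f := fun u => u ^+ 2) j2.
have k1 := integrable_scale (2 * a) i1.
have k0 := integrable_scale (a ^+ 2) i0.
transitivity (\int[lebesgue]_u (u ^+ 2 * npdf 0 s u + (2 * a * (u * npdf 0 s u)
    + a ^+ 2 * npdf 0 s u))).
  by apply: eq_Rintegral => u _; ring.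
rewrite RintegralD//; last by have := integrableD measurableT k1 k0; exact: eq_integrable.
rewrite RintegralD// !RintegralZl// normal_first_moment// Rintegral_normal_pdf.
by rewrite normal_second_moment//; ring.
Qed.

(** From (|u| + |a|)^3 <= 4 (|u|^3 + |a|^3); the constant is 256 = 4 * 64, where 64 s^3 bounds the
    third absolute moment by [normal_pdf_cubic]. *)
Lemma normal_tcut : \int[lebesgue]_u (tcut u * npdf a s u) <= 256 * s ^+ 3 + 4 * `|a| ^+ 3.
Proof.
have n3 u : 0 <= `|u| ^+ 3 * npdf 0 s u by rewrite mulr_ge0 ?normal_pdf_ge0.
have i3' : lebesgue.-integrable setT (EFin \o (fun u => `|u| ^+ 3 * npdf 0 s u)).
  have := @integrable_norm _ _ _ lebesgue _ _ i3; apply: eq_integrable => // u _ /=.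
  by rewrite normrM normrX (ger0_norm (normal_pdf_ge0 _ _ _)).
have k3 := integrable_scale 4 i3'.
have k0 := integrable_scale (4 * `|a| ^+ 3) i0.
have k : lebesgue.-integrable setT (EFin \o (fun u => 4 * (`|u| ^+ 3 * npdf 0 s u)
    + 4 * `|a| ^+ 3 * npdf 0 s u)).
  by have := integrableD measurableT k3 k0; exact: eq_integrable.
have b u : tcut (u + a) * npdf 0 s u <= 4 * (`|u| ^+ 3 * npdf 0 s u)
    + 4 * `|a| ^+ 3 * npdf 0 s u.
  rewrite mulrA -mulrDl ler_wpM2r ?normal_pdf_ge0//.
  apply: le_trans (tcut_le3 _) _.
  apply: (@le_trans _ _ ((`|u| + `|a|) ^+ 3)).
    by rewrite lerXn2r ?nnegrE ?addr_ge0// ler_normD.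
  have := normr_ge0 u; have := normr_ge0 a; set x := `|u|; set y := `|a| => y0 x0.
  rewrite -subr_ge0 (_ : _ - _ = 3 * ((x + y) * (x - y) ^+ 2)); last by ring.
  by rewrite mulr_ge0// mulr_ge0 ?addr_ge0 ?sqr_ge0.
have jc : lebesgue.-integrable setT (EFin \o (fun u => tcut (u + a) * npdf 0 s u)).
  apply: (@integrable_dom _ (measurableTypeR R) _ lebesgue _ _ _ _ k).
  - apply: measurable_funM; last exact: measurable_normal_pdf.
    by apply: (measurableT_comp measurable_tcut); exact: measurable_funD.
  - by move=> u; rewrite ger0_norm ?b// mulr_ge0 ?tcut_ge0 ?normal_pdf_ge0.
have [_ ->] := back (f := tcut) jc.
apply: (@le_trans _ _ (\int[lebesgue]_u (4 * (`|u| ^+ 3 * npdf 0 s u)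
    + 4 * `|a| ^+ 3 * npdf 0 s u))).
  by apply: le_Rintegral => //.
rewrite RintegralD// !RintegralZl// Rintegral_normal_pdf mulr1 lerD2r.
have : \int[lebesgue]_u (`|u| ^+ 3 * npdf 0 s u) <=
    \int[lebesgue]_u (64 * s ^+ 3 * npdf 0 (2 * s) u).
  apply: le_Rintegral => //; first exact/integrable_scale/integrable_normal_pdf.
  by move=> u _; exact: normal_pdf_cubic.
rewrite RintegralZl ?integrable_normal_pdf// Rintegral_normal_pdf mulr1.
lra.
Qed.

End shifted_normal_moments.

Section central_limit.
Context {d : measure_display} {T : measurableType d} {R : realType}.
Local Notation lebesgue := (@lebesgue_measure R).
Local Notation npdf := (@normal_pdf R).
Variables (m : {sigma_finite_measure set T -> \bar R}) (q r : nat -> T -> R).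
Hypotheses (q0 : forall n p, 0 <= q n p).
Hypothesis (iq : forall n, m.-integrable setT (EFin \o q n)).
Hypotheses (mr : forall n, measurable_fun setT (r n)).
Hypothesis (q1 : forall n, \int[m]_p q n p = 1).
Hypothesis r2 : forall n, m.-integrable setT (EFin \o (fun p => r n p ^+ 2 * q n p)).
Variable v : R.
Hypothesis v0 : 0 < v.
Hypothesis cvg1 : n%:R * (\int[m]_p (r n p * q n p)) @[n --> \oo] --> - (v / 2).
Hypothesis cvg2 : n%:R * (\int[m]_p (r n p ^+ 2 * q n p)) @[n --> \oo] --> v.
Hypothesis cvg3 : n%:R * (\int[m]_p (tcut (r n p) * q n p)) @[n --> \oo] --> (0 : R).

Local Notation A n := (avg m (q n) (r n)).
Local Notation N := (avg lebesgue (npdf (- (v / 2)) (Num.sqrt v)) id).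

Lemma cvg_natV : n%:R^-1 @[n --> \oo] --> (0 : R).
Proof.
apply/gtr0_cvgV0; last exact: cvgr_idn.
by exists 1%N => // n /=; rewrite ltr0n.
Qed.

(** The limit law is itself the [n]-th convolution power of the normal law with mean -v / (2 n) and
    variance v / n, so both sides are [n]-th iterates and Lindeberg replacement applies directly.
    [D n] bounds the resulting error. *)
Lemma central_limit_taylor2 C h h1 h2 : taylor2 C h h1 h2 ->
  iter n (A n) h 0 @[n --> \oo] --> N h 0.
Proof.
move=> th.
have Bh : bdd_meas h by case: th => [[? _ _] [? _ _ _]]; split=> //; exists C.
have C0 : 0 <= C by case: th => _ [/(_ 0) + _ _ _]; apply: le_trans.
pose D n := C * (`|n%:R * (\int[m]_p (r n p * q n p)) - - (v / 2)|
  + `|n%:R * (\int[m]_p (r n p ^+ 2 * q n p)) - v| + (v / 2) ^+ 2 * n%:R^-1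
  + n%:R * (\int[m]_p (tcut (r n p) * q n p)) +
  (256 * v * Num.sqrt (v * n%:R^-1) + 4 * (v / 2) ^+ 3 * (n%:R^-1 * n%:R^-1))).
have D0 : D n @[n --> \oo] --> (0 : R).
  rewrite -[X in _ --> X](mulr0 C); apply: cvgM; first exact: cvg_cst.
  rewrite (_ : 0 = `|- (v / 2) - - (v / 2)| + `|v - v| + (v / 2) ^+ 2 * 0 + 0
    + (256 * v * Num.sqrt (v * 0) + 4 * (v / 2) ^+ 3 * (0 * 0)))%R; last first.
    by rewrite !subrr normr0 !mulr0 sqrtr0 mulr0 !addr0.
  have cn := cvg_natV.
  apply: cvgD; first (apply: cvgD; [apply: cvgD; [apply: cvgD|]|]) => //.
  - by apply: cvg_norm; apply: cvgB => //; exact: cvg_cst.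
  - by apply: cvg_norm; apply: cvgB => //; exact: cvg_cst.
  - by apply: cvgM => //; exact: cvg_cst.
  apply: cvgD; apply: cvgM; try exact: cvg_cst.
    apply: continuous_cvg; first exact: sqrt_continuous.
    by apply: cvgM => //; exact: cvg_cst.
  exact: cvgM.
apply/cvgrPdist_le => e e0.
have : \forall n \near \oo, D n <= e.
  by move/cvgrPdist_le : D0 => /(_ e e0); apply: filterS => n; rewrite sub0r normrN; apply: le_trans; rewrite ler_norm.
move=> De; near=> n; rewrite distrC.
have n0 : (0 < n)%N by near: n; exists 1%N.
have nr : 0 < n%:R :> R by rewrite ltr0n.
have nn : n%:R != 0 :> R by rewrite gt_eqF.
apply: (@le_trans _ _ (D n)); last by near: n.
pose a : R := - (v / 2) * n%:R^-1; pose s := Num.sqrt (v * n%:R^-1).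
have vn0 : 0 < v * n%:R^-1 by rewrite mulr_gt0// invr_gt0.
have s0 : 0 < s by rewrite sqrtr_gt0.
have s2 : s ^+ 2 = v * n%:R^-1 by rewrite sqr_sqrtr// ltW.
have -> : N h 0 = iter n (avg lebesgue (npdf a s) id) h 0.
  have E1 : n%:R * a = - (v / 2) by rewrite /a; field.
  have E2 : Num.sqrt n%:R * s = Num.sqrt v.
    by rewrite -sqrtrM ?ler0n// mulrCA divff// mulr1.
  have := iter_avg_normal a n.-1 0 s0 Bh.
  by rewrite prednK// E1 E2 => ->.
have np0 := normal_pdf_ge0 a s.
have mi : measurable_fun [set: measurableTypeR R] (@id R) by exact: measurable_id.
have := lindeberg (q0 n) (iq n) (mr n) (q1 n) (r2 n) (m' := lebesgue) (r' := id) np0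
  (integrable_normal_pdf a s) mi (Rintegral_normal_pdf a s)
  (integrable_normal_sqr a s0) n 0 th.
move=> /le_trans; apply.
rewrite normal_mean// normal_sqr//.
have tau' := normal_tcut a s0.
rewrite /D mulrCA ler_wpM2l// !mulrDr.
set M1 := \int[m]_p (r n p * _); set M2 := \int[m]_p (r n p ^+ 2 * _).
set M3 := \int[m]_p _.
have e1 : n%:R * `|M1 - a| = `|n%:R * M1 - - (v / 2)|.
  by rewrite -{1}(gtr0_norm nr) -normrM mulrBr /a; congr (`|_ - _|); field.
have e2 : n%:R * `|M2 - (s ^+ 2 + a ^+ 2)| <= `|n%:R * M2 - v| + (v / 2) ^+ 2 * n%:R^-1.
  rewrite -{1}(gtr0_norm nr) -normrM.
  rewrite (_ : _ * _ = (n%:R * M2 - v) - (v / 2) ^+ 2 * n%:R^-1); last first.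
    by rewrite s2 /a; field.
  rewrite (le_trans (ler_normB _ _))// lerD2l ger0_norm//.
  by rewrite mulr_ge0 ?sqr_ge0 ?invr_ge0.
have e3 : n%:R * (\int[lebesgue]_u (tcut u * npdf a s u)) <=
    256 * v * s + 4 * (v / 2) ^+ 3 * (n%:R^-1 * n%:R^-1).
  apply: (le_trans (ler_wpM2l (ltW nr) tau')).
  rewrite (_ : s ^+ 3 = v * n%:R^-1 * s); last by rewrite -s2 -exprSr.
  rewrite (_ : `|a| = v / 2 * n%:R^-1); last first.
    rewrite /a mulNr normrN ger0_norm// mulr_ge0 ?invr_ge0//.
    by rewrite divr_ge0// ltW.
  by rewrite le_eqVlt; apply/orP; left; apply/eqP; field.
rewrite e1; move: e2 e3; rewrite /s; lra.
Unshelve. all: by end_near. Qed.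

Lemma central_limit_lipschitz (g : R -> R) (L M : R) : (forall x, 0 <= g x) ->
  lebesgue.-integrable setT (EFin \o g) -> (forall x, g x <= M) -> 0 <= L ->
  (forall x y, g x <= g y + L * `|x - y|) ->
  iter n (A n) g 0 @[n --> \oo] --> N g 0.
Proof.
move=> g0 ig gM L0 gL.
have Bg : bdd_meas g.
  by split; [exact: integrable_meas ig|exists M => x; rewrite ger0_norm].
(* [L + 1] instead of [L] avoids a division by zero; smoothing at scale [s] then costs at most
   [e / 3] on each side. *)
apply/cvgrPdist_le => e e0; pose s := e / 3 / (L + 1).
have L1 : 0 < L + 1 by lra.
have s0 : 0 < s by rewrite !divr_gt0.
have Ls : L * s <= e / 3.
  by rewrite /s mulrA ler_pdivrMr// mulrDr mulr1 mulrC lerDl divr_ge0// ltW.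
have [C [h1 [h2 th]]] := taylor2_smooth g0 ig s0.
have Bh : bdd_meas (smooth g s) by case: th => [[? _ _] [? _ _ _]]; split=> //; exists C.
have gh x : `|smooth g s x - g x| <= e / 3.
  exact: le_trans (smooth_near g0 ig gM gL L0 x s0) Ls.
have /cvgrPdist_le/(_ (e / 3)) := central_limit_taylor2 th.
have e30 : 0 < e / 3 by rewrite divr_gt0.
move=> /(_ e30); apply: filterS => n close.
have mi : measurable_fun [set: measurableTypeR R] (@id R) by exact: measurable_id.
have c1 := iter_avg_close (q0 n) (iq n) (mr n) (q1 n) n 0 Bh Bg gh.
have c2 := iter_avg_close (m := lebesgue) (r := id) (normal_pdf_ge0 (- (v / 2)) (Num.sqrt v))
  (integrable_normal_pdf _ _) mi (Rintegral_normal_pdf _ _) 1 0 Bh Bg gh.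
have /= {}c2 : `|N (smooth g s) 0 - N g 0| <= e / 3 := c2.
rewrite (_ : e = e / 3 + e / 3 + e / 3); last by field.
apply: le_trans (ler_distD (iter n (A n) (smooth g s) 0) _ _) _; apply: lerD => //.
apply: le_trans (ler_distD (N (smooth g s) 0) _ _) _; apply: lerD => //.
by rewrite distrC.
Qed.

(** One-sided, because minorants of bounded support say nothing about mass escaping to infinity.
    Monotonicity of the iterates turns them into a lower bound, and applying it to [f] and to [- f]
    replaces any tightness argument. *)
Lemma central_limit_lower (f : R -> R) (M e : R) : continuous f -> (forall x, `|f x| <= M) -> 0 < e ->
  \forall n \near \oo, N f 0 - e <= iter n (A n) f 0.
Proof.
have aux (a b c y z : R) : `|a - b| <= e / 2 -> `|b - c| <= e / 2 -> c <= y + M ->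
    a = z + M -> z - e <= y.
  by rewrite !ler_norml => /andP[? ?] /andP[? ?] ? ?; lra.
move=> cf fM e0; pose F x := f x + M.
have F0 x : 0 <= F x by have := fM x; rewrite ler_norml => /andP[]; rewrite /F; lra.
have FM x : F x <= M + M by have := fM x; rewrite ler_norml => /andP[]; rewrite /F; lra.
have cF : continuous F by move=> x; apply: cvgD; [exact: cf|exact: cvg_cst].
have Bf : bdd_meas f by split; [exact: continuous_measurable_fun|exists M].
have BF : bdd_meas F by exact/bdd_measD/bdd_meas_cst.
have mi : measurable_fun [set: measurableTypeR R] (@id R) by exact: measurable_id.
have NF : N F 0 = N f 0 + M.
  exact: (iter_avg_addc (m := lebesgue) (r := id)
    (normal_pdf_ge0 (- (v / 2)) (Num.sqrt v))
    (integrable_normal_pdf _ _) mi (Rintegral_normal_pdf _ _) 1).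
have iNF : lebesgue.-integrable setT
    (EFin \o (fun p => (M + M) * npdf (- (v / 2)) (Num.sqrt v) p)).
  exact/integrable_scale/integrable_normal_pdf.
have [|||_ LN] := @dominated_Rintegral _ _ _ lebesgue
    (fun k p => lip_approx F k%:R (0 + p) * npdf (- (v / 2)) (Num.sqrt v) p)
    (fun p => F (0 + p) * npdf (- (v / 2)) (Num.sqrt v) p) _ _ iNF.
- move=> k; apply: measurable_funM; last exact: measurable_normal_pdf.
  apply: measurableT_comp; first exact: lip_approx_measurable.
  exact: measurable_funD.
- move=> p; apply: cvgM; last exact: cvg_cst.
  exact: lip_approx_cvg FM cF _.
- move=> k p; rewrite ger0_norm; last first.
    by rewrite mulr_ge0 ?normal_pdf_ge0 ?lip_approx_ge0.
  rewrite ler_wpM2r ?normal_pdf_ge0//.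
  by apply: le_trans (FM (0 + p)); exact: lip_approx_le.
have e20 : 0 < e / 2 by rewrite divr_gt0.
have [k _ /(_ k (leqnn k)) hk] : \forall k \near \oo, `|N F 0 - N (lip_approx F k%:R) 0| <= e / 2.
  by move/cvgrPdist_le : LN; exact.
have k0 : 0 <= k%:R :> R by [].
have LA := central_limit_lipschitz (fun x => lip_approx_ge0 F0 x k0)
  (lip_approx_integrable F0 k0) (fun x => le_trans (lip_approx_le F0 x k0) (FM x))
  (addr_ge0 k0 ler01) (fun x y => lip_approx_lipschitz F0 x y k0).
move/cvgrPdist_le : LA => /(_ _ e20); apply: filterS => n hn.
have BG : bdd_meas (lip_approx F k%:R).
  split; first exact: lip_approx_measurable.
  exists (M + M) => x; rewrite ger0_norm ?lip_approx_ge0//.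
  by apply: le_trans (FM x); exact: lip_approx_le.
have := iter_avg_le (q0 n) (iq n) (mr n) n 0 BG BF (fun x => lip_approx_le F0 x k0).
by rewrite /F iter_avg_addc// => /(aux _ _ _ _ _ hk hn); apply.
Qed.

Theorem central_limit (f : R -> R) (M : R) : continuous f -> (forall x, `|f x| <= M) ->
  iter n (A n) f 0 @[n --> \oo] --> N f 0.
Proof.
move=> cf fM; apply/cvgrPdist_le => e e0.
have Bf : bdd_meas f by split; [exact: continuous_measurable_fun|exists M].
have cNf : continuous (fun x => - f x) by move=> x; apply: cvgN; exact: cf.
have NfM x : `|- f x| <= M by rewrite normrN.
have lo := central_limit_lower cf fM e0.
have hi := central_limit_lower cNf NfM e0.
have mi : measurable_fun [set: measurableTypeR R] (@id R) by exact: measurable_id.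
have NN : N (fun x => - f x) 0 = - N f 0.
  exact: (iter_avgN (m := lebesgue) (r := id)
    (normal_pdf_ge0 (- (v / 2)) (Num.sqrt v))
    (integrable_normal_pdf _ _) mi 1).
near=> n.
have h1 : N f 0 - e <= iter n (A n) f 0 by near: n.
have h2 : N (fun x => - f x) 0 - e <= iter n (A n) (fun x => - f x) 0 by near: n.
move: h2; rewrite NN iter_avgN// => h2.
by rewrite ler_norml; apply/andP; split; lra.
Unshelve. all: by end_near. Qed.

End central_limit.

(** * Tilted laws and balancing functions *)

Section power_bounds.
Context {R : realType}.
Implicit Types (z a p xi : R) (k : nat).

Lemma cvg_powR0 (a : R^nat) p : 0 < p -> (forall n, 0 <= a n) ->
  a n @[n --> \oo] --> (0 : R) -> a n `^ p @[n --> \oo] --> (0 : R).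
Proof.
move=> p0 a0 /cvgr0Pnorm_le ca; apply/cvgr0Pnorm_le => e e0.
have /ca : 0 < e `^ p^-1 by rewrite powR_gt0.
apply: filterS => n; rewrite !ger0_norm ?powR_ge0// => h.
have eE : (e `^ p^-1) `^ p = e by rewrite -powRrM mulVf ?gt_eqF// powRr1// ltW.
by rewrite -eE; apply: ge0_ler_powR; rewrite ?(ltW p0) ?nnegrE ?powR_ge0.
Qed.

Lemma ler_exp_powR k xi z : 0 <= z -> k%:R <= xi -> z ^+ k <= 1 + z `^ xi.
Proof.
move=> z0 kxi; have [z1|z1] := leP z 1.
  by apply: (@le_trans _ _ 1); [rewrite exprn_ile1|rewrite lerDl powR_ge0].
by rewrite -powR_mulrn// (le_trans (ler_powR (ltW z1) kxi))// lerDr ler01.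
Qed.

(** When a z^2 > 1, so is its power of exponent (xi - 6) / 2, and multiplying by it turns z^6 into
    a^((xi - 6) / 2) |z|^xi. The factor 2 absorbs the constant term, since a <= 1 forces z^2 >=
    1. *)
Lemma tail_powR (a z xi : R) : 6 < xi -> 0 <= a <= 1 -> 1 < a * z ^+ 2 ->
  1 + z ^+ 6 <= 2 * a `^ ((xi - 6) / 2) * `|z| `^ xi.
Proof.
move=> xi6 /andP[a0 a1] az.
have z2 : 1 <= z ^+ 2.
  by rewrite ltW// (lt_le_trans az)// ler_piMl// sqr_ge0.
have zn : z != 0 by apply: contraTneq z2 => ->; rewrite expr0n/= -ltNge.
have z6 : 1 <= z ^+ 6 by rewrite (exprM z 2 3) exprn_ege1.
rewrite (@le_trans _ _ (2 * z ^+ 6))//; first by lra.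
rewrite -mulrA ler_pM2l//.
have -> : z ^+ 6 = `|z| `^ 6 by rewrite (powR_mulrn 6)// -normrX ger0_norm// (exprM z 2 3) exprn_ge0// sqr_ge0.
rewrite {2}(_ : xi = (xi - 6) + 6); last by ring.
rewrite powRD ?normr_eq0 ?zn ?implybT// mulrA ler_peMl ?powR_ge0//.
have -> : `|z| `^ (xi - 6) = (z ^+ 2) `^ ((xi - 6) / 2).
  by rewrite -(real_normK (num_real z)) -(powR_mulrn 2)// -powRrM; congr (_ `^ _); field.
rewrite -powRM ?sqr_ge0//.
suff : 1 `^ ((xi - 6) / 2) <= (a * z ^+ 2) `^ ((xi - 6) / 2) by rewrite powR1.
apply: ge0_ler_powR; last exact: ltW.
- by rewrite divr_ge0// subr_ge0 ltW.
- by rewrite nnegrE.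
- by rewrite nnegrE mulr_ge0 ?sqr_ge0.
Qed.

End power_bounds.

Section tilted_limits.
Context {R : realType}.
Variables (mu : probability R R) (B : R -> R) (M xi beta C : R).
Hypotheses (mB : measurable_fun setT B) (BM : forall u, `|B u| <= M * `|u|).
Hypotheses (xi6 : 6 < xi) (beta0 : 0 <= beta) (C0 : 0 <= C).
Hypothesis ixi : mu.-integrable setT (EFin \o (fun z => `|z| `^ xi)).
Hypothesis iB : forall a, mu.-integrable setT (EFin \o (fun z => expR (B (a * z)))).
Hypothesis iBxi : forall a, mu.-integrable setT
  (EFin \o (fun z => `|z| `^ xi * expR (B (a * z)))).

Definition tilt_mass (a : R) := \int[mu]_z expR (B (a * z)).

Hypothesis Bxi : forall a, \int[mu]_z (`|z| `^ xi * expR (B (a * z))) <=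
  C * (1 + `|a| `^ beta) * tilt_mass a.

Let M0 : 0 <= M. Proof. by have := BM 1; rewrite normr1 mulr1; apply: le_trans. Qed.

Lemma measurable_tilt (a : R) : measurable_fun setT (fun z => expR (B (a * z))).
Proof.
by apply: measurableT_comp => //; apply: measurableT_comp.
Qed.

Lemma measurable_abs_powR (p : R) : measurable_fun setT (fun z : R => `|z| `^ p).
Proof. by apply: (measurableT_comp (measurable_powR p)); exact: normr_measurable. Qed.

Lemma prob_integrable_cst (c : R) : mu.-integrable setT (EFin \o (fun=> c)).
Proof. exact: finite_measure_integrable_cst. Qed.

Lemma prob_Rintegral_cst (c : R) : \int[mu]_z c = c.
Proof.
rewrite (Rintegral_cst mu measurableT) -[RHS]mulr1; congr (_ * _).
exact: (congr1 fine (probability_setT mu)).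
Qed.

Lemma tilt_integrable (u : R -> R) (c1 c2 a : R) : measurable_fun setT u ->
  (forall z, `|u z| <= c1 + c2 * `|z| `^ xi) ->
  mu.-integrable setT (EFin \o (fun z => u z * expR (B (a * z)))).
Proof.
move=> mu_ uc; apply: (@integrable_dom _ _ _ mu _
  (fun z => c1 * expR (B (a * z)) + c2 * (`|z| `^ xi * expR (B (a * z))))).
- by apply: measurable_funM => //; exact: measurable_tilt.
- by move=> z; rewrite normrM (ger0_norm (expR_ge0 _)) mulrA -mulrDl ler_wpM2r ?expR_ge0.
- have := integrableD measurableT (integrable_scale c1 (iB a)) (integrable_scale c2 (iBxi a)).
  exact: eq_integrable.
Qed.

(* Jensen's inequality for the tilted law, through [expR D >= expR m * (1 + D - m)]
   with [m] the tilted mean of [D]. *)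
Lemma tilt_jensen (D : R -> R) (c1 c2 a a' : R) : measurable_fun setT D ->
  (forall z, `|D z| <= c1 + c2 * `|z| `^ xi) ->
  (forall z, B (a * z) = B (a' * z) + D z) -> 0 < tilt_mass a' ->
  expR ((\int[mu]_z (D z * expR (B (a' * z)))) / tilt_mass a') * tilt_mass a' <= tilt_mass a.
Proof.
move=> mD Dc BD Z0; set m := _ / _.
have iD := tilt_integrable a' mD Dc.
have i1 := iB a'.
have k1 := integrable_scale (expR m) iD.
have k2 := integrable_scale (expR m * (1 - m)) i1.
have k : mu.-integrable setT (EFin \o (fun z => expR m * (D z * expR (B (a' * z)))
   + expR m * (1 - m) * expR (B (a' * z)))).
  by have := integrableD measurableT k1 k2; exact: eq_integrable.
have -> : expR m * tilt_mass a' = \int[mu]_z (expR m * (D z * expR (B (a' * z)))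
   + expR m * (1 - m) * expR (B (a' * z))).
  rewrite RintegralD// !RintegralZl// -/(tilt_mass a').
  rewrite -mulrA -mulrDr; congr (_ * _).
  rewrite (_ : \int[mu]_z _ = m * tilt_mass a'); first by ring.
  by rewrite /m divfK// gt_eqF.
apply: le_Rintegral => // z _; rewrite BD expRD.
rewrite (_ : _ + _ = expR m * (1 + (D z - m)) * expR (B (a' * z))); last by ring.
rewrite mulrC ler_wpM2l ?expR_ge0// -[in leRHS](subrKC m (D z)) expRD.
by rewrite ler_wpM2l ?expR_ge0// expR_ge1Dx.
Qed.

Lemma integrable_le_xi (u : R -> R) (c1 c2 : R) : measurable_fun setT u ->
  (forall z, `|u z| <= c1 + c2 * `|z| `^ xi) -> mu.-integrable setT (EFin \o u).
Proof.
move=> mu_ uc; apply: (integrable_dom mu_ uc).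
have := integrableD measurableT (prob_integrable_cst c1) (integrable_scale c2 ixi).
exact: eq_integrable.
Qed.

(** Jensen again, now for [mu] itself: the mass is at least the exponential of the mean of B(a z),
    which is finite by the linear bound on [B]. *)
Lemma tilt_mass_gt0 (a : R) : 0 < tilt_mass a.
Proof.
pose m := \int[mu]_z B (a * z).
have mBa : measurable_fun setT (fun z => B (a * z)).
  by apply: measurableT_comp => //; exact: measurable_funM.
have iBa : mu.-integrable setT (EFin \o (fun z => B (a * z))).
  apply: (@integrable_le_xi _ (M * `|a|) (M * `|a|)) => // z.
  rewrite -{1}(mulr1 (M * `|a|)) -mulrDr (le_trans (BM _))// normrM mulrA.
  rewrite ler_wpM2l ?mulr_ge0//; apply: (@ler_exp_powR _ 1); first exact: normr_ge0.
  by apply: le_trans (ltW xi6); rewrite ler_nat.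
have k1 := integrable_scale (expR m) iBa.
have k2 := prob_integrable_cst (expR m * (1 - m)).
have k : mu.-integrable setT (EFin \o (fun z => expR m * B (a * z) + expR m * (1 - m))).
  by have := integrableD measurableT k1 k2; exact: eq_integrable.
apply: (@lt_le_trans _ _ (expR m)); first exact: expR_gt0.
have -> : expR m = \int[mu]_z (expR m * B (a * z) + expR m * (1 - m)).
  by rewrite RintegralD// RintegralZl// prob_Rintegral_cst -/m; ring.
apply: le_Rintegral => // z _.
rewrite (_ : _ + _ = expR m * (1 + (B (a * z) - m))); last by ring.
rewrite -[in leRHS](subrKC m (B (a * z))) expRD.
by rewrite ler_wpM2l ?expR_ge0// expR_ge1Dx.
Qed.

Lemma tilt_bound (u : R -> R) (c1 c2 a : R) : measurable_fun setT u ->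
  (forall z, `|u z| <= c1 + c2 * `|z| `^ xi) -> 0 <= c2 ->
  `|\int[mu]_z (u z * expR (B (a * z)))| / tilt_mass a <= c1 + c2 * (C * (1 + `|a| `^ beta)).
Proof.
move=> mu_ uc c20; have Z0 := tilt_mass_gt0 a.
have iu := tilt_integrable a mu_ uc.
rewrite ler_pdivrMr//; apply: le_trans (le_normr_Rintegral _ _) _ => //.
have k1 := integrable_scale c1 (iB a).
have k2 := integrable_scale c2 (iBxi a).
apply: (@le_trans _ _ (\int[mu]_z (c1 * expR (B (a * z))
    + c2 * (`|z| `^ xi * expR (B (a * z)))))).
  apply: le_Rintegral => //.
  - exact: (@integrable_norm _ _ _ mu).
  - by have := integrableD measurableT k1 k2; exact: eq_integrable.
  - by move=> z _; rewrite normrM (ger0_norm (expR_ge0 _)) mulrA -mulrDl ler_wpM2r ?expR_ge0.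
rewrite RintegralD// !RintegralZl// mulrDl lerD2l -mulrA ler_wpM2l//.
Qed.

Section limit.
Variables (a : R^nat).
Hypotheses (a1 : forall n, `|a n| <= 1) (a_cvg0 : a n @[n --> \oo] --> (0 : R)).

Let norm_a_cvg0 : `|a n| @[n --> \oo] --> (0 : R).
Proof. by rewrite -(normr0 R); exact: cvg_norm. Qed.

(** The cut set. As |a n| <= 1, it forces |a n z| <= 1, so the tilt is at most [expR M] on it, while
    every fixed [z] eventually belongs to it; off it, [tail_powR] applies. *)
Let E n : set R := (fun z : R => `|a n| * z ^+ 2) @^-1` `]-oo, 1].

Let mE n : measurable (E n).
Proof.
rewrite -[X in measurable X]setTI.
by apply: measurable_funM => //; exact: measurable_funX.
Qed.

(** Dominated convergence handles the part on the cut set. The part off it is controlled only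
    relative to [tilt_mass (a n)], whose limit is not known at this stage and is itself deduced from
    this lemma. *)
Let tilt_main (u : nat -> R -> R) (v : R -> R) (D : R) (eta : R^nat) :
  (forall n, measurable_fun setT (u n)) -> (forall z, u n z @[n --> \oo] --> v z) ->
  0 <= D -> (forall n, 0 <= eta n <= 1) ->
  (forall n z, `|u n z| <= D * (1 + z ^+ 6 + eta n * `|z| `^ xi)) ->
  [/\ mu.-integrable setT (EFin \o v),
    \int[mu]_z (u n z * expR (B (a n * z)) * \1_(E n) z) @[n --> \oo] --> \int[mu]_z v z &
    forall n, `|\int[mu]_z (u n z * expR (B (a n * z)))
      - \int[mu]_z (u n z * expR (B (a n * z)) * \1_(E n) z)|
      <= D * (2 * C * (2 * `|a n| `^ ((xi - 6) / 2) + eta n)) * tilt_mass (a n)].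
Proof.
move=> mu_ uv D0 eta01 uD.
have eta0 n : 0 <= eta n by case/andP : (eta01 n).
have eta1 n : eta n <= 1 by case/andP : (eta01 n).
have x0 z : 0 <= `|z| `^ xi by exact: powR_ge0.
have z6 z : z ^+ 6 <= 1 + `|z| `^ xi.
  have -> : z ^+ 6 = `|z| ^+ 6 by rewrite -normrX ger0_norm// (exprM z 2 3) exprn_ge0// sqr_ge0.
  by apply: ler_exp_powR => //; move: xi6; lra.
have ub n z : `|u n z| <= D * 2 + D * 2 * `|z| `^ xi.
  apply: (le_trans (uD n z)).
  rewrite (_ : D * 2 + _ = D * (2 + 2 * `|z| `^ xi)); last by ring.
  rewrite ler_wpM2l//.
  have : eta n * `|z| `^ xi <= `|z| `^ xi by rewrite ler_piMl.
  by have := z6 z; lra.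
have iu n := tilt_integrable (a n) (mu_ n) (ub n).
have ind01 n z : 0 <= (\1_(E n) z : R) <= 1 by rewrite indicE; case: (_ \in _); rewrite ?lexx ?ler01.
have mind n : measurable_fun setT (\1_(E n) : R -> R) by exact: measurable_indic.
have mut n : measurable_fun setT (fun z => u n z * expR (B (a n * z))).
  by apply: measurable_funM => //; exact: measurable_tilt.
have iui n : mu.-integrable setT (EFin \o (fun z => u n z * expR (B (a n * z)) * \1_(E n) z)).
  apply: (@integrable_dom _ _ _ mu _ (fun z => `|u n z * expR (B (a n * z))|)).
  - exact: measurable_funM.
  - move=> z; have /andP[i0 i1] := ind01 n z.
    by rewrite normrM ler_piMr// ger0_norm.
  - exact: (@integrable_norm _ _ _ mu).
have idom : mu.-integrable setT (EFin \o (fun z => expR M * (D * 2 + D * 2 * `|z| `^ xi))).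
  apply: integrable_scale.
  have := integrableD measurableT (prob_integrable_cst (D * 2)) (integrable_scale (D * 2) ixi).
  exact: eq_integrable.
have [|||iv cv] := @dominated_Rintegral _ _ _ mu
  (fun n z => u n z * expR (B (a n * z)) * \1_(E n) z) v _ _ idom.
- by move=> n; exact: measurable_funM.
- move=> z; rewrite -[X in _ --> X]mulr1 -[X in _ --> X]mulr1.
  apply: cvgM; first apply: cvgM => //.
    rewrite -expR0; apply: continuous_cvg; first exact: continuous_expR.
    apply: norm_cvg0; apply: (@squeeze_cvgr _ _ _ _ (fun=> 0) (fun n => M * (`|a n| * `|z|))).
    + by apply: nearW => n; rewrite normr_ge0/= -normrM.
    + exact: cvg_cst.
    + have c0 : `|a n| * `|z| @[n --> \oo] --> (0 : R).
        by rewrite -(mul0r `|z|); apply: cvgM; [exact: norm_a_cvg0|exact: cvg_cst].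
      by rewrite -(mulr0 M); apply: cvgM; [exact: cvg_cst|exact: c0].
  apply: cvg_near_cst.
  have L : `|a n| * z ^+ 2 @[n --> \oo] --> (0 : R).
    rewrite -(mul0r (z ^+ 2)).
    by apply: cvgM; [exact: norm_a_cvg0|exact: cvg_cst].
  move/cvgr0Pnorm_le : L => /(_ 1 ltr01); apply: filterS => n.
  rewrite ger0_norm; last by apply: mulr_ge0 => //; exact: sqr_ge0.
  move=> h.
  by rewrite indicE mem_set//= in_itv.
- move=> n z; rewrite indicE.
  have [zE|_] := boolP (z \in E n); last first.
    by rewrite mulr0 normr0 mulr_ge0 ?expR_ge0// addr_ge0 ?mulr_ge0.
  rewrite mulr1 normrM (ger0_norm (expR_ge0 _)) mulrC ler_pM ?expR_ge0//.
  rewrite ler_expR (le_trans (ler_norm _))// (le_trans (BM _))// ler_piMr// normrM.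
  have {}zE : `|a n| * z ^+ 2 <= 1 by move: zE; rewrite inE /E/= in_itv.
  have [z1|z1] := leP `|z| 1.
    by rewrite -[leRHS]mulr1 ler_pM.
  apply: le_trans zE; rewrite ler_wpM2l// -(real_normK (num_real z)) expr2.
  by rewrite ler_peMl// ltW.
split=> // n.
rewrite -RintegralB//.
have id : mu.-integrable setT (EFin \o (fun z => u n z * expR (B (a n * z))
    - u n z * expR (B (a n * z)) * \1_(E n) z)).
  by have := integrableB measurableT (iu n) (iui n); exact: eq_integrable.
apply: le_trans (le_normr_Rintegral _ _) _ => //.
pose t := 2 * `|a n| `^ ((xi - 6) / 2) + eta n.
have t0 : 0 <= t by rewrite addr_ge0// mulr_ge0// powR_ge0.
have kk := integrable_scale (D * t) (iBxi (a n)).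
apply: (@le_trans _ _ (\int[mu]_z (D * t * (`|z| `^ xi * expR (B (a n * z)))))).
  apply: le_Rintegral => //; first exact: (@integrable_norm _ _ _ mu).
  move=> z _; rewrite -{1}[u n z * _]mulr1 -mulrBr normrM indicE.
  have [zE|zE] := boolP (z \in E n).
    by rewrite subrr normr0 mulr0 !mulr_ge0 ?expR_ge0.
  rewrite subr0 normr1 mulr1 normrM (ger0_norm (expR_ge0 _)) mulrA ler_wpM2r ?expR_ge0//.
  apply: (le_trans (uD n z)); rewrite -mulrA ler_wpM2l// /t mulrDl lerD2r.
  apply: tail_powR => //; first by rewrite normr_ge0 a1.
  by rewrite ltNge; apply: contra zE => zE; rewrite inE /E/= in_itv/=.
rewrite RintegralZl//.
have -> : D * (2 * C * (2 * `|a n| `^ ((xi - 6) / 2) + eta n)) = D * t * (C * 2).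
  by rewrite -/t; ring.
rewrite -[leRHS]mulrA ler_wpM2l ?mulr_ge0// (le_trans (Bxi _))//.
rewrite ler_wpM2r ?(ltW (tilt_mass_gt0 _))// ler_wpM2l//.
have : `|a n| `^ beta <= 1 `^ beta.
  by apply: ge0_ler_powR => //; rewrite nnegrE.
by rewrite powR1; lra.
Qed.

Let delta0 : 2 * C * (2 * `|a n| `^ ((xi - 6) / 2)) @[n --> \oo] --> (0 : R).
Proof.
have c0 : `|a n| `^ ((xi - 6) / 2) @[n --> \oo] --> (0 : R).
  by apply: cvg_powR0 => //; rewrite divr_gt0// subr_gt0.
have c1 : 2 * `|a n| `^ ((xi - 6) / 2) @[n --> \oo] --> (0 : R).
  by rewrite -(mulr0 2); apply: cvgM; [exact: cvg_cst|exact: c0].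
by rewrite -(mulr0 (2 * C)); apply: cvgM; [exact: cvg_cst|exact: c1].
Qed.

(** With u = 1 the truncated mass tends to 1, and so does its ratio to the full mass; dividing one
    by the other gives the limit without an a priori upper bound on the mass. *)
Lemma tilt_mass_cvg : tilt_mass (a n) @[n --> \oo] --> (1 : R).
Proof.
have h1 (n : nat) : measurable_fun setT (fun _ : R => 1 : R) by exact: measurable_cst.
have h2 (z : R) : (1 : R) @[n --> \oo] --> (1 : R) by exact: cvg_cst.
have h3 (n : nat) : 0 <= (0 : R) <= 1 by rewrite lexx ler01.
have h4 (n : nat) (z : R) : `|1 : R| <= 1 * (1 + z ^+ 6 + 0 * `|z| `^ xi).
  rewrite normr1 mul1r mul0r addr0 lerDl (exprM z 2 3) exprn_ge0//.
  exact: sqr_ge0.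
have [_ c1 c2] := tilt_main h1 h2 ler01 h3 h4.
rewrite prob_Rintegral_cst in c1.
set F := fun n => \int[mu]_z (1 * expR (B (a n * z)) * \1_(E n) z) in c1.
have G1 : F n / tilt_mass (a n) @[n --> \oo] --> (1 : R).
  apply/cvgrPdist_le => e e0; move/cvgr0Pnorm_le : delta0 => /(_ e e0).
  apply: filterS => n; apply: le_trans.
  have Z0 := tilt_mass_gt0 (a n); have := c2 n.
  under eq_Rintegral do rewrite mul1r.
  rewrite -/(tilt_mass (a n)) -/(F n) mul1r addr0 => h.
  rewrite -{1}(divff (lt0r_neq0 Z0)) -mulrBl normrM (gtr0_norm (_ : 0 < (tilt_mass _)^-1)) ?invr_gt0//.
  by rewrite ler_pdivrMr// (le_trans h)// ler_wpM2r ?(ltW Z0)// ler_norm.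
have FZ n : tilt_mass (a n) * (F n / tilt_mass (a n)) = F n.
  by rewrite mulrC divfK// gt_eqF// tilt_mass_gt0.
have : F n / (F n / tilt_mass (a n)) @[n --> \oo] --> 1 / (1 : R).
  by apply: cvgM => //; apply: cvgV => //; exact: oner_neq0.
rewrite divr1; apply: cvg_trans; apply: near_eq_cvg.
have [N _ HN] : \forall n \near \oo, F n / tilt_mass (a n) != 0.
  move/cvgrPdist_lt : G1 => /(_ 1 ltr01); apply: filterS => n.
  by apply: contraTneq => ->; rewrite subr0 normr1 ltxx.
by exists N => // n /HN Fn /=; rewrite -{1}FZ mulfK.
Qed.

(** Growth like z^6 leaves a spare power of |z| off the cut set, but growth like |z|^xi leaves none:
    that part vanishes only through its coefficient [eta n]. *)
Lemma tilt_cvg (u : nat -> R -> R) (v : R -> R) (D : R) (eta : R^nat) :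
  (forall n, measurable_fun setT (u n)) -> (forall z, u n z @[n --> \oo] --> v z) ->
  0 <= D -> (forall n, 0 <= eta n <= 1) -> eta n @[n --> \oo] --> (0 : R) ->
  (forall n z, `|u n z| <= D * (1 + z ^+ 6 + eta n * `|z| `^ xi)) ->
  (\int[mu]_z (u n z * expR (B (a n * z)))) / tilt_mass (a n) @[n --> \oo]
    --> \int[mu]_z v z.
Proof.
move=> mu_ uv D0 eta01 eta_cvg0 uD.
have [iv c1 c2] := tilt_main mu_ uv D0 eta01 uD.
set F := fun n => \int[mu]_z (u n z * expR (B (a n * z)) * \1_(E n) z) in c1.
set J := fun n => \int[mu]_z (u n z * expR (B (a n * z))).
have F1 : F n / tilt_mass (a n) @[n --> \oo] --> \int[mu]_z v z.
  rewrite -[X in _ --> X]divr1; apply: cvgM => //.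
  by apply: cvgV; [exact: oner_neq0|exact: tilt_mass_cvg].
have d0 : D * (2 * C * (2 * `|a n| `^ ((xi - 6) / 2) + eta n)) @[n --> \oo] --> (0 : R).
  rewrite -(mulr0 D); apply: cvgM; first exact: cvg_cst.
  rewrite (_ : (fun n => _) = (fun n => 2 * C * (2 * `|a n| `^ ((xi - 6) / 2)) + 2 * C * eta n)).
    rewrite -(addr0 0) -{2}(mulr0 (2 * C)); apply: cvgD; first exact: delta0.
    by apply: cvgM => //; exact: cvg_cst.
  by apply/funext => n; rewrite mulrDr.
have JF : (J n - F n) / tilt_mass (a n) @[n --> \oo] --> (0 : R).
  apply: norm_cvg0; apply: (@squeeze_cvgr _ _ _ _ (fun=> 0) _ _ _ _ _ d0); last exact: cvg_cst.
  apply: nearW => n; rewrite normr_ge0/= normrM.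
  have Z0 := tilt_mass_gt0 (a n).
  by rewrite (gtr0_norm (_ : 0 < (tilt_mass _)^-1)) ?invr_gt0// ler_pdivrMr// c2.
rewrite (_ : (fun n => _) = (fun n => (J n - F n) / tilt_mass (a n) + F n / tilt_mass (a n))).
  by rewrite -[X in _ --> X]add0r; apply: cvgD.
by apply/funext => n; rewrite -mulrDl subrK.
Qed.

End limit.
End tilted_limits.

(** * Increments of even functions *)

Section even_functions.
Context {R : realType}.

(** By evenness both points may be taken nonnegative. The mean value point then lies between them,
    hence is at most their sum, and sum times difference is the difference of squares. *)
Lemma even_increment (c c1 : R -> R) (M d : R) : (forall x, c (- x) = c x) ->
  (forall x : R, is_derive x 1 c (c1 x)) -> 0 <= M ->
  (forall t, `|t| <= d -> `|c1 t| <= M * `|t|) ->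
  forall u v, `|u| <= d -> `|v| <= d -> `|c v - c u| <= M * `|v ^+ 2 - u ^+ 2|.
Proof.
move=> ce dc M0 c1M u v ud vd.
have cabs x : c x = c `|x| by have [x0|x0] := leP 0 x; [rewrite ger0_norm|rewrite ltr0_norm// ce].
rewrite (cabs u) (cabs v) -(real_normK (num_real u)) -(real_normK (num_real v)).
have u0 := normr_ge0 u; have v0 := normr_ge0 v.
move: `|u| `|v| u0 v0 ud vd => {cabs u v} u v u0 v0 ud vd.
have [t /andP[t0 t1]] := mean_value01 u (v - u) dc.
rewrite subrKC => ->.
set z := u + t * (v - u).
have zE : z = (1 - t) * u + t * v by rewrite /z; ring.
have z0 : 0 <= z by rewrite zE addr_ge0// mulr_ge0// subr_ge0.
have zd : z <= d.
  rewrite (_ : d = (1 - t) * d + t * d); last by ring.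
  by rewrite zE lerD// ler_wpM2l// subr_ge0.
have zuv : z <= v + u.
  rewrite zE addrC lerD//; first by rewrite ler_piMl.
  by rewrite ler_piMl// lerBlDr lerDl.
have h : `|c1 z| <= M * z by have := c1M z; rewrite (ger0_norm z0); apply.
rewrite subr_sqr !normrM (ger0_norm (addr_ge0 v0 u0)) mulrCA ler_wpM2l//.
by apply: (le_trans h); rewrite ler_wpM2l.
Qed.

Lemma derive_at0_bound (c1 : R -> R) (k e : R) : is_derive (0 : R) 1 c1 k -> c1 0 = 0 -> 0 < e ->
  exists2 d, 0 < d & forall t, `|t| <= d -> `|c1 t - k * t| <= e * `|t|.
Proof.
move=> /is_derive1_caratheodory[G [GE /= cG G0]] c0 e0.
move/cvgrPdist_le : cG => /(_ e e0) /nbhs_ballP[d /= d0 Gd].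
exists (d / 2); first by rewrite divr_gt0.
move=> t td; have := GE t; rewrite c0 !subr0 => ->.
rewrite -mulrBl normrM ler_wpM2r// distrC -{1}G0; apply: Gd.
rewrite /ball/= sub0r normrN (le_lt_trans td)//.
by rewrite ltr_pdivrMr// ltr_pMr// ltr1n.
Qed.

(** Only the quotient of v^2 - u^2 by [r] is assumed to converge; u^2 and v^2 may be much larger
    than [r], so an expansion at 0 with error o(u^2) would not do. Subtracting (k / 2) t^2 leaves an
    even function whose derivative is a small multiple of t near 0, and [even_increment] bounds its
    increments by a small multiple of |v^2 - u^2|. *)
Lemma even_increment_cvg (c c1 : R -> R) (k L : R) (u v r : R^nat) :
  (forall x, c (- x) = c x) -> (forall x : R, is_derive x 1 c (c1 x)) ->
  is_derive (0 : R) 1 c1 k -> c1 0 = 0 ->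
  u n @[n --> \oo] --> (0 : R) -> v n @[n --> \oo] --> (0 : R) ->
  (forall n, 0 < r n) -> (v n ^+ 2 - u n ^+ 2) / r n @[n --> \oo] --> L ->
  (c (v n) - c (u n)) / r n @[n --> \oo] --> k / 2 * L.
Proof.
move=> ce dc dk c0 u0 v0 r0 qL.
pose D n := (v n ^+ 2 - u n ^+ 2) / r n.
suff H : (c (v n) - c (u n)) / r n - k / 2 * D n @[n --> \oo] --> (0 : R).
  rewrite (_ : (fun n => _) = (fun n => ((c (v n) - c (u n)) / r n - k / 2 * D n) + k / 2 * D n)).
    rewrite -[X in _ --> X]add0r; apply: cvgD => //.
    by apply: cvgM => //; exact: cvg_cst.
  by apply/funext => n; rewrite subrK.
apply/cvgr0Pnorm_le => e e0.
pose eta := e / (`|L| + 1).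
have L1 : 0 < `|L| + 1 by rewrite ltr_wpDl.
have eta0 : 0 < eta by rewrite divr_gt0.
have [d d0 cd] := derive_at0_bound dk c0 eta0.
pose ct t := c t - k / 2 * t ^+ 2.
pose ct1 t := c1 t - k * t.
have cte x : ct (- x) = ct x by rewrite /ct ce sqrrN.
have dct (x : R) : is_derive x 1 ct (ct1 x).
  have H : is_derive x 1 ct _ := is_deriveBf (dc x) (is_deriveZf (k / 2) (is_derive_sqrf x)).
  by apply: (is_derive_eq H); rewrite /ct1; field.
have inc := even_increment cte dct (ltW eta0) cd.
near=> n.
have ud : `|u n| <= d by near: n; move/cvgr0Pnorm_le : u0; exact.
have vd : `|v n| <= d by near: n; move/cvgr0Pnorm_le : v0; exact.
have DL : `|D n| <= `|L| + 1.
  have h : `|L - D n| <= 1 by near: n; move/cvgrPdist_le : qL; exact.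
  have := ler_normB L (L - D n); rewrite opprB addrC subrK => h'.
  by rewrite (le_trans h')// lerD2l.
have := inc _ _ ud vd; rewrite /ct => h.
rewrite (_ : _ - _ = (c (v n) - k / 2 * v n ^+ 2 - (c (u n) - k / 2 * u n ^+ 2)) / r n);
  last by rewrite /D; ring.
rewrite normrM (gtr0_norm (_ : 0 < (r n)^-1)) ?invr_gt0// ler_pdivrMr//.
apply: (le_trans h).
have -> : `|v n ^+ 2 - u n ^+ 2| = `|D n| * r n.
  by rewrite /D normrM (gtr0_norm (_ : 0 < (r n)^-1)) ?invr_gt0// divfK// gt_eqF.
rewrite mulrA ler_wpM2r ?(ltW (r0 n))// mulrC.
by rewrite /eta mulrA ler_pdivrMr// mulrC ler_wpM2l ?(ltW e0)//.
Unshelve. all: by end_near. Qed.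

End even_functions.

(** * Balancing functions on the logarithmic scale *)

Section balancing_functions.
Context {R : realType}.
Variables (g : R -> R) (M : R).
Hypotheses (bal : balancing g) (gpos : forall t, 0 < t -> 0 < g t).
Local Notation b := (bfun g).
Local Notation b1 := (derive1n 1 (bfun g)).
Local Notation b2 := (derive1n 2 (bfun g)).
Hypothesis db : forall x, derivable b x 1.
Hypothesis db1 : forall x, derivable b1 x 1.
Hypothesis b1M : forall x, `|b1 x| <= M.
Hypothesis b2M : forall x, `|b2 x| <= M.

Let Db (x : R) : is_derive x 1 b (b1 x).
Proof. exact: derivable_is_derive1. Qed.

Let Db1 (x : R) : is_derive x 1 b1 (b2 x).
Proof. exact: derivable_is_derive1. Qed.

Let M0 : 0 <= M. Proof. exact: le_trans (b1M 0). Qed.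

Lemma expR_bfun x : expR (b x) = g (expR x).
Proof. by rewrite /bfun lnK// posrE gpos// expR_gt0. Qed.

Lemma bfun_reflect x : b x = x + b (- x).
Proof.
apply: expR_inj; rewrite expRD !expR_bfun expRN.
by case: bal => _ _ /(_ _ (expR_gt0 x)).
Qed.

Lemma bfun0 : b 0 = 0.
Proof. by rewrite /bfun expR0; case: bal => _ _ _ ->; rewrite ln1. Qed.

Let is_deriveN (x : R) : is_derive x 1 (fun y : R => - y) (-1).
Proof.
have H : is_derive x 1 (fun y : R => 0 - y) _ := is_deriveBf (is_derive_cstf x 0) (is_derive_idf x).
rewrite (_ : (fun y : R => - y) = (fun y => 0 - y)); last by apply/funext => y; rewrite sub0r.
by apply: (is_derive_eq H); rewrite sub0r.
Qed.

(** Differentiating the reflection identity at 0 gives b'(0) = 1 - b'(0). *)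
Lemma bfun_derive0 : b1 0 = 2^-1.
Proof.
have H := is_deriveDf (is_derive_idf (0 : R)) (is_deriveCf (Db (- 0)) (is_deriveN 0)).
have := is_derive1E H; rewrite (_ : (fun y => _) = b); last first.
  by apply/funext => y; rewrite -bfun_reflect.
by rewrite (is_derive1E (Db 0)) oppr0; lra.
Qed.

Definition bfun_even (x : R) := b x - x / 2.

Lemma bfun_evenN x : bfun_even (- x) = bfun_even x.
Proof. by rewrite /bfun_even (bfun_reflect x); field. Qed.

Lemma bfun_even_derive (x : R) : is_derive x 1 bfun_even (b1 x - 2^-1).
Proof.
have H : is_derive x 1 bfun_even _ :=
  is_deriveBf (Db x) (is_deriveMf (is_derive_idf x) (is_derive_cstf x 2^-1)).
by apply: (is_derive_eq H); ring.
Qed.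

Let Db1c (x : R) : is_derive x 1 (fun x => b1 x - 2^-1) (b2 x).
Proof.
have H := is_deriveBf (Db1 x) (is_derive_cstf x 2^-1).
by apply: (is_derive_eq H); rewrite subr0.
Qed.

Lemma bfun_even_derive2 : is_derive (0 : R) 1 (fun x => b1 x - 2^-1) (b2 0).
Proof. exact: Db1c. Qed.

Lemma bfun_even_derive_bound t : `|b1 t - 2^-1| <= M * `|t|.
Proof.
have [u _] := mean_value 0 t Db1c; rewrite !add0r bfun_derive0 subrr subr0 => ->.
by rewrite normrM mulrC ler_wpM2r.
Qed.

Lemma bfun_even_lipschitz u v : `|bfun_even v - bfun_even u| <= (M + 1) * `|v - u|.
Proof.
have [w _] := mean_value u (v - u) bfun_even_derive; rewrite subrKC => ->.
rewrite normrM mulrC ler_wpM2r// (le_trans (ler_normB _ _))// lerD//.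
by rewrite ger0_norm ?invr_ge0// invf_le1// ler1n.
Qed.

(* The even part of the weight: [expR (bfun_sym x)] is the mean of [expR (b x)] and
   [expR (b (- x))], so a symmetric [mu] gives both the same normalising constants. *)
Definition bfun_sym (x : R) := b x + ln ((1 + expR (- x)) / 2).

Let ex0 x : 0 < 1 + expR x :> R.
Proof. by rewrite addr_gt0// expR_gt0. Qed.

Lemma expR_bfun_sym x : expR (bfun_sym x) = (expR (b x) + expR (b (- x))) / 2.
Proof.
rewrite /bfun_sym expRD lnK ?posrE ?divr_gt0//.
rewrite mulrA mulrDr mulr1 -expRD; congr ((_ + expR _) / 2).
by rewrite (bfun_reflect x); ring.
Qed.

Lemma bfun_symN x : bfun_sym (- x) = bfun_sym x.
Proof. by apply: expR_inj; rewrite !expR_bfun_sym opprK addrC. Qed.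

Lemma bfun_sym0 : bfun_sym 0 = 0.
Proof. by rewrite /bfun_sym bfun0 oppr0 expR0 divff// ln1 addr0. Qed.

Definition bfun_sym1 (x : R) := b1 x - (1 + expR x)^-1.

Lemma bfun_sym_derive (x : R) : is_derive x 1 bfun_sym (bfun_sym1 x).
Proof.
have E := is_deriveMf (is_deriveDf (is_derive_cstf x 1)
  (is_deriveCf (is_derive_expR (- x)) (is_deriveN x))) (is_derive_cstf x 2^-1).
have p0 : 0 < (1 + expR (- x)) / 2 by rewrite divr_gt0.
have H : is_derive x 1 bfun_sym _ := is_deriveDf (Db x) (is_deriveCf (g := fun y => (1 + expR (- y)) / 2) (is_derive1_ln p0) E).
apply: (is_derive_eq H); rewrite /bfun_sym1; congr (_ + _).
have := ex0 x; have e0 := expR_gt0 x; rewrite expRN => e1.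
by field; rewrite !lt0r_neq0// addrC.
Qed.

Let bfun_sym2 (x : R) := b2 x + expR x / (1 + expR x) ^+ 2.

Let bfun_sym1_derive (x : R) : is_derive x 1 bfun_sym1 (bfun_sym2 x).
Proof.
have E := is_deriveDf (is_derive_cstf x 1) (is_derive_expR x).
have n0 : (fun y => 1 + expR y) x != 0 by rewrite /= gt_eqF.
have V : is_derive x 1 (fun y => (1 + expR y)^-1) _ := is_deriveV (f := fun y => 1 + expR y) n0 E.
have H : is_derive x 1 bfun_sym1 _ := is_deriveBf (Db1 x) V.
apply: (is_derive_eq H); rewrite /bfun_sym2 /GRing.scale/=; congr (_ + _).
by rewrite add0r mulNr opprK mulrC.
Qed.

Lemma bfun_sym10 : bfun_sym1 0 = 0.
Proof. by rewrite /bfun_sym1 bfun_derive0 expR0 subrr. Qed.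

(** The additional 1/4 is the derivative of the logistic function at 0. *)
Lemma bfun_sym_derive2 : is_derive (0 : R) 1 bfun_sym1 (b2 0 + 4^-1).
Proof.
apply: (is_derive_eq (bfun_sym1_derive 0)); rewrite /bfun_sym2 expR0.
by congr (_ + _); field.
Qed.

Lemma bfun_sym_derive_bound t : `|bfun_sym1 t| <= (M + 1) * `|t|.
Proof.
have [u _] := mean_value 0 t bfun_sym1_derive; rewrite !add0r bfun_sym10 subr0 => ->.
rewrite normrM mulrC ler_wpM2r// (le_trans (ler_normD _ _))// lerD//.
have e0 := expR_gt0 u; rewrite ger0_norm ?divr_ge0 ?sqr_ge0 ?(ltW e0)//.
rewrite ler_pdivrMr ?exprn_gt0// mul1r; nra.
Qed.

Lemma bfun_bound u : `|b u| <= M * `|u|.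
Proof.
have [w _] := mean_value 0 u Db; rewrite !add0r bfun0 subr0 => ->.
by rewrite normrM mulrC ler_wpM2r.
Qed.

Lemma bfun_sym_bound u : `|bfun_sym u| <= (M + 1) * `|u|.
Proof.
have [w _] := mean_value 0 u bfun_sym_derive; rewrite !add0r bfun_sym0 subr0 => ->.
rewrite normrM mulrC ler_wpM2r// (le_trans (ler_normB _ _))// lerD//.
rewrite ger0_norm ?invr_ge0 ?(ltW (ex0 _))// invf_le1//.
by rewrite lerDl ltW// expR_gt0.
Qed.

Lemma measurable_bfun : measurable_fun setT b.
Proof. by apply: continuous_measurable_fun => x; exact: is_derive_continuous (Db x). Qed.

(** Near 1, g is the composite of exp, b and ln, so g''(1) = b''(0) + b'(0)^2 - b'(0), with b'(0) =
    1/2. *)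
Lemma frakgE : frakg g = b2 0 - 4^-1.
Proof.
pose G t := expR (b (ln t)) * (b1 (ln t) * t^-1).
have dg (t : R) : 0 < t -> is_derive t 1 g (G t).
  move=> t0; have dl := is_derive1_ln t0.
  have H := is_deriveCf (g := fun y => b (ln y)) (is_derive_expR (b (ln t))) (is_deriveCf (Db (ln t)) dl).
  apply: (near_eq_is_derive _ H).
  near=> y; have y0 : 0 < y by near: y; exact: lt_nbhsr.
  by rewrite expR_bfun lnK.
have dl := is_derive1_ln (ltr01 : 0 < 1 :> R).
have dV : is_derive (1 : R) 1 (fun y : R => y^-1) _ :=
  is_deriveV (oner_neq0 R : (fun y : R => y) 1 != 0) (is_derive_idf 1).
have HG : is_derive (1 : R) 1 G _ := is_deriveMf
  (is_deriveCf (g := fun y => b (ln y)) (is_derive_expR (b (ln 1))) (is_deriveCf (Db (ln 1)) dl))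
  (is_deriveMf (is_deriveCf (Db1 (ln 1)) dl) dV).
have E : \forall y \near (1 : R), G y = derive1 g y.
  near=> y; have y0 : 0 < y by near: y; exact: lt_nbhsr.
  by rewrite (is_derive1E (dg y y0)).
have HG' := near_eq_is_derive E HG.
rewrite /frakg (_ : derive1n 2 g = derive1 (derive1 g))//.
rewrite (is_derive1E HG') ln1 bfun0 expR0 invr1 bfun_derive0.
by rewrite -[_ *: _]/(_ * _); field.
Unshelve. all: by end_near. Qed.

End balancing_functions.

(** * Increments of the logarithm of the normalising constant *)

Section symmetric_tilt.
Context {R : realType}.
Variables (mu : probability R R) (b psi psi1 : R -> R) (M kappa xi beta C : R).
Hypotheses (mb : measurable_fun setT b) (bM : forall u, `|b u| <= M * `|u|).
Hypothesis expR_psi : forall x, expR (psi x) = (expR (b x) + expR (b (- x))) / 2.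
Hypotheses (psiN : forall x, psi (- x) = psi x) (psiM : forall u, `|psi u| <= M * `|u|).
Hypotheses (dpsi : forall x : R, is_derive x 1 psi (psi1 x)).
Hypotheses (dpsi0 : is_derive (0 : R) 1 psi1 kappa) (psi10 : psi1 0 = 0).
Hypothesis psi1M : forall t, `|psi1 t| <= M * `|t|.
Hypothesis muN : forall A : set R, measurable A -> mu ((fun z => - z) @^-1` A) = mu A.
Hypotheses (xi6 : 6 < xi) (beta0 : 0 <= beta) (C0 : 0 <= C).
Hypothesis ixi : mu.-integrable setT (EFin \o (fun z => `|z| `^ xi)).
Hypothesis mu2 : (\int[mu]_z (z ^+ 2)%:E = 1)%E.
Hypothesis tailC : forall a : R,
  (\int[mu]_z (expR (b (a * z)) * `|z| `^ xi)%:E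
     <= (C * (1 + `|a| `^ beta))%:E * \int[mu]_z (expR (b (a * z)))%:E)%E
  /\ (\int[mu]_z (expR (b (a * z)))%:E < +oo)%E.

Let mpsi : measurable_fun setT psi.
Proof. by apply: continuous_measurable_fun => x; exact: is_derive_continuous (dpsi x). Qed.

Let M1 : 0 <= M. Proof. by have := bM 1; rewrite normr1 mulr1; apply: le_trans. Qed.

Lemma integrable_tilt_bfun (a : R) : mu.-integrable setT (EFin \o (fun z => expR (b (a * z)))).
Proof.
apply/integrableP; split; first by apply/measurable_EFinP; exact: measurable_tilt.
under eq_integral do rewrite /= ger0_norm ?expR_ge0//.
by case: (tailC a).
Qed.

Lemma integrable_tilt_bfun_xi (a : R) :
  mu.-integrable setT (EFin \o (fun z => `|z| `^ xi * expR (b (a * z)))).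
Proof.
apply/integrableP; split.
  apply/measurable_EFinP; apply: measurable_funM; last exact: measurable_tilt.
  exact: measurable_abs_powR.
under eq_integral => z _.
  rewrite /= ger0_norm ?mulr_ge0 ?powR_ge0 ?expR_ge0// mulrC.
  over.
have [h1 h2] := tailC a; apply: (le_lt_trans h1).
have f : (\int[mu]_z (expR (b (a * z)))%:E)%E \is a fin_num.
  by rewrite ge0_fin_numE//; apply: integral_ge0 => z _; rewrite lee_fin expR_ge0.
by rewrite -(fineK f) -EFinM ltry.
Qed.

Lemma tilt_bfun_xi (a : R) : \int[mu]_z (`|z| `^ xi * expR (b (a * z))) <=
  C * (1 + `|a| `^ beta) * tilt_mass mu b a.
Proof.
have [h1 _] := tailC a.
rewrite -lee_fin EFinM /tilt_mass /Rintegral !fineK; first last.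
- exact: integrable_fin_num (integrable_tilt_bfun_xi a).
- exact: integrable_fin_num (integrable_tilt_bfun a).
by under eq_integral do rewrite mulrC.
Qed.

Let mN : measurable_fun setT (fun z : R => - z). Proof. exact: oppr_measurable. Qed.

(** Against an even [f], the symmetry of [mu] makes the weights built from b(a z) and b(-a z)
    interchangeable, hence both equal in effect to their mean. The mass and its [xi]-moment may
    therefore be computed with the even function [psi]. *)
Let psi_tilt (f : R -> R) (a : R) : (forall z, f (- z) = f z) ->
  mu.-integrable setT (EFin \o (fun z => f z * expR (b (a * z)))) ->
  mu.-integrable setT (EFin \o (fun z => f z * expR (psi (a * z)))) /\
  \int[mu]_z (f z * expR (psi (a * z))) = \int[mu]_z (f z * expR (b (a * z))).
Proof.
move=> fe fi.
have fiN : mu.-integrable setT (EFin \o (fun z => f z * expR (b (- (a * z))))).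
  rewrite (_ : (fun z => _) = (fun z => f z * expR (b (a * z))) \o (fun z => - z)).
    exact: integrable_invariant.
  by apply/funext => z /=; rewrite fe mulrN.
have fEN : \int[mu]_z (f z * expR (b (- (a * z)))) = \int[mu]_z (f z * expR (b (a * z))).
  have := Rintegral_invariant mN muN fi => <-.
  by apply: eq_Rintegral => z _; rewrite fe mulrN.
have k1 := integrable_scale 2^-1 fi; have k2 := integrable_scale 2^-1 fiN.
have E z : f z * expR (psi (a * z)) = 2^-1 * (f z * expR (b (a * z)))
    + 2^-1 * (f z * expR (b (- (a * z)))).
  by rewrite expR_psi; ring.
split.
  rewrite (funext E).
  by have := integrableD measurableT k1 k2; exact: eq_integrable.
under eq_Rintegral do rewrite E.
by rewrite RintegralD// !RintegralZl// fEN; field.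
Qed.

Let mul1f (f : R -> R) : (fun z => 1 * f z) = f.
Proof. by apply/funext => z; rewrite mul1r. Qed.

Let psi_tilt1 (a : R) : mu.-integrable setT (EFin \o (fun z => 1 * expR (psi (a * z)))) /\
  \int[mu]_z (1 * expR (psi (a * z))) = \int[mu]_z (1 * expR (b (a * z))).
Proof.
apply: (psi_tilt (f := fun=> 1)) => //.
by rewrite (mul1f (fun z => expR (b (a * z)))); exact: integrable_tilt_bfun.
Qed.

Lemma integrable_tilt_sym (a : R) :
  mu.-integrable setT (EFin \o (fun z => expR (psi (a * z)))).
Proof. by case: (psi_tilt1 a); rewrite (mul1f (fun z => expR (psi (a * z)))). Qed.

Lemma tilt_mass_sym (a : R) : tilt_mass mu psi a = tilt_mass mu b a.
Proof.
case: (psi_tilt1 a) => _.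
by rewrite (mul1f (fun z => expR (psi (a * z)))) (mul1f (fun z => expR (b (a * z)))).
Qed.

Let absN (z : R) : `|- z| `^ xi = `|z| `^ xi. Proof. by rewrite normrN. Qed.

Lemma integrable_tilt_sym_xi (a : R) :
  mu.-integrable setT (EFin \o (fun z => `|z| `^ xi * expR (psi (a * z)))).
Proof. by case: (psi_tilt absN (integrable_tilt_bfun_xi a)). Qed.

Lemma tilt_sym_xi (a : R) : \int[mu]_z (`|z| `^ xi * expR (psi (a * z))) <=
  C * (1 + `|a| `^ beta) * tilt_mass mu psi a.
Proof.
case: (psi_tilt absN (integrable_tilt_bfun_xi a)) => _ ->.
by rewrite tilt_mass_sym tilt_bfun_xi.
Qed.

Lemma tilt_mass_bfun_gt0 (a : R) : 0 < tilt_mass mu b a.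
Proof. exact: (tilt_mass_gt0 mb bM xi6 ixi integrable_tilt_bfun). Qed.

Let Z0 (a : R) : 0 < tilt_mass mu psi a.
Proof. by rewrite tilt_mass_sym tilt_mass_bfun_gt0. Qed.

(** Since [psi] is even, this difference is bounded by a multiple of |a^2 - a'^2| z^2; the same
    difference for [b] would be of the order of (a - a') z. *)
Let D (a a' z : R) := psi (a * z) - psi (a' * z).

Let mD a a' : measurable_fun setT (D a a').
Proof. by apply: measurable_funB; apply: measurableT_comp. Qed.

Let D_sqr (a a' z : R) : `|D a a' z| <= M * `|a ^+ 2 - a' ^+ 2| * z ^+ 2.
Proof.
have := @even_increment _ psi psi1 M (`|a' * z| + `|a * z|)
  psiN dpsi M1 (fun t _ => psi1M t) (a' * z) (a * z).
rewrite lerDl lerDr !normr_ge0 => /(_ isT isT); rewrite /D => /le_trans; apply.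
by rewrite !exprMn -mulrBl normrM (ger0_norm (sqr_ge0 z)) mulrA.
Qed.

Let D_xi (a a' z : R) : `|D a a' z| <= M * `|a ^+ 2 - a' ^+ 2| +
  M * `|a ^+ 2 - a' ^+ 2| * `|z| `^ xi.
Proof.
apply: (le_trans (D_sqr a a' z)).
rewrite -{2}(mulr1 (M * _)) -mulrDr ler_wpM2l ?mulr_ge0//.
rewrite -(real_normK (num_real z)); apply: ler_exp_powR => //.
by apply: le_trans (ltW xi6); rewrite ler_nat.
Qed.

Let mean a a' := (\int[mu]_z (D a a' z * expR (psi (a' * z)))) / tilt_mass mu psi a'.

(** Jensen under the law tilted at [a']. Exchanging the arguments gives the matching upper bound, so
    an increment of the logarithm of the mass lies between two tilted means, and the mass is never
    differentiated. *)
Lemma ln_tilt_mass_ge (a a' : R) : mean a a' <= ln (tilt_mass mu b a) - ln (tilt_mass mu b a').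
Proof.
rewrite -!tilt_mass_sym lerBrDr -ler_expR expRD !lnK ?posrE//.
apply: (tilt_jensen mpsi integrable_tilt_sym integrable_tilt_sym_xi (mD a a') (D_xi a a')) => //.
by move=> z; rewrite /D subrKC.
Qed.

Let meanN a a' : \int[mu]_z (D a a' z * expR (psi (a * z))) / tilt_mass mu psi a = - mean a' a.
Proof.
rewrite /mean -mulNr -mulN1r -RintegralZl//; last first.
  exact: (tilt_integrable mpsi integrable_tilt_sym integrable_tilt_sym_xi a (mD a' a) (D_xi a' a)).
by congr (_ / _); apply: eq_Rintegral => z _; rewrite /D; ring.
Qed.

Lemma ln_tilt_mass_le (a a' : R) :
  ln (tilt_mass mu b a) - ln (tilt_mass mu b a') <= - mean a' a.
Proof. by rewrite -opprB lerN2; exact: ln_tilt_mass_ge. Qed.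

Let mean_bound (a a' : R) :
  `|mean a a'| <= M * `|a ^+ 2 - a' ^+ 2| * (1 + C * (1 + `|a'| `^ beta)).
Proof.
have c0 : 0 <= M * `|a ^+ 2 - a' ^+ 2| by rewrite mulr_ge0.
rewrite /mean normrM (gtr0_norm (_ : 0 < (tilt_mass _ _ _)^-1)) ?invr_gt0//.
have := tilt_bound mpsi psiM xi6 ixi integrable_tilt_sym integrable_tilt_sym_xi
  tilt_sym_xi a' (mD a a') (D_xi a a') c0.
by move=> /le_trans; apply; rewrite [leRHS]mulrDr mulr1.
Qed.

Lemma ln_tilt_mass_bound (a a' : R) :
  `|ln (tilt_mass mu b a) - ln (tilt_mass mu b a')| <=
  M * (1 + C) * (`|a ^+ 2 - a' ^+ 2| * (1 + Num.max `|a| `|a'| `^ beta)).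
Proof.
have aux (x y z K : R) : y <= x -> x <= - z -> `|y| <= K -> `|z| <= K -> `|x| <= K.
  rewrite !ler_norml => ? ? /andP[? ?] /andP[? ?]; apply/andP; split; lra.
have h (c : R) : 0 <= c -> c <= Num.max `|a| `|a'| ->
    M * `|a ^+ 2 - a' ^+ 2| * (1 + C * (1 + c `^ beta)) <=
    M * (1 + C) * (`|a ^+ 2 - a' ^+ 2| * (1 + Num.max `|a| `|a'| `^ beta)).
  move=> c0 cm.
  have p : c `^ beta <= Num.max `|a| `|a'| `^ beta.
    by apply: ge0_ler_powR => //; rewrite nnegrE// (le_trans c0).
  rewrite (_ : M * (1 + C) * _ = M * `|a ^+ 2 - a' ^+ 2| *
    ((1 + C) * (1 + Num.max `|a| `|a'| `^ beta))); last by ring.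
  rewrite ler_wpM2l ?mulr_ge0//.
  have := ler_wpM2l C0 p; have := powR_ge0 c beta; move: C0; nra.
have h1 := ln_tilt_mass_ge a a'; have h2 := ln_tilt_mass_le a a'.
have b1 := mean_bound a a'; have b2 := mean_bound a' a.
rewrite distrC in b2.
have c1 := h `|a'| (normr_ge0 _); rewrite le_max lexx orbT in c1.
have c2 := h `|a| (normr_ge0 _); rewrite le_max lexx in c2.
have d1 := le_trans b1 (c1 isT); have d2 := le_trans b2 (c2 isT).
exact: aux h1 h2 d1 d2.
Qed.

(** Squeeze between the two Jensen means. By [tilt_cvg], applied at [a'] and at [a], both have the
    same limit: the integrand tends to (kappa / 2) L z^2, and [mu] has unit second moment. *)
Lemma ln_tilt_mass_cvg (a a' r : R^nat) (L : R) :
  (forall n, `|a n| <= 1) -> (forall n, `|a' n| <= 1) ->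
  a n @[n --> \oo] --> (0 : R) -> a' n @[n --> \oo] --> (0 : R) ->
  (forall n, 0 < r n) -> (a n ^+ 2 - a' n ^+ 2) / r n @[n --> \oo] --> L ->
  (ln (tilt_mass mu b (a n)) - ln (tilt_mass mu b (a' n))) / r n @[n --> \oo]
    --> kappa / 2 * L.
Proof.
move=> a1 a'1 a0 a'0 r0 qL.
have [K K0 Kq] : exists2 K, 0 <= K & forall n, `|(a n ^+ 2 - a' n ^+ 2) / r n| <= K.
  have : cvgn (fun n => (a n ^+ 2 - a' n ^+ 2) / r n) by apply/cvg_ex; exists L.
  by move=> /cvg_seq_bounded/pinfty_ex_gt0[K K0 /= Kq]; exists K; [exact: ltW|move=> n; exact: Kq].
pose u n z := D (a n) (a' n) z / r n.
have mu_ n : measurable_fun setT (u n) by apply: measurable_funM.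
have uz z : u n z @[n --> \oo] --> kappa / 2 * (L * z ^+ 2).
  apply: (even_increment_cvg psiN dpsi dpsi0 psi10) => //.
  - by rewrite -(mul0r z); apply: cvgM; [exact: a'0|exact: cvg_cst].
  - by rewrite -(mul0r z); apply: cvgM; [exact: a0|exact: cvg_cst].
  - rewrite (_ : (fun n => _) = (fun n => (a n ^+ 2 - a' n ^+ 2) / r n * z ^+ 2)).
      by apply: cvgM; [exact: qL|exact: cvg_cst].
    by apply/funext => n; rewrite !exprMn; ring.
have e01 (n : nat) : 0 <= (0 : R) <= 1 by rewrite lexx ler01.
have D0 : 0 <= M * K by rewrite mulr_ge0.
have e0 : (0 : R) @[n --> \oo] --> (0 : R) by exact: cvg_cst.
have uD n z : `|u n z| <= M * K * (1 + z ^+ 6 + 0 * `|z| `^ xi).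
  rewrite mul0r addr0 /u normrM (gtr0_norm (_ : 0 < (r n)^-1)) ?invr_gt0//.
  rewrite ler_pdivrMr//; apply: (le_trans (D_sqr _ _ _)).
  have h : `|a n ^+ 2 - a' n ^+ 2| <= K * r n.
    have := Kq n; rewrite normrM (gtr0_norm (_ : 0 < (r n)^-1)) ?invr_gt0//.
    by rewrite ler_pdivrMr.
  have z6 : z ^+ 2 <= 1 + z ^+ 6.
    rewrite (exprM z 2 3); have := sqr_ge0 z; set y := z ^+ 2 => y0.
    have [y1|y1] := leP y 1; first by rewrite (le_trans y1)// lerDl exprn_ge0.
    by rewrite (le_trans _ (_ : y ^+ 3 <= _))// ?lerDr// ler_eXnr// ltW.
  rewrite -!mulrA ler_wpM2l// [leRHS](_ : _ = K * r n * (1 + z ^+ 6)); last by ring.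
  by rewrite ler_pM// sqr_ge0.
have I2 : \int[mu]_z (kappa / 2 * (L * z ^+ 2)) = kappa / 2 * L.
  under eq_Rintegral do rewrite mulrA.
  rewrite RintegralZl//; first by rewrite /Rintegral mu2 mulr1.
  apply/integrableP; split; first by apply/measurable_EFinP; exact: measurable_funX.
  by under eq_integral do rewrite /= ger0_norm ?sqr_ge0//; rewrite mu2 ltry.
have lim1 := tilt_cvg mpsi psiM xi6 beta0 C0 ixi integrable_tilt_sym integrable_tilt_sym_xi
  tilt_sym_xi a'1 a'0 mu_ uz D0 e01 e0 uD.
have lim2 := tilt_cvg mpsi psiM xi6 beta0 C0 ixi integrable_tilt_sym integrable_tilt_sym_xi
  tilt_sym_xi a1 a0 mu_ uz D0 e01 e0 uD.
rewrite I2 in lim1 lim2.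
have iD c n : mu.-integrable setT (EFin \o (fun z => D (a n) (a' n) z * expR (psi (c * z)))).
  exact: (tilt_integrable mpsi integrable_tilt_sym integrable_tilt_sym_xi c (mD _ _) (D_xi _ _)).
have uE c n : \int[mu]_z (u n z * expR (psi (c * z))) =
    (\int[mu]_z (D (a n) (a' n) z * expR (psi (c * z)))) / r n.
  by rewrite mulrC -RintegralZl//; apply: eq_Rintegral => z _; rewrite /u; ring.
apply: (squeeze_cvgr _ lim1 lim2); apply: nearW => n.
rewrite !uE mulrAC -/(mean (a n) (a' n)) [X in _ <= _ <= X]mulrAC meanN.
by rewrite !ler_wpM2r ?invr_ge0 ?(ltW (r0 n)) ?ln_tilt_mass_ge ?ln_tilt_mass_le.
Qed.

End symmetric_tilt.

(** * The log-Metropolis-Hastings ratio *)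

Section absolute_powers.
Context {R : realType}.
Variable beta : R.
Hypothesis beta0 : 0 <= beta.

Lemma abs_powR2 (t : R) : `|t| `^ (2 + beta) = t * `|t| `^ beta * t.
Proof.
have [->|t0] := eqVneq t 0; first by rewrite mulr0 normr0 powR0// gt_eqF// ltr_wpDr.
rewrite powRD ?normr_eq0 ?t0 ?implybT// (powR_mulrn 2)// real_normK ?num_real//.
by ring.
Qed.

Lemma abs_powR1 (t : R) : `|t * `|t| `^ beta| = `|t| `^ (1 + beta).
Proof.
have [->|t0] := eqVneq t 0; first by rewrite mul0r normr0 powR0// gt_eqF// ltr_wpDr.
rewrite powRD ?normr_eq0 ?t0 ?implybT// powRr1//.
by rewrite normrM (ger0_norm (powR_ge0 _ _)).
Qed.

(** Off 0 this is the rule for powers, transported by y -> -y when [t] is negative; at 0 the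
    function y |y|^beta is a Caratheodory slope, continuous there because |y|^beta <= 1 for small
    y. *)
Lemma is_derive_abs_powR (t : R) :
  is_derive t 1 (fun y => `|y| `^ (2 + beta)) ((2 + beta) * (t * `|t| `^ beta)).
Proof.
have powE (y : R) : 0 < y -> y `^ (2 + beta - 1) = y * y `^ beta.
  move=> y0; rewrite (_ : 2 + beta - 1 = 1 + beta); last by ring.
  by rewrite powRD; [rewrite powRr1// ltW|rewrite (gt_eqF y0) implybT].
have [t0|t0|->] := ltgtP t 0; last first.
- apply/is_derive1_caratheodory; exists (fun y => y * `|y| `^ beta); split.
  + by move=> z; rewrite !abs_powR2 !mul0r !subr0.
  + suff : (y * `|y| `^ beta) @[y --> (0 : R)] --> (0 : R).
      by rewrite /prop_for /continuous_at mul0r.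
    apply/cvgr0Pnorm_le => e e0.
    have : \forall z \near (0 : R), `|z| <= Num.min e 1.
      have m0 : 0 < Num.min e 1 by rewrite lt_min e0 ltr01.
      have /cvgr0Pnorm_le : z @[z --> (0 : R)] --> (0 : R) by exact: cvg_id.
      exact.
    apply: filterS => z; rewrite le_min => /andP[ze z1].
    rewrite normrM (ger0_norm (powR_ge0 _ _)); apply: le_trans ze; rewrite ler_piMr//.
    apply: (@le_trans _ _ (1 `^ beta)); last by rewrite powR1.
    by apply: ge0_ler_powR => //; rewrite nnegrE.
  + by rewrite mul0r mulr0.
- have H := is_derive1_powR (2 + beta) t0.
  have -> : (2 + beta) * (t * `|t| `^ beta) = (2 + beta) * t `^ (2 + beta - 1).
    by rewrite powE// gtr0_norm.
  apply: (near_eq_is_derive _ H); near=> y.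
  by rewrite gtr0_norm//; near: y; exact: lt_nbhsr.
have nt : 0 < - t by rewrite oppr_gt0.
have dN : is_derive t 1 (fun y : R => 0 - y) (0 - 1) :=
  is_deriveBf (is_derive_cstf t 0) (is_derive_idf t).
have tE : 0 - t = - t by rewrite sub0r.
have P := is_derive1_powR (2 + beta) nt; rewrite -tE in P.
have H := is_deriveCf (g := fun y : R => 0 - y) P dN.
have -> : (2 + beta) * (t * `|t| `^ beta) = (2 + beta) * (0 - t) `^ (2 + beta - 1) * (0 - 1).
  by rewrite tE powE// ltr0_norm//; ring.
apply: (near_eq_is_derive _ H); near=> y.
have y0 : y < 0 by near: y; exact: lt_nbhsl.
by rewrite sub0r ltr0_norm.
Unshelve. all: by end_near. Qed.

(** For |q| <= |p|, compare q^2 |q|^beta with q^2 |p|^beta. This turns the bound on increments of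
    the log-mass into an increment of |p1|^(2 + beta), whose derivative has the size of p2 |p1|^(1 +
    beta), a function with controlled growth. *)
Lemma sqr_diff_powR (p q : R) : `|p ^+ 2 - q ^+ 2| * Num.max `|p| `|q| `^ beta <=
  `| `|q| `^ (2 + beta) - `|p| `^ (2 + beta) |.
Proof.
wlog qp : p q / `|q| <= `|p|.
  move=> W; have [h|] := boolP (`|q| <= `|p|); first exact: W.
  by rewrite -ltNge => /ltW h; rewrite distrC maxC [leRHS]distrC; exact: W.
rewrite (max_idPl qp) distrC.
have qb : `|q| `^ beta <= `|p| `^ beta by apply: ge0_ler_powR; rewrite ?nnegrE.
have p0 := powR_ge0 `|p| beta; have q0 := powR_ge0 `|q| beta.
have q2p2 : q ^+ 2 <= p ^+ 2.
  by rewrite -(real_normK (num_real q)) -(real_normK (num_real p)) lerXn2r ?nnegrE.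
rewrite !abs_powR2 [leRHS]ler0_norm ?opprB; last first.
  by rewrite subr_le0 [leLHS]mulrAC [leRHS]mulrAC -!expr2 ler_pM ?sqr_ge0.
rewrite ler0_norm ?subr_le0// opprB mulrBl lerB//.
- by rewrite [leRHS]mulrAC -expr2.
- by rewrite [leLHS]mulrAC -expr2 ler_wpM2l ?sqr_ge0.
Qed.

End absolute_powers.

(** * Third order bounds and pointwise limit of the log-ratio *)

Section log_ratio.
Context {R : realType}.
Variables (phi p1 p2 p3 c c1 Lam : R -> R) (M kc kl : R).
Variables (H gamma beta xi : R) (K1 K2 K3 K4 : R -> R).
Hypotheses (dphi : forall x : R, is_derive x 1 phi (p1 x)).
Hypotheses (dp1 : forall x : R, is_derive x 1 p1 (p2 x)).
Hypotheses (dp2 : forall x : R, is_derive x 1 p2 (p3 x)) (cp3 : continuous p3).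
Hypotheses (cN : forall x, c (- x) = c x) (dc : forall x : R, is_derive x 1 c (c1 x)).
Hypotheses (dc0 : is_derive (0 : R) 1 c1 kc) (c10 : c1 0 = 0) (M0 : 0 <= M).
Hypotheses (c1M : forall t, `|c1 t| <= M * `|t|).
Hypotheses (cM : forall u v, `|c v - c u| <= M * `|v - u|).
Hypothesis LamM : forall a a', `|Lam a - Lam a'| <=
  M * (`|a ^+ 2 - a' ^+ 2| * (1 + Num.max `|a| `|a'| `^ beta)).
Hypothesis Lam_cvg : forall (a a' r : R^nat) (L : R),
  (forall n, `|a n| <= 1) -> (forall n, `|a' n| <= 1) ->
  a n @[n --> \oo] --> (0 : R) -> a' n @[n --> \oo] --> (0 : R) ->
  (forall n, 0 < r n) -> (a n ^+ 2 - a' n ^+ 2) / r n @[n --> \oo] --> L ->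
  (Lam (a n) - Lam (a' n)) / r n @[n --> \oo] --> kl / 2 * L.
Hypotheses (H0 : 0 < H) (gamma0 : 0 < gamma) (beta0 : 0 <= beta).
Hypotheses (xi6 : 6 < xi) (xiH : 2 + 2 * H <= xi) (xig : 2 + 2 * gamma <= xi).

Definition holder (d : R) := Num.max (`|d| `^ H) (`|d| `^ gamma).

Hypothesis g1 : forall x d, `|p3 (x + d) - p3 x| <= K1 x * holder d.
Hypothesis g2 : forall x d, `|p2 (x + d) * p1 (x + d) - p2 x * p1 x| <= K2 x * holder d.
Hypothesis g3 : forall x d, `|p1 (x + d) ^+ 3 - p1 x ^+ 3| <= K3 x * holder d.
Hypothesis g4 : forall x d, `|p2 (x + d) * `|p1 (x + d)| `^ (1 + beta)
  - p2 x * `|p1 x| `^ (1 + beta)| <= K4 x * holder d.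

Definition trapezoid (x h : R) := phi (x + h) - phi x - h / 2 * (p1 x + p1 (x + h)).

(* [log_ratio s x h] is [rho_s(x, x + h)] once [b u] is split as [u / 2] plus its even part [c]:
   the linear parts produce the trapezoidal rule error for [phi]. *)
Definition log_ratio (s x h : R) := trapezoid x h + (c (p1 (x + h) * h) - c (p1 x * h))
  + (Lam (s * p1 x) - Lam (s * p1 (x + h))).

(** The summand 1 serves to bound [p1], whose increments are controlled only through its cube, by
    means of |p1| <= 1 + |p1|^3. *)
Definition envelope (x : R) := 1 + (`|p3 x| + K1 x) + (`|p2 x * p1 x| + K2 x)
  + (`|p1 x ^+ 3| + K3 x) + (`|p2 x * `|p1 x| `^ (1 + beta)| + K4 x).

Let G d := 1 + holder d.

Let holder_ge0 d : 0 <= holder d.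
Proof. by rewrite /holder le_max powR_ge0. Qed.

Let holder1 : holder 1 = 1.
Proof. by rewrite /holder normr1 !powR1 maxxx. Qed.

Let K_ge0 (f K : R -> R) : (forall x d, `|f (x + d) - f x| <= K x * holder d) ->
  forall x, 0 <= K x.
Proof. by move=> fK x; have := fK x 1; rewrite holder1 mulr1; apply: le_trans. Qed.

Let K10 x : 0 <= K1 x. Proof. exact: (K_ge0 (f := p3) g1). Qed.
Let K20 x : 0 <= K2 x. Proof. exact: (K_ge0 (f := fun x => p2 x * p1 x) g2). Qed.
Let K30 x : 0 <= K3 x. Proof. exact: (K_ge0 (f := fun x => p1 x ^+ 3) g3). Qed.
Let K40 x : 0 <= K4 x.
Proof. exact: (K_ge0 (f := fun x => p2 x * `|p1 x| `^ (1 + beta)) g4). Qed.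

Let holder_mono u h : `|u| <= `|h| -> holder u <= holder h.
Proof.
move=> uh; rewrite /holder ge_max !le_max; apply/andP; split; apply/orP; [left|right].
- by apply: ge0_ler_powR; rewrite ?nnegrE// ltW.
- by apply: ge0_ler_powR; rewrite ?nnegrE// ltW.
Qed.

Let growth (f K : R -> R) : (forall x d, `|f (x + d) - f x| <= K x * holder d) ->
  (forall x, 0 <= K x) -> forall x u h, `|u| <= `|h| -> `|f (x + u)| <= (`|f x| + K x) * G h.
Proof.
move=> fK K0 x u h uh; have := fK x u; have := ler_wpM2l (K0 x) (holder_mono uh).
have hh := holder_ge0 h; have := mulr_ge0 (normr_ge0 (f x)) hh.
have := ler_normD (f (x + u) - f x) (f x); rewrite subrK /G.
have := K0 x; nra.
Qed.

Let envelope_terms x : [/\ `|p3 x| + K1 x <= envelope x, `|p2 x * p1 x| + K2 x <= envelope x,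
  1 + (`|p1 x ^+ 3| + K3 x) <= envelope x &
  (`|p2 x * `|p1 x| `^ (1 + beta)| + K4 x) <= envelope x].
Proof.
rewrite /envelope; have := K10 x; have := K20 x; have := K30 x; have := K40 x.
have := normr_ge0 (p3 x); have := normr_ge0 (p2 x * p1 x).
have := normr_ge0 (p1 x ^+ 3); have := normr_ge0 (p2 x * `|p1 x| `^ (1 + beta)).
move: `|p3 x| `|p2 x * p1 x| `|p1 x ^+ 3| `|p2 x * _| (K1 x) (K2 x) (K3 x) (K4 x).
by move=> *; split; lra.
Qed.

Let envelope_ge0 x : 0 <= envelope x.
Proof. by have [h _ _ _] := envelope_terms x; apply: le_trans h; rewrite addr_ge0. Qed.

Let G0 h : 0 <= G h. Proof. by rewrite addr_ge0. Qed.

Let f2_bound x u h : `|u| <= `|h| -> `|p2 (x + u) * p1 (x + u)| <= envelope x * G h.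
Proof.
move=> uh; apply: (le_trans (growth (f := fun x => p2 x * p1 x) g2 K20 x uh)).
by rewrite ler_wpM2r//; case: (envelope_terms x).
Qed.

Let f4_bound x u h : `|u| <= `|h| ->
  `|p2 (x + u) * `|p1 (x + u)| `^ (1 + beta)| <= envelope x * G h.
Proof.
move=> uh; apply: (le_trans (growth (f := fun x => p2 x * `|p1 x| `^ (1 + beta)) g4 K40 x uh)).
by rewrite ler_wpM2r//; case: (envelope_terms x).
Qed.

Let p1_bound x u h : `|u| <= `|h| -> `|p1 (x + u)| <= envelope x * G h.
Proof.
move=> uh; have h3 := growth (f := fun x => p1 x ^+ 3) g3 K30 x uh.
apply: (@le_trans _ _ (1 + `|p1 (x + u) ^+ 3|)).
  rewrite normrX; have := normr_ge0 (p1 (x + u)); set y := `|_| => y0.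
  have [y1|y1] := leP y 1; first by rewrite (le_trans y1)// lerDl exprn_ge0.
  by rewrite (le_trans _ (_ : y ^+ 3 <= _)) ?lerDr// ler_eXnr// ltW.
apply: (@le_trans _ _ ((1 + (`|p1 x ^+ 3| + K3 x)) * G h)).
  by rewrite mulrDl mul1r lerD// /G lerDl.
by rewrite ler_wpM2r//; case: (envelope_terms x).
Qed.

Let sqr_increment x h : exists2 u, `|u| <= `|h| &
  p1 (x + h) ^+ 2 - p1 x ^+ 2 = h * (2 * (p2 (x + u) * p1 (x + u))).
Proof.
have d2 (y : R) : is_derive y 1 (fun y => p1 y ^+ 2) (2 * (p2 y * p1 y)).
  have D := is_deriveMf (dp1 y) (dp1 y).
  by apply: (is_derive_eq D); ring.
exact: (mean_value x h d2).
Qed.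

Let sqr_bound x h : `|p1 (x + h) ^+ 2 - p1 x ^+ 2| <= 2 * `|h| * (envelope x * G h).
Proof.
have [u uh ->] := sqr_increment x h.
rewrite !normrM (ger0_norm (ler0n _ 2)) -normrM mulrCA -mulrA ler_wpM2l// ler_wpM2l//.
exact: f2_bound.
Qed.

Let pow_bound x h : `| `|p1 (x + h)| `^ (2 + beta) - `|p1 x| `^ (2 + beta) | <=
  (2 + beta) * `|h| * (envelope x * G h).
Proof.
have d2 (y : R) : is_derive y 1 (fun y => `|p1 y| `^ (2 + beta))
   ((2 + beta) * (p1 y * `|p1 y| `^ beta) * p2 y).
  exact: (is_deriveCf (is_derive_abs_powR beta0 (p1 y)) (dp1 y)).
have [u uh ->] := mean_value x h d2.
have b2 : 0 <= 2 + beta by rewrite addr_ge0.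
rewrite (_ : h * _ = (2 + beta) * (h * (p2 (x + u) * (p1 (x + u) * `|p1 (x + u)| `^ beta))));
  last by ring.
rewrite normrM (ger0_norm b2) -[leRHS]mulrA ler_wpM2l// normrM ler_wpM2l//.
rewrite normrM abs_powR1//; apply: le_trans (f4_bound x uh).
by rewrite normrM (ger0_norm (powR_ge0 _ _)).
Qed.

(** The corrected error vanishes at 0 together with its first derivative, and its second derivative
    is -(t / 2) (p3(x + t) - p3(x)). Two mean value steps thus leave an increment of [p3], with no
    fourth derivative. *)
Lemma trapezoid_error x h : exists2 u, `|u| <= `|h| &
  `|trapezoid x h + p3 x * h ^+ 3 / 12| <= `|h| ^+ 3 / 2 * `|p3 (x + u) - p3 x|.
Proof.
pose E t := trapezoid x t + p3 x * t ^+ 3 / 12.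
pose E1 t := (p1 (x + t) - p1 x) / 2 - t / 2 * p2 (x + t) + p3 x * t ^+ 2 / 4.
pose E2 t := - (t / 2) * (p3 (x + t) - p3 x).
have dt (t : R) : is_derive t 1 (fun t => x + t) (0 + 1) :=
  is_deriveDf (is_derive_cstf t x) (is_derive_idf t).
have dcube (t : R) : is_derive t 1 (fun t : R => t ^+ 3) (3 * t ^+ 2).
  have D : is_derive t 1 (fun t : R => t * t ^+ 2) _ :=
    is_deriveMf (is_derive_idf t) (is_derive_sqrf t).
  rewrite (_ : (fun t : R => t ^+ 3) = (fun t => t * t ^+ 2)); last first.
    by apply/funext => y; rewrite exprS.
  by apply: (is_derive_eq D); ring.
have dE (t : R) : is_derive t 1 E (E1 t).
  have D : is_derive t 1 E _ := is_deriveDf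
    (is_deriveBf (is_deriveBf (is_deriveCf (dphi (x + t)) (dt t)) (is_derive_cstf t (phi x)))
      (is_deriveMf (is_deriveMf (is_derive_idf t) (is_derive_cstf t 2^-1))
        (is_deriveDf (is_derive_cstf t (p1 x)) (is_deriveCf (dp1 (x + t)) (dt t)))))
    (is_deriveMf (is_deriveMf (is_derive_cstf t (p3 x)) (dcube t)) (is_derive_cstf t 12^-1)).
  by apply: (is_derive_eq D); rewrite /E1; field.
have dE1 (t : R) : is_derive t 1 E1 (E2 t).
  have D : is_derive t 1 E1 _ := is_deriveDf
    (is_deriveBf (is_deriveMf (is_deriveBf (is_deriveCf (dp1 (x + t)) (dt t))
       (is_derive_cstf t (p1 x))) (is_derive_cstf t 2^-1))
      (is_deriveMf (is_deriveMf (is_derive_idf t) (is_derive_cstf t 2^-1))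
        (is_deriveCf (dp2 (x + t)) (dt t))))
    (is_deriveMf (is_deriveMf (is_derive_cstf t (p3 x)) (is_derive_sqrf t))
       (is_derive_cstf t 4^-1)).
  by apply: (is_derive_eq D); rewrite /E2; field.
have E0 : E 0 = 0 by rewrite /E /trapezoid addr0; field.
have E10 : E1 0 = 0 by rewrite /E1 addr0; field.
have [u uh] := mean_value 0 h dE; rewrite !add0r E0 subr0 => EE.
have [v vu] := mean_value 0 u dE1; rewrite !add0r E10 subr0 => EE1.
exists v; first exact: le_trans uh.
rewrite -/(E h) EE EE1 /E2 !normrM normrN normrM (ger0_norm (_ : 0 <= 2^-1)) ?invr_ge0//.
rewrite (_ : `|h| ^+ 3 / 2 = `|h| * (`|h| * (`|h| / 2))); last by field.
rewrite -[leRHS]mulrA ler_wpM2l// -[leRHS]mulrA ler_pM// ler_wpM2r// ler_wpM2r ?invr_ge0//.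
exact: le_trans uh.
Qed.

(** Two regimes. For |h| <= 1 every term is of third order in [h] and [s] together. For |h| > 1
    first order bounds suffice, since growth of order |h|^(1 + H) or |h|^(1 + gamma) stays below
    |h|^(xi / 2) by the choice of [xi]. *)
Lemma log_ratio_bound : exists2 A, 0 <= A & forall s x h, 0 <= s <= 1 ->
  (`|h| <= 1 -> `|log_ratio s x h| <= A * envelope x * (`|h| ^+ 3 + s ^+ 2 * `|h|)) /\
  (1 < `|h| -> `|log_ratio s x h| <= A * envelope x * `|h| `^ (xi / 2)).
Proof.
(* Twice the sum of the coefficients [2], [2 * M] and [M * (4 + beta)] of the three terms when |h| >
   1; it also covers |h| <= 1. *)
exists (4 + 4 * M + 2 * M * (4 + beta)).
  by rewrite !addr_ge0 ?mulr_ge0 ?addr_ge0.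
move=> s x h /andP[s0 s1].
have e0 := envelope_ge0 x; have n0 := normr_ge0 h; have Gh0 := G0 h.
set S := envelope x in e0 *.
have hh : `|h| <= `|h| by [].
have z0 : `|0 : R| <= `|h| by rewrite normr0.
have T3 : `|Lam (s * p1 x) - Lam (s * p1 (x + h))| <=
    M * (4 + beta) * (s ^+ 2 * `|h|) * (S * G h).
  apply: (le_trans (LamM _ _)); rewrite -[leRHS]mulrA -[leRHS]mulrA ler_wpM2l//.
  rewrite !exprMn -mulrBr normrM (ger0_norm (sqr_ge0 s)).
  rewrite (_ : (4 + beta) * _ = s ^+ 2 * (2 * `|h| * (S * G h) + (2 + beta) * `|h| * (S * G h)));
    last by ring.
  rewrite -[leLHS]mulrA ler_wpM2l ?sqr_ge0// mulrDr mulr1 lerD//.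
    by rewrite distrC; exact: sqr_bound.
  apply: le_trans (pow_bound x h).
  apply: le_trans (sqr_diff_powR beta0 (p1 x) (p1 (x + h))).
  rewrite ler_wpM2l//; apply: ge0_ler_powR => //.
  - by rewrite nnegrE le_max normr_ge0.
  - by rewrite nnegrE le_max normr_ge0.
  - by rewrite !normrM (ger0_norm s0) -maxr_pMr// ler_piMl// le_max normr_ge0.
have SG0 : 0 <= S * G h by rewrite mulr_ge0.
have n3 : 0 <= `|h| ^+ 3 by rewrite exprn_ge0.
have sh0 : 0 <= s ^+ 2 * `|h| by rewrite mulr_ge0 ?sqr_ge0.
have tri : `|log_ratio s x h| <= `|trapezoid x h| + `|c (p1 (x + h) * h) - c (p1 x * h)|
    + `|Lam (s * p1 x) - Lam (s * p1 (x + h))|.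
  by rewrite /log_ratio (le_trans (ler_normD _ _))// lerD2r ler_normD.
split=> h1.
- have Gh2 : G h <= 2.
    rewrite /G -[2]/(1 + 1) lerD2l -holder1; apply: holder_mono.
    by rewrite normr1.
  have hold1 : holder h <= 1 by move: Gh2; rewrite /G; lra.
  have T1 : `|trapezoid x h| <= `|h| ^+ 3 * S.
    have [u uh] := trapezoid_error x h.
    move=> te; have k1 := g1 x u.
    have k2 : K1 x * holder u <= K1 x.
      by rewrite ler_piMr// (le_trans (holder_mono uh)).
    have := ler_normB (trapezoid x h + p3 x * h ^+ 3 / 12) (p3 x * h ^+ 3 / 12).
    rewrite addrK => /le_trans; apply.
    apply: (@le_trans _ _ (`|h| ^+ 3 / 2 * K1 x + `|p3 x| * `|h| ^+ 3 / 12)).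
      rewrite lerD//; last first.
        by rewrite normrM (ger0_norm (_ : 0 <= 12^-1)) ?invr_ge0// normrM normrX.
      apply: (le_trans te); rewrite ler_wpM2l ?divr_ge0//.
      exact: le_trans k2.
    have [h3 _ _ _] := envelope_terms x; rewrite -/S in h3.
    have := ler_wpM2l n3 h3; have := mulr_ge0 n3 (K10 x).
    have := mulr_ge0 n3 (normr_ge0 (p3 x)); lra.
  have T2 : `|c (p1 (x + h) * h) - c (p1 x * h)| <= 2 * M * `|h| ^+ 3 * (S * G h).
    have := @even_increment _ c c1 M (`|p1 x * h| + `|p1 (x + h) * h|) cN dc M0
      (fun t _ => c1M t) (p1 x * h) (p1 (x + h) * h).
    rewrite lerDl lerDr !normr_ge0 => /(_ isT isT) /le_trans; apply.
    rewrite !exprMn -mulrBl normrM normrX.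
    rewrite (_ : 2 * M * _ * _ = M * (2 * `|h| * (S * G h) * `|h| ^+ 2)); last by ring.
    by rewrite ler_wpM2l// ler_wpM2r ?sqr_ge0// sqr_bound.
  have SG2 : S * G h <= S * 2 by rewrite ler_wpM2l.
  apply: (le_trans tri).
  apply: (@le_trans _ _ (`|h| ^+ 3 * S + 2 * M * `|h| ^+ 3 * (S * 2)
      + M * (4 + beta) * (s ^+ 2 * `|h|) * (S * 2))).
    rewrite lerD ?lerD//.
      by rewrite (le_trans T2)// ler_wpM2l// ?mulr_ge0.
    by rewrite (le_trans T3)// ler_wpM2l// !mulr_ge0// addr_ge0.
  rewrite -subr_ge0 (_ : _ - _ = S * ((3 + 2 * M * (4 + beta)) * `|h| ^+ 3
     + (4 + 4 * M) * (s ^+ 2 * `|h|))); last by ring.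
  by rewrite mulr_ge0// addr_ge0// mulr_ge0// !addr_ge0// !mulr_ge0// addr_ge0.
- have hx1 : `|h| <= `|h| `^ (xi / 2).
    by apply: le1r_powR; rewrite ?(ltW h1)//; move: xi6; lra.
  have hG : `|h| * G h <= 2 * `|h| `^ (xi / 2).
    rewrite /G mulrDr mulr1 (_ : 2 * _ = `|h| `^ (xi / 2) + `|h| `^ (xi / 2)); last by ring.
    rewrite lerD// /holder maxr_pMr// ge_max; apply/andP; split.
      rewrite -{1}(powRr1 n0) -powRD; last by rewrite (gt_eqF (lt_trans ltr01 h1)) implybT.
      by apply: ler_powR; rewrite ?(ltW h1)//; move: xiH; lra.
    rewrite -{1}(powRr1 n0) -powRD; last by rewrite (gt_eqF (lt_trans ltr01 h1)) implybT.
    by apply: ler_powR; rewrite ?(ltW h1)//; move: xig; lra.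
  have p1x : `|p1 x| <= S * G h by have := p1_bound x z0; rewrite addr0.
  have p1h : `|p1 (x + h)| <= S * G h by exact: p1_bound.
  have T1 : `|trapezoid x h| <= 2 * `|h| * (S * G h).
    have [u uh] := mean_value x h dphi; rewrite /trapezoid => ->.
    rewrite (le_trans (ler_normB _ _))// !normrM (ger0_norm (_ : 0 <= 2^-1)) ?invr_ge0//.
    have q1 : `|h| * `|p1 (x + u)| <= `|h| * (S * G h) by rewrite ler_wpM2l// p1_bound.
    have q2 : `|h| / 2 * `|p1 x + p1 (x + h)| <= `|h| / 2 * (2 * (S * G h)).
      rewrite ler_wpM2l ?divr_ge0// (le_trans (ler_normD _ _))//.
      by move: p1x p1h; lra.
    by move: q1 q2; lra.
  have T2 : `|c (p1 (x + h) * h) - c (p1 x * h)| <= 2 * M * `|h| * (S * G h).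
    apply: (le_trans (cM _ _)); rewrite -mulrBl normrM.
    rewrite (_ : 2 * M * _ * _ = M * ((2 * (S * G h)) * `|h|)); last by ring.
    rewrite ler_wpM2l// ler_wpM2r// (le_trans (ler_normB _ _))//.
    by move: p1x p1h; lra.
  have s2 : s ^+ 2 * `|h| <= `|h| by rewrite ler_piMl// exprn_ile1.
  have T3' : `|Lam (s * p1 x) - Lam (s * p1 (x + h))| <= M * (4 + beta) * `|h| * (S * G h).
    apply: (le_trans T3); rewrite ler_wpM2r// ler_wpM2l// mulr_ge0// addr_ge0//.
  apply: (le_trans tri).
  apply: (@le_trans _ _ ((2 + 2 * M + M * (4 + beta)) * S * (`|h| * G h))).
    rewrite (_ : _ * S * _ = 2 * `|h| * (S * G h) + 2 * M * `|h| * (S * G h)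
      + M * (4 + beta) * `|h| * (S * G h)); last by ring.
    by rewrite lerD ?lerD.
  rewrite (_ : (4 + _ + _) * S * _ = (2 + 2 * M + M * (4 + beta)) * S * (2 * `|h| `^ (xi / 2)));
    last by ring.
  by rewrite ler_wpM2l// mulr_ge0// !addr_ge0// !mulr_ge0// addr_ge0.
Qed.

(** With h = s w the far regime contributes |s w|^xi = s^6 s^(xi - 6) |w|^xi: after division by s^6
    a vanishing coefficient remains, which is the [eta] of [tilt_cvg]. The near regime uses (|w|^3 +
    |w|)^2 <= 4 (1 + w^6). *)
Lemma log_ratio_sqr_bound : exists2 A, 0 <= A & forall s x w, 0 < s <= 1 ->
  log_ratio s x (s * w) ^+ 2 <=
  s ^+ 6 * (A * envelope x ^+ 2 * (1 + w ^+ 6 + s `^ (xi - 6) * `|w| `^ xi)).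
Proof.
have [A A0 LA] := log_ratio_bound; exists (4 * A ^+ 2).
  by rewrite mulr_ge0 ?sqr_ge0.
move=> s x w /andP[s0 s1].
have [|h1 h2] := LA s x (s * w); first by rewrite ltW.
have e0 := envelope_ge0 x; have c0 : 0 <= A * envelope x by rewrite mulr_ge0.
have p0 : 0 <= s `^ (xi - 6) * `|w| `^ xi by rewrite mulr_ge0 ?powR_ge0.
have s60 : 0 <= s ^+ 6 by rewrite exprn_ge0 ?ltW.
have w60 : 0 <= w ^+ 6 by rewrite (exprM w 2 3) exprn_ge0// sqr_ge0.
have cc0 : 0 <= 4 * A ^+ 2 * envelope x ^+ 2 by rewrite !mulr_ge0 ?sqr_ge0.
rewrite -(real_normK (num_real (log_ratio _ _ _))).
have [h|h] := leP `|s * w| 1.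
  have := h1 h; rewrite normrM (gtr0_norm s0) => hb.
  apply: (@le_trans _ _ ((A * envelope x * ((s * `|w|) ^+ 3 + s ^+ 2 * (s * `|w|))) ^+ 2)).
    by rewrite lerXn2r ?nnegrE// mulr_ge0// addr_ge0 ?exprn_ge0 ?mulr_ge0 ?sqr_ge0 ?(ltW s0)//.
  apply: (@le_trans _ _ (s ^+ 6 * (4 * A ^+ 2 * envelope x ^+ 2 * (1 + w ^+ 6)))); last first.
    by rewrite ler_wpM2l// ler_wpM2l// lerDl.
  have -> : w ^+ 6 = `|w| ^+ 6 by rewrite -normrX ger0_norm.
  have := normr_ge0 w; set y := `|w| => y0.
  rewrite (_ : (A * envelope x * _) ^+ 2 = s ^+ 6 * (A ^+ 2 * envelope x ^+ 2 * (y ^+ 3 + y) ^+ 2));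
    last by ring.
  rewrite ler_wpM2l// (_ : 4 * A ^+ 2 * envelope x ^+ 2 * (1 + y ^+ 6) =
    A ^+ 2 * envelope x ^+ 2 * (4 * (1 + y ^+ 6))); last by ring.
  rewrite ler_wpM2l ?mulr_ge0 ?sqr_ge0//.
  have [y1|y1] := leP y 1.
    have y31 : y ^+ 3 <= 1 by rewrite exprn_ile1.
    have y30 : 0 <= y ^+ 3 by rewrite exprn_ge0.
    have : 0 <= y ^+ 6 by rewrite exprn_ge0.
    by rewrite [y ^+ 6](exprM y 3 2); nra.
  have y31 : y <= y ^+ 3 by rewrite ler_eXnr// ltW.
  by rewrite [y ^+ 6](exprM y 3 2); nra.
have := h2 h; rewrite normrM (gtr0_norm s0) => hb.
apply: (@le_trans _ _ ((A * envelope x * (s * `|w|) `^ (xi / 2)) ^+ 2)).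
  by rewrite lerXn2r ?nnegrE// mulr_ge0// powR_ge0.
apply: (@le_trans _ _ (s ^+ 6 * (4 * A ^+ 2 * envelope x ^+ 2 * (s `^ (xi - 6) * `|w| `^ xi))));
  last by rewrite ler_wpM2l// ler_wpM2l// lerDr addr_ge0.
have -> : (A * envelope x * (s * `|w|) `^ (xi / 2)) ^+ 2 =
    (A * envelope x) ^+ 2 * (s `^ xi * `|w| `^ xi).
  rewrite -powRM ?(ltW s0)// exprMn; congr (_ * _).
  by rewrite -(powR_mulrn 2) ?powR_ge0// -powRrM divfK.
have -> : s `^ xi = s ^+ 6 * s `^ (xi - 6).
  rewrite -(powR_mulrn 6) ?(ltW s0)// -powRD; last by rewrite (gt_eqF s0) implybT.
  by congr (_ `^ _); ring.
rewrite [leRHS](_ : _ = 4 * ((A * envelope x) ^+ 2 *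
  (s ^+ 6 * s `^ (xi - 6) * `|w| `^ xi))); last by ring.
rewrite ler_peMl ?ler1n//; apply: mulr_ge0; first exact: sqr_ge0.
by apply: mulr_ge0; [apply: mulr_ge0; rewrite ?powR_ge0|exact: powR_ge0].
Qed.

Let trapezoid_cvg (s : R^nat) x w : (forall n, 0 < s n) -> s n @[n --> \oo] --> (0 : R) ->
  trapezoid x (s n * w) / s n ^+ 3 @[n --> \oo] --> - (p3 x * w ^+ 3 / 12).
Proof.
move=> s0 sc; have hc : s n * w @[n --> \oo] --> (0 : R).
  by rewrite -(mul0r w); apply: cvgM => //; exact: cvg_cst.
apply/cvgrPdist_le => e e0.
pose k : R := `|w| ^+ 3 / 2 + 1.
have k0 : 0 < k by rewrite ltr_wpDl// divr_ge0// exprn_ge0.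
have /cvgrPdist_le/(_ (e / k)) := @cp3 x.
have ek0 : 0 < e / k by rewrite divr_gt0.
move=> /(_ ek0)/nbhs_ballP[d /= d0 pd].
near=> n.
have hd : `|s n * w| < d by near: n; move/cvgr0Pnorm_lt : hc; exact.
have [u uh tu] := trapezoid_error x (s n * w).
have pu : `|p3 (x + u) - p3 x| <= e / k.
  rewrite distrC; apply: pd; rewrite /ball/= opprD addNKr normrN.
  exact: le_lt_trans hd.
have s3 : 0 < s n ^+ 3 by rewrite exprn_gt0.
have sn : s n != 0 by rewrite gt_eqF.
rewrite -normrN opprB (_ : _ - _ = (trapezoid x (s n * w) + p3 x * (s n * w) ^+ 3 / 12) / s n ^+ 3);
  last by field.
rewrite normrM (gtr0_norm (_ : 0 < (s n ^+ 3)^-1)) ?invr_gt0// ler_pdivrMr//.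
apply: (le_trans tu); rewrite normrM (gtr0_norm (s0 n)) exprMn.
apply: (@le_trans _ _ (s n ^+ 3 * `|w| ^+ 3 / 2 * (e / k))).
  by rewrite ler_wpM2l// divr_ge0// mulr_ge0 ?exprn_ge0 ?(ltW (s0 n)).
rewrite (_ : s n ^+ 3 * `|w| ^+ 3 / 2 * (e / k) = e * s n ^+ 3 * (`|w| ^+ 3 / 2 / k)); last by ring.
have wk : `|w| ^+ 3 / 2 / k <= 1 by rewrite ler_pdivrMr// mul1r /k lerDl ler01.
by apply: ler_piMr => //; apply: mulr_ge0; exact: ltW.
Unshelve. all: by end_near. Qed.

Let sqr_increment_cvg (s : R^nat) x w : (forall n, 0 < s n) -> s n @[n --> \oo] --> (0 : R) ->
  (p1 (x + s n * w) ^+ 2 - p1 x ^+ 2) / s n @[n --> \oo] --> 2 * (p1 x * p2 x) * w.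
Proof.
move=> s0 sc; have D := is_deriveMf (dp1 x) (dp1 x).
have [F [FE cF Fx]] := (is_derive1_caratheodory _ _ _).1 D.
have hc : x + s n * w @[n --> \oo] --> x.
  rewrite -[X in _ --> X]addr0 -(mul0r w).
  by apply: cvgD; [exact: cvg_cst|apply: cvgM => //; exact: cvg_cst].
rewrite (_ : (fun n => _) = fun n => F (x + s n * w) * w); last first.
  apply/funext => n; rewrite expr2 expr2 FE (_ : x + s n * w - x = s n * w); last by ring.
  by field; rewrite gt_eqF.
rewrite (_ : 2 * (p1 x * p2 x) = F x); last by rewrite Fx; ring.
by apply: cvgM; [apply: continuous_cvg; [exact: cF|exact: hc]|exact: cvg_cst].
Qed.

(** The arguments of [c] are p1 times h, so their squares differ by h^2 times the increment of p1^2,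
    whence a term in w^3 with coefficient [kc]; the arguments of [Lam] are s p1, whence a term
    linear in [w] with coefficient [kl]. *)
Lemma log_ratio_cvg (s : R^nat) x w : (forall n, 0 < s n) -> s n @[n --> \oo] --> (0 : R) ->
  log_ratio (s n) x (s n * w) / s n ^+ 3 @[n --> \oo] -->
  w ^+ 3 * (kc * (p1 x * p2 x) - p3 x / 12) - kl * (p1 x * p2 x) * w.
Proof.
move=> s0 sc.
have cvg_tail (u : R^nat) : u n @[n --> \oo] --> (0 : R) ->
    exists N, forall n, (N <= n)%N -> `|u n| <= 1.
  by move/cvgr0Pnorm_le => /(_ 1 ltr01)[N _ HN]; exists N => n Nn; exact: HN.
have hc : s n * w @[n --> \oo] --> (0 : R).
  by rewrite -(mul0r w); apply: cvgM => //; exact: cvg_cst.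
have xc : x + s n * w @[n --> \oo] --> x.
  by rewrite -[X in _ --> X]addr0; apply: cvgD => //; exact: cvg_cst.
have cp1 : {for x, continuous p1} := is_derive_continuous (dp1 x).
have pc : p1 (x + s n * w) @[n --> \oo] --> p1 x by apply: continuous_cvg; [exact: cp1|exact: xc].
have q := @sqr_increment_cvg s x w s0 sc.
have s3 n : 0 < s n ^+ 3 by rewrite exprn_gt0.
have T2 : (c (p1 (x + s n * w) * (s n * w)) - c (p1 x * (s n * w))) / s n ^+ 3 @[n --> \oo]
    --> kc / 2 * (2 * (p1 x * p2 x) * w * w ^+ 2).
  apply: (even_increment_cvg cN dc dc0 c10) => //.
  - by rewrite -(mulr0 (p1 x)); apply: cvgM => //; exact: cvg_cst.
  - by rewrite -(mulr0 (p1 x)); apply: cvgM.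
  - rewrite (_ : (fun n => _) = fun n => (p1 (x + s n * w) ^+ 2 - p1 x ^+ 2) / s n * w ^+ 2).
      by apply: cvgM => //; exact: cvg_cst.
    by apply/funext => n; field; rewrite gt_eqF.
have a0 : s n * p1 x @[n --> \oo] --> (0 : R).
  by rewrite -(mul0r (p1 x)); apply: cvgM => //; exact: cvg_cst.
have a'0 : s n * p1 (x + s n * w) @[n --> \oo] --> (0 : R).
  by rewrite -(mul0r (p1 x)); apply: cvgM.
have T3 : (Lam (s n * p1 x) - Lam (s n * p1 (x + s n * w))) / s n ^+ 3 @[n --> \oo]
    --> kl / 2 * - (2 * (p1 x * p2 x) * w).
  have [N1 h1] := cvg_tail _ a0; have [N2 h2] := cvg_tail _ a'0.
  (* [Lam_cvg] asks for arguments bounded by 1 at every index; shifting the sequence arranges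
     this. *)
  pose N := (N1 + N2)%N.
  rewrite -(cvg_shiftn N).
  apply: (@Lam_cvg (fun n => s (n + N)%N * p1 x) (fun n => s (n + N)%N * p1 (x + s (n + N)%N * w))
    (fun n => s (n + N)%N ^+ 3)).
  - by move=> n; apply: h1; rewrite /N addnCA leq_addr.
  - by move=> n; apply: h2; rewrite /N addnA leq_addl.
  - by move: a0; rewrite -(cvg_shiftn N).
  - by move: a'0; rewrite -(cvg_shiftn N).
  - by [].
  - rewrite (cvg_shiftn N (fun n => ((s n * p1 x) ^+ 2 - (s n * p1 (x + s n * w)) ^+ 2) / s n ^+ 3)).
    rewrite (_ : (fun n => _) = fun n => - ((p1 (x + s n * w) ^+ 2 - p1 x ^+ 2) / s n)).
      exact: cvgN.
    by apply/funext => n; field; rewrite gt_eqF.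
rewrite (_ : (fun n => _) = fun n => trapezoid x (s n * w) / s n ^+ 3
  + (c (p1 (x + s n * w) * (s n * w)) - c (p1 x * (s n * w))) / s n ^+ 3
  + (Lam (s n * p1 x) - Lam (s n * p1 (x + s n * w))) / s n ^+ 3); last first.
  by apply/funext => n; rewrite /log_ratio !mulrDl.
rewrite (_ : w ^+ 3 * _ - _ = - (p3 x * w ^+ 3 / 12)
  + kc / 2 * (2 * (p1 x * p2 x) * w * w ^+ 2) + kl / 2 * - (2 * (p1 x * p2 x) * w)); last by field.
by apply: cvgD => //; apply: cvgD => //; exact: trapezoid_cvg.
Qed.

End log_ratio.

(** * The joint law of the chain and its proposal *)

Lemma cvg_exprn (R : realType) (k : nat) (u : R^nat) (a : R) :
  u n @[n --> \oo] --> a -> u n ^+ k @[n --> \oo] --> a ^+ k.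
Proof.
move=> ua; elim: k => [|k IH]; first exact: cvg_cst.
rewrite (_ : (fun n => _) = fun n => u n * u n ^+ k); last by apply/funext => n; rewrite exprS.
by rewrite exprS; apply: cvgM. Qed.

Lemma ge0_integral_translate (R : realType) (c : R) (f : R -> \bar R) :
  measurable_fun [set: measurableTypeR R] f -> (forall x, 0 <= f x)%E ->
  (\int[@lebesgue_measure R]_x f ((x : R) + c)%R = \int[@lebesgue_measure R]_x f x)%E.
Proof.
move=> mf f0.
have mt : measurable_fun [set: measurableTypeR R]
   ((fun x => x + c) : measurableTypeR R -> measurableTypeR R).
  exact: measurable_funD.
exact: (@ge0_integral_invariant _ (measurableTypeR R) _ lebesgue_measure (fun x => x + c) mt
  (lebesgue_measure_translate c) f mf f0).
Qed.

Section joint_law.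
Context {R : realType}.
Local Notation lebesgue := (@lebesgue_measure R).
Variables (mu : probability R R) (b phi p1 : R -> R) (M xi beta C : R).
Hypotheses (mb : measurable_fun setT b) (bM : forall u, `|b u| <= M * `|u|).
Hypotheses (xi6 : 6 < xi) (beta0 : 0 <= beta) (C0 : 0 <= C).
Hypothesis ixi : mu.-integrable setT (EFin \o (fun z => `|z| `^ xi)).
Hypothesis iB : forall a, mu.-integrable setT (EFin \o (fun z => expR (b (a * z)))).
Hypothesis iBxi : forall a, mu.-integrable setT
  (EFin \o (fun z => `|z| `^ xi * expR (b (a * z)))).
Local Notation Z := (tilt_mass mu b).
Hypothesis Bxi : forall a, \int[mu]_z (`|z| `^ xi * expR (b (a * z))) <=
  C * (1 + `|a| `^ beta) * Z a.
Hypotheses (mphi : measurable_fun setT phi) (mp1 : measurable_fun setT p1).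
Hypothesis dens1 : (\int[lebesgue]_x (expR (phi x))%:E = 1)%E.
Hypothesis muN : forall A : set R, measurable A -> mu ((fun z => - z) @^-1` A) = mu A.

Let Z0 (a : R) : 0 < Z a. Proof. exact: (tilt_mass_gt0 mb bM xi6 ixi iB). Qed.

Definition prop_density (s x w : R) := expR (b (s * p1 x * w)) / Z (s * p1 x).

(* Density of [(X, W)] with respect to [lebesgue \x mu]; the proposal is [Y = X + s W]. *)
Definition joint_density (s : R) (p : R * R) := expR (phi p.1) * prop_density s p.1 p.2.

Definition weight (x : R) := 1 + `|p1 x| `^ beta.

Lemma prop_density_ge0 s x w : 0 <= prop_density s x w.
Proof. by rewrite divr_ge0 ?expR_ge0// ltW. Qed.

Lemma joint_density_ge0 s p : 0 <= joint_density s p.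
Proof. by rewrite mulr_ge0 ?expR_ge0 ?prop_density_ge0. Qed.

Lemma measurable_tilt_mass : measurable_fun setT Z.
Proof.
pose F (p : R * R) : \bar R := (expR (b (p.1 * p.2)))%:E.
have mF : measurable_fun setT F.
  apply/measurable_EFinP; apply: measurableT_comp => //; apply: measurableT_comp => //.
  exact: measurable_funM.
have F0 p : (0 <= F p)%E by rewrite lee_fin expR_ge0.
have := measurable_fun_fubini_tonelli_F (m2 := mu) F mF F0 => h.
by apply: measurableT_comp h.
Qed.

Lemma measurable_joint_density s : measurable_fun setT (joint_density s).
Proof.
apply: measurable_funM.
  by apply: measurableT_comp => //; exact: measurableT_comp.
apply: measurable_funM.
  apply: measurableT_comp => //; apply: measurableT_comp => //.
  apply: measurable_funM => //; apply: measurable_funM => //.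
  exact: measurableT_comp.
have mZ1 : measurable_fun setT (fun p : R * R => Z (s * p1 p.1)).
  apply: (measurableT_comp measurable_tilt_mass); apply: measurable_funM => //.
  exact: measurableT_comp.
(* The inverse is written as a power of exponent -1, which agrees with it because the mass is
   positive. *)
rewrite (_ : (fun p : R * R => _) = (fun p => (Z (s * p1 p.1)) `^ (-1))).
  exact: (measurableT_comp (measurable_powR _)).
by apply/funext => p; rewrite powR_inv1// ltW.
Qed.

Lemma measurable_prop_density s x : measurable_fun setT (prop_density s x).
Proof.
apply: measurable_funM => //.
by apply: measurableT_comp => //; apply: measurableT_comp.
Qed.

Lemma ge0_joint_integral s (G : R * R -> R) : measurable_fun setT G ->
  (forall p, 0 <= G p) ->
  (\int[lebesgue \x mu]_p (G p * joint_density s p)%:E =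
   \int[lebesgue]_x ((expR (phi x))%:E * \int[mu]_w (G (x, w) * prop_density s x w)%:E))%E.
Proof.
move=> mG G0.
have mF : measurable_fun setT (fun p => (G p * joint_density s p)%:E).
  by apply/measurable_EFinP; apply: measurable_funM => //; exact: measurable_joint_density.
have F0 p : (0 <= (G p * joint_density s p)%:E)%E.
  by rewrite lee_fin mulr_ge0 ?joint_density_ge0.
rewrite (fubini_tonelli1 (m1 := lebesgue) (m2 := mu) _ mF F0); apply: eq_integral => x _; rewrite /fubini_F.
rewrite -ge0_integralZl//.
- by apply: eq_integral => w _; rewrite -EFinM /joint_density/= mulrCA.
- apply/measurable_EFinP; apply: measurable_funM; last exact: measurable_prop_density.
  exact: (measurableT_comp mG (measurable_pair1 x)).
- by move=> w _; rewrite lee_fin mulr_ge0 ?prop_density_ge0.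
Qed.

Lemma prop_density_mass s x : (\int[mu]_w (prop_density s x w)%:E = 1)%E.
Proof.
have h := integrable_scale (Z (s * p1 x))^-1 (iB (s * p1 x)).
have : \int[mu]_w ((Z (s * p1 x))^-1 * expR (b (s * p1 x * w))) = 1.
  by rewrite RintegralZl// -/(Z _) mulVf// gt_eqF.
move=> h1; rewrite -(congr1 EFin h1) /Rintegral fineK; last exact: integrable_fin_num h.
by apply: eq_integral => w _; rewrite /prop_density mulrC.
Qed.

Lemma joint_mass s : (\int[lebesgue \x mu]_p (joint_density s p)%:E = 1)%E.
Proof.
transitivity (\int[lebesgue \x mu]_p (1 * joint_density s p)%:E)%E.
  by apply: eq_integral => p _; rewrite mul1r.
rewrite (ge0_joint_integral s (G := fun=> 1))//.
rewrite -dens1; apply: eq_integral => x _.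
under eq_integral do rewrite mul1r.
by rewrite prop_density_mass mule1.
Qed.

Lemma integrable_joint_density s :
  (lebesgue \x mu)%E.-integrable setT (EFin \o joint_density s).
Proof.
apply/integrableP; split; first by apply/measurable_EFinP; exact: measurable_joint_density.
under eq_integral do rewrite /= ger0_norm ?joint_density_ge0//.
by rewrite joint_mass ltry.
Qed.

Lemma Rintegral_joint_density s : \int[(lebesgue \x mu)%E]_p joint_density s p = 1.
Proof. by rewrite /Rintegral joint_mass. Qed.

Definition inner (s : R) (G : R * R -> R) (x : R) := \int[mu]_w (G (x, w) * prop_density s x w).

Section dominated.
Variables (s : R) (D : R -> R).
Hypotheses (s01 : 0 < s <= 1) (D0 : forall x, 0 <= D x).
Hypothesis iD : lebesgue.-integrable setT (EFin \o (fun x => D x * weight x * expR (phi x))).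

Section sections.
Variable G : R * R -> R.
Hypotheses (mG : measurable_fun setT G).
Hypothesis GD : forall x w, `|G (x, w)| <= D x * (2 + 2 * `|w| `^ xi).

Let mGx x : measurable_fun setT (fun w => G (x, w)).
Proof. exact: (measurableT_comp mG (measurable_pair1 x)). Qed.

Let GD' x w : `|G (x, w)| <= D x * 2 + D x * 2 * `|w| `^ xi.
Proof. by apply: (le_trans (GD x w)); rewrite le_eqVlt; apply/orP; left; apply/eqP; ring. Qed.

Lemma integrable_section x :
  mu.-integrable setT (EFin \o (fun w => G (x, w) * prop_density s x w)).
Proof.
have h := tilt_integrable mb iB iBxi (s * p1 x) (mGx x) (GD' x).
have := integrable_scale (Z (s * p1 x))^-1 h.
apply: eq_integrable => // w _ /=; rewrite /prop_density; congr (_%:E); ring.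
Qed.

Lemma inner_tilt x : inner s G x =
  (\int[mu]_w (G (x, w) * expR (b (s * p1 x * w)))) / Z (s * p1 x).
Proof.
have h := tilt_integrable mb iB iBxi (s * p1 x) (mGx x) (GD' x).
rewrite mulrC -RintegralZl//; apply: eq_Rintegral => w _.
by rewrite /prop_density; ring.
Qed.

(** The tail hypothesis costs a factor 1 + |s p1|^beta, at most the weight since s <= 1; this is the
    reason for weighting the majorant [D]. *)
Lemma inner_bound x : `|inner s G x| <= 2 * (1 + C) * (D x * weight x).
Proof.
have d0 : 0 <= D x * 2 by rewrite mulr_ge0.
rewrite inner_tilt normrM (gtr0_norm (_ : 0 < (Z _)^-1)) ?invr_gt0//.
apply: (le_trans (tilt_bound mb bM xi6 ixi iB iBxi Bxi (s * p1 x) (mGx x) (GD' x) d0)).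
have sp : `|s * p1 x| `^ beta <= `|p1 x| `^ beta.
  case/andP: s01 => s0 s1; apply: ge0_ler_powR; rewrite ?nnegrE//.
  by rewrite normrM (gtr0_norm s0) ler_piMl.
rewrite (_ : D x * 2 + _ = D x * 2 * (1 + C * (1 + `|s * p1 x| `^ beta))); last by ring.
rewrite (_ : 2 * (1 + C) * _ = D x * 2 * ((1 + C) * weight x)); last by ring.
rewrite ler_wpM2l// /weight; have := ler_wpM2l C0 sp; have := powR_ge0 `|p1 x| beta.
by move: C0; nra.
Qed.

End sections.

Variable G : R * R -> R.
Hypotheses (mG : measurable_fun setT G).
Hypothesis GD : forall x w, `|G (x, w)| <= D x * (2 + 2 * `|w| `^ xi).

Lemma joint_integrable : (lebesgue \x mu)%E.-integrable setT
  (EFin \o (fun p => G p * joint_density s p)).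
Proof.
apply/integrable12ltyP.
  by apply/measurable_EFinP; apply: measurable_funM => //; exact: measurable_joint_density.
apply: (@le_lt_trans _ _
   (\int[lebesgue]_x (2 * (1 + C) * (D x * weight x * expR (phi x)))%:E)%E); last first.
  by have /integrable_lty := integrable_scale (2 * (1 + C)) iD; exact.
apply: ge0_le_integral => //.
- by move=> x _; apply: integral_ge0.
- have mF' : measurable_fun setT (fun p => `|(G p * joint_density s p)%:E|)%E.
    apply: measurableT_comp => //; apply/measurable_EFinP.
    by apply: measurable_funM => //; exact: measurable_joint_density.
  exact: (measurable_fun_fubini_tonelli_F (m2 := mu) _ mF' (fun=> abse_ge0 _)).
- apply/measurable_EFinP; apply: measurable_funM => //.
  exact: (integrable_meas iD).
move=> x _.
have h : (\int[mu]_w `|(G (x, w) * joint_density s (x, w))%:E| =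
    (expR (phi x))%:E * \int[mu]_w (`|G (x, w)| * prop_density s x w)%:E)%E.
  rewrite -ge0_integralZl//.
  - apply: eq_integral => w _; rewrite abse_EFin normrM (ger0_norm (joint_density_ge0 _ _)).
    by rewrite -EFinM /joint_density/= mulrCA.
  - apply/measurable_EFinP; apply: measurable_funM; last exact: measurable_prop_density.
    by apply: measurableT_comp => //; exact: (measurableT_comp mG (measurable_pair1 x)).
  - by move=> w _; rewrite lee_fin mulr_ge0 ?prop_density_ge0.
have h2 : (\int[mu]_w (`|G (x, w)| * prop_density s x w)%:E <=
    (2 * (1 + C) * (D x * weight x))%:E)%E.
  have mG' : measurable_fun setT (fun p => `|G p|) by exact: measurableT_comp.
  have GD' x' w : `| `|G (x', w)| | <= D x' * (2 + 2 * `|w| `^ xi) by rewrite normr_id.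
  rewrite -(fineK (integrable_fin_num measurableT (integrable_section mG' GD' x))).
  by rewrite lee_fin (le_trans (ler_norm _))// (inner_bound mG' GD').
apply: (@le_trans _ _ ((expR (phi x))%:E *
    \int[mu]_w (`|G (x, w)| * prop_density s x w)%:E)%E); first by rewrite -h.
rewrite (_ : 2 * (1 + C) * _ = expR (phi x) * (2 * (1 + C) * (D x * weight x))); last by ring.
by rewrite EFinM lee_pmul ?lee_fin ?expR_ge0//; apply: integral_ge0 => w _;
   rewrite lee_fin mulr_ge0 ?prop_density_ge0.
Qed.

Lemma joint_Rintegral : (forall p, 0 <= G p) ->
  \int[(lebesgue \x mu)%E]_p (G p * joint_density s p) =
  \int[lebesgue]_x (inner s G x * expR (phi x)).
Proof.
move=> G0; rewrite /Rintegral ge0_joint_integral//; congr fine.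
apply: eq_integral => x _; rewrite /inner /Rintegral EFinM muleC; congr (_ * _)%E.
by rewrite fineK//; exact: integrable_fin_num (integrable_section mG GD x).
Qed.

End dominated.

(** No majorant of the joint integrand uniform in [n] is at hand, so convergence is obtained in two
    stages: for fixed [x] by [tilt_cvg], then over [x] by domination of the inner integrals. *)
Lemma joint_limit (s : R^nat) (G : nat -> R * R -> R) (G_ : R -> R -> R) (D : R -> R) :
  (forall n, 0 < s n <= 1) -> s n @[n --> \oo] --> (0 : R) ->
  (forall n, measurable_fun setT (G n)) -> (forall n p, 0 <= G n p) ->
  (forall x, 0 <= D x) ->
  lebesgue.-integrable setT (EFin \o (fun x => D x * weight x * expR (phi x))) ->
  (forall n x w, G n (x, w) <= D x * (1 + w ^+ 6 + s n `^ (xi - 6) * `|w| `^ xi)) ->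
  (forall x w, G n (x, w) @[n --> \oo] --> G_ x w) ->
  (forall n, (lebesgue \x mu)%E.-integrable setT
    (EFin \o (fun p => G n p * joint_density (s n) p))) /\
  \int[(lebesgue \x mu)%E]_p (G n p * joint_density (s n) p) @[n --> \oo] -->
    \int[lebesgue]_x ((\int[mu]_w G_ x w) * expR (phi x)).
Proof.
move=> s01 sc mG G0 D0 iD GD GG.
have s0 n : 0 < s n by case/andP : (s01 n).
have s1 n : s n <= 1 by case/andP : (s01 n).
have eta1 n : s n `^ (xi - 6) <= 1.
  have x6 : 0 <= xi - 6 by rewrite subr_ge0 ltW.
  apply: (@le_trans _ _ (1 `^ (xi - 6))); last by rewrite powR1.
  by apply: ge0_ler_powR; rewrite ?nnegrE ?(ltW (s0 n)).
have GD' n x w : `|G n (x, w)| <= D x * (2 + 2 * `|w| `^ xi).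
  rewrite ger0_norm//; apply: (le_trans (GD n x w)); rewrite ler_wpM2l//.
  have -> : w ^+ 6 = `|w| ^+ 6 by rewrite -normrX ger0_norm// (exprM w 2 3) exprn_ge0// sqr_ge0.
  have w6 : `|w| ^+ 6 <= 1 + `|w| `^ xi by apply: ler_exp_powR => //; exact: ltW.
  have := ler_wpM2r (powR_ge0 `|w| xi) (eta1 n); rewrite mul1r.
  by move: w6; lra.
split=> [n|]; first exact: (joint_integrable (s01 n) D0 iD (mG n) (GD' n)).
have ic n : \int[(lebesgue \x mu)%E]_p (G n p * joint_density (s n) p) =
    \int[lebesgue]_x (inner (s n) (G n) x * expR (phi x)).
  exact: (@joint_Rintegral (s n) D (G n) (mG n) (GD' n) (G0 n)).
rewrite (funext ic).
have ac x : s n * p1 x @[n --> \oo] --> (0 : R).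
  by rewrite -(mul0r (p1 x)); apply: cvgM => //; exact: cvg_cst.
have eta0 : s n `^ (xi - 6) @[n --> \oo] --> (0 : R).
  by apply: cvg_powR0 => //; [rewrite subr_gt0|move=> n; exact: ltW].
have inner_cvg x : inner (s n) (G n) x @[n --> \oo] --> \int[mu]_w G_ x w.
  (* The index from which |s n p1(x)| <= 1 depends on [x], hence the shift inside the pointwise
     statement. *)
  have [N HN] : exists N, forall n, (N <= n)%N -> `|s n * p1 x| <= 1.
    by have /cvgr0Pnorm_le/(_ 1 ltr01)[N _ HN] := ac x; exists N => n Nn; exact: HN.
  rewrite -(cvg_shiftn N).
  rewrite (_ : (fun n => _) = fun n => (\int[mu]_w (G (n + N)%N (x, w) *
    expR (b (s (n + N)%N * p1 x * w)))) / Z (s (n + N)%N * p1 x)); last first.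
    by apply/funext => n; rewrite (inner_tilt _ (mG _) (GD' _)).
  apply: (@tilt_cvg _ mu b M xi beta C mb bM xi6 beta0 C0 ixi iB iBxi Bxi
    (fun n => s (n + N)%N * p1 x) _ _ (fun n w => G (n + N)%N (x, w)) (G_ x) (D x)
    (fun n => s (n + N)%N `^ (xi - 6))).
  - by move=> n; apply: HN; exact: leq_addl.
  - by have := ac x; rewrite -(cvg_shiftn N).
  - by move=> n; exact: (measurableT_comp (mG _) (measurable_pair1 x)).
  - by move=> w; have := GG x w; rewrite -(cvg_shiftn N).
  - exact: D0.
  - by move=> n; rewrite powR_ge0 eta1.
  - by have := eta0; rewrite -(cvg_shiftn N).
  - by move=> n w; rewrite ger0_norm.
have K := integrable_scale (2 * (1 + C)) iD.
have minner n : measurable_fun setT (inner (s n) (G n)).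
  have mF : measurable_fun setT (fun p => (G n p * prop_density (s n) p.1 p.2)%:E).
    apply/measurable_EFinP.
    rewrite (_ : (fun p => _) = fun p => (G n p * joint_density (s n) p) * expR (- phi p.1)).
      apply: measurable_funM.
        by apply: measurable_funM => //; exact: measurable_joint_density.
      apply: measurableT_comp => //; apply: measurableT_comp; first exact: oppr_measurable.
      exact: measurableT_comp.
    apply/funext => p; rewrite /joint_density expRN; field.
    by rewrite gt_eqF// expR_gt0.
  have F0 p : (0 <= (G n p * prop_density (s n) p.1 p.2)%:E)%E.
    by rewrite lee_fin mulr_ge0 ?prop_density_ge0.
  have := measurable_fun_fubini_tonelli_F (m2 := mu) _ mF F0 => h.
  by apply: measurableT_comp h.
have [|x|n x|_ //] := @dominated_Rintegral _ _ _ lebesgue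
  (fun n x => inner (s n) (G n) x * expR (phi x))
  (fun x => (\int[mu]_w G_ x w) * expR (phi x)) _ _ K.
- by move=> n; apply: measurable_funM; [exact: minner|exact: measurableT_comp].
- by apply: cvgM; [exact: inner_cvg|exact: cvg_cst].
- rewrite normrM (ger0_norm (expR_ge0 _)) mulrA ler_wpM2r ?expR_ge0//.
  exact: (inner_bound (s01 n) D0 (mG n) (GD' n)).
Qed.

Definition log_mh (s x y : R) := phi y - phi x + b (p1 y * (x - y)) - b (p1 x * (y - x))
  + ln (Z (s * p1 x)) - ln (Z (s * p1 y)).

Definition joint_ratio (s : R) (p : R * R) := log_mh s p.1 (p.1 + s * p.2).

Lemma measurable_joint_ratio s : measurable_fun setT (joint_ratio s).
Proof.
have m1 : measurable_fun setT (fun p : R * R => p.1) by exact: measurable_fst.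
have m2 : measurable_fun setT (fun p : R * R => p.1 + s * p.2).
  by apply: measurable_funD => //; exact: measurable_funM.
have mZ : measurable_fun setT (fun a => ln (Z a)).
  by apply: (measurableT_comp (@measurable_ln R)); exact: measurable_tilt_mass.
have mphi1 : measurable_fun setT (fun p : R * R => phi p.1) by exact: measurableT_comp.
have mphi2 : measurable_fun setT (fun p : R * R => phi (p.1 + s * p.2)) by exact: measurableT_comp.
have mp11 : measurable_fun setT (fun p : R * R => p1 p.1) by exact: measurableT_comp.
have mp12 : measurable_fun setT (fun p : R * R => p1 (p.1 + s * p.2)) by exact: measurableT_comp.
apply: measurable_funB; last first.
  by apply: (measurableT_comp mZ); exact: measurable_funM.
apply: measurable_funD; last first.
  by apply: (measurableT_comp mZ); exact: measurable_funM.
apply: measurable_funB; last first.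
  apply: (measurableT_comp mb); apply: measurable_funM => //.
  exact: measurable_funB.
apply: measurable_funD; first exact: measurable_funB.
apply: (measurableT_comp mb); apply: measurable_funM => //.
exact: measurable_funB.
Qed.

(** The map (x, w) -> (x + s w, -w) is the involution that exchanges the state and the proposal. *)
Lemma joint_ratio_flip s x w : joint_ratio s (x + s * w, - w) = - joint_ratio s (x, w).
Proof.
have aux (a1 a2 a3 a4 a5 a6 : R) :
    a1 - a2 + a3 - a4 + a5 - a6 = - (a2 - a1 + a4 - a3 + a6 - a5) by ring.
have opp y z : log_mh s z y = - log_mh s y z by exact: aux.
have -> : joint_ratio s (x + s * w, - w) = log_mh s (x + s * w) (x + s * w + s * - w) by [].
have -> : x + s * w + s * - w = x by ring.
exact: opp.
Qed.

(* The density of (X, Y) times the Metropolis-Hastings ratio is the density of (Y, X). *)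
Lemma joint_density_flip s x w : joint_density s (x, w) * expR (joint_ratio s (x, w)) =
  joint_density s (x + s * w, - w).
Proof.
rewrite /joint_density /prop_density /joint_ratio /log_mh/=.
set y := x + s * w; have yx : y - x = s * w by rewrite /y; ring.
rewrite -(opprB y x) yx.
have -> : p1 x * (s * w) = s * p1 x * w by ring.
have -> : p1 y * - (s * w) = s * p1 y * - w by ring.
have := Z0 (s * p1 x); have := Z0 (s * p1 y).
move: (Z _) (Z _) (phi y) (phi x) (b _) (b _) => u v c1 c2 d1 d2 u0 v0.
rewrite !expRD !expRN !lnK ?posrE//.
by field; rewrite !gt_eqF// expR_gt0.
Qed.

(** The exchange of state and proposal preserves the product measure: it is a translation of
    Lebesgue measure for fixed [w], followed by the reflection of [mu]. Nonnegative [k] and Tonelli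
    spare any prior integrability of the exponential of the ratio. *)
Lemma reversibility s (k : R -> R) : measurable_fun setT k -> (forall r, 0 <= k r) ->
  (\int[lebesgue \x mu]_p (k (joint_ratio s p) * expR (joint_ratio s p) * joint_density s p)%:E
   = \int[lebesgue \x mu]_p (k (- joint_ratio s p) * joint_density s p)%:E)%E.
Proof.
move=> mk k0; pose F (p : R * R) := k (- joint_ratio s p) * joint_density s p.
have F0 p : 0 <= F p by rewrite mulr_ge0 ?joint_density_ge0.
have mF : measurable_fun setT F.
  apply: measurable_funM; last exact: measurable_joint_density.
  apply: measurableT_comp => //; apply: measurableT_comp; first exact: oppr_measurable.
  exact: measurable_joint_ratio.
have mfl : measurable_fun setT (fun p : R * R => (p.1 + s * p.2, - p.2)).
  apply/measurable_fun_pairP; split=> /=.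
    by apply: measurable_funD => //; exact: measurable_funM.
  exact: (measurableT_comp (@oppr_measurable R setT) measurable_snd).
have mFE : measurable_fun setT (fun p => (F p)%:E) by exact/measurable_EFinP.
have mFf : measurable_fun setT (fun p : R * R => (F (p.1 + s * p.2, - p.2))%:E).
  by apply/measurable_EFinP; exact: (measurableT_comp mF mfl).
transitivity (\int[lebesgue \x mu]_p (F (p.1 + s * p.2, - p.2))%:E)%E.
  apply: eq_integral => -[x w] _; rewrite /F/= joint_ratio_flip opprK -joint_density_flip.
  by rewrite mulrAC -!mulrA.
have F0E p : (0 <= (F p)%:E)%E by rewrite lee_fin.
rewrite (fubini_tonelli2 (m1 := lebesgue) (m2 := mu) _ mFf) /fubini_G/=; last first.
  by move=> p; rewrite lee_fin.
rewrite (fubini_tonelli2 (m1 := lebesgue) (m2 := mu) _ mFE F0E) /fubini_G/=.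
have mN : measurable_fun setT (fun z : R => - z) by exact: oppr_measurable.
have mG := measurable_fun_fubini_tonelli_G (m1 := lebesgue) _ mFE F0E.
have G0 w : (0 <= fubini_G lebesgue (fun p => (F p)%:E) w)%E.
  by apply: integral_ge0 => x _; exact: F0E.
transitivity (\int[mu]_w fubini_G lebesgue (fun p => (F p)%:E) (- (w : R))%R)%E; last first.
  exact: (ge0_integral_invariant mN muN mG G0).
apply: eq_integral => w _; rewrite /fubini_G.
apply: (ge0_integral_translate (s * w) (f := fun x => (F (x, - w))%:E)).
  exact: (measurableT_comp mFE (measurable_pair2 (- w))).
by move=> x; exact: F0E.
Qed.

Section third_order_ratio.
Variables (s : R^nat) (D : R -> R) (L : R -> R -> R).
Hypotheses (s01 : forall n, 0 < s n <= 1) (s_cvg0 : s n @[n --> \oo] --> (0 : R)).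
Hypothesis D0 : forall x, 0 <= D x.
Hypothesis iD : lebesgue.-integrable setT (EFin \o (fun x => D x * weight x * expR (phi x))).
Hypothesis ratioD : forall n x w, joint_ratio (s n) (x, w) ^+ 2 <=
  s n ^+ 6 * (D x * (1 + w ^+ 6 + s n `^ (xi - 6) * `|w| `^ xi)).
Hypothesis ratioL : forall x w, joint_ratio (s n) (x, w) / s n ^+ 3 @[n --> \oo] --> L x w.

Let s0 n : 0 < s n. Proof. by case/andP : (s01 n). Qed.
Let s60 n : 0 < s n ^+ 6. Proof. exact: exprn_gt0. Qed.

Lemma joint_sqr_limit :
  (forall n, (lebesgue \x mu)%E.-integrable setT
    (EFin \o (fun p => joint_ratio (s n) p ^+ 2 * joint_density (s n) p))) /\
  (\int[(lebesgue \x mu)%E]_p (joint_ratio (s n) p ^+ 2 * joint_density (s n) p)) / s n ^+ 6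
    @[n --> \oo] --> \int[lebesgue]_x ((\int[mu]_w (L x w ^+ 2)) * expR (phi x)).
Proof.
pose G n p := (s n ^+ 6)^-1 * joint_ratio (s n) p ^+ 2.
have GE n p : joint_ratio (s n) p ^+ 2 * joint_density (s n) p =
    s n ^+ 6 * (G n p * joint_density (s n) p).
  by rewrite /G; field; rewrite gt_eqF.
have [|n p|n x w|x w|iG cG] := @joint_limit s G (fun x w => L x w ^+ 2) D s01 s_cvg0 _ _ D0 iD.
- by move=> n; apply: measurable_funM => //; apply: measurable_funX; exact: measurable_joint_ratio.
- by rewrite mulr_ge0 ?sqr_ge0// invr_ge0 ltW.
- by rewrite /G mulrC ler_pdivrMr// [leRHS]mulrC; exact: ratioD.
- rewrite (_ : (fun n => _) = fun n =>
      (joint_ratio (s n) (x, w) / s n ^+ 3) * (joint_ratio (s n) (x, w) / s n ^+ 3)).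
    by rewrite expr2; apply: cvgM; exact: ratioL.
  apply/funext => n; rewrite /G.
  have aux (u v : R) : v != 0 -> (v ^+ 6)^-1 * u ^+ 2 = (u / v ^+ 3) * (u / v ^+ 3).
    by move=> v0; field.
  by apply: aux; rewrite gt_eqF.
split=> [n|]; first by rewrite (funext (GE n)); exact: integrable_scale.
rewrite (_ : (fun n => _) = fun n => \int[(lebesgue \x mu)%E]_p (G n p * joint_density (s n) p))//.
apply/funext => n; rewrite (funext (GE n)) RintegralZl// mulrC mulKf// gt_eqF//.
Qed.

(** The integrand has the same majorant as the squared ratio, and after division by s^6 it is at
    most |ratio / s^3|^3 s^3, which tends to 0 pointwise. *)
Lemma joint_tcut_limit :
  (\int[(lebesgue \x mu)%E]_p (tcut (joint_ratio (s n) p) * joint_density (s n) p)) / s n ^+ 6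
    @[n --> \oo] --> (0 : R).
Proof.
pose G n p := (s n ^+ 6)^-1 * tcut (joint_ratio (s n) p).
have [|n p|n x w|x w|iG cG] := @joint_limit s G (fun=> fun=> 0) D s01 s_cvg0 _ _ D0 iD.
- move=> n; apply: measurable_funM => //; apply: (measurableT_comp (@measurable_tcut R)).
  exact: measurable_joint_ratio.
- by rewrite mulr_ge0 ?tcut_ge0// invr_ge0 ltW.
- rewrite /G mulrC ler_pdivrMr// [leRHS]mulrC.
  by apply: (le_trans (tcut_le _)); exact: ratioD.
- have h : `|joint_ratio (s n) (x, w) / s n ^+ 3| ^+ 3 * s n ^+ 3 @[n --> \oo] --> (0 : R).
    rewrite -(mulr0 (`|L x w| ^+ 3)); apply: cvgM.
      by apply: cvg_exprn; apply: cvg_norm; exact: ratioL.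
    by have := cvg_exprn (k := 3) s_cvg0; rewrite expr0n.
  apply: (squeeze_cvgr _ (cvg_cst _) h); apply: nearW => n.
  rewrite mulr_ge0 ?tcut_ge0 ?invr_ge0 ?(ltW (s60 n))//=.
  rewrite /G mulrC ler_pdivrMr//; apply: (le_trans (tcut_le3 _)).
  rewrite le_eqVlt; apply/orP; left; apply/eqP.
  have aux (u v : R) : 0 < v -> `|u| ^+ 3 = `|u / v ^+ 3| ^+ 3 * v ^+ 3 * v ^+ 6.
    move=> v0; rewrite normrM (gtr0_norm (_ : 0 < (v ^+ 3)^-1)) ?invr_gt0 ?exprn_gt0//.
    by field; rewrite gt_eqF.
  exact: aux.
have Rintegral0 d (T : measurableType d) (m : {measure set T -> \bar R}) : \int[m]_x (0 : R) = 0.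
  by rewrite /Rintegral (eq_integral (cst 0%E)) ?integral0.
have l0 : \int[lebesgue]_x ((\int[mu]_w (0 : R)) * expR (phi x)) = 0.
  transitivity (\int[lebesgue]_x (0 : R)); last by rewrite Rintegral0.
  by apply: eq_Rintegral => x _; rewrite Rintegral0 mul0r.
move: cG; rewrite l0; set lhs := (X in X @ _ --> _ -> _).
rewrite (_ : lhs = fun n =>
  (\int[(lebesgue \x mu)%E]_p (tcut (joint_ratio (s n) p) * joint_density (s n) p)) / s n ^+ 6)//.
rewrite {}/lhs.
apply/funext => n.
rewrite (_ : (fun p => _) = fun p => (s n ^+ 6)^-1 *
  (tcut (joint_ratio (s n) p) * joint_density (s n) p)); last first.
  by apply/funext => p; rewrite /G -mulrA.
rewrite RintegralZl//; first by rewrite mulrC.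
have := integrable_scale (s n ^+ 6) (iG n).
rewrite (_ : (fun p => _) = (fun p => tcut (joint_ratio (s n) p) * joint_density (s n) p))//.
by apply/funext => p; rewrite /G; field; rewrite gt_eqF.
Qed.

End third_order_ratio.

End joint_law.

(** * The mean of a reversible log-ratio *)

Section reversible.
Context {d : measure_display} {T : measurableType d} {R : realType}.

(** One-sided, so that it is nonnegative as [reversibility] requires; half_cut(t) - half_cut(-t) is
    t / 2 for |t| <= 1/2 and 0 beyond. The support in (0, 1/2] keeps the products of half_cut(t) and
    half_cut(-t) with [expR t] bounded. *)
Definition half_cut (t : R) := t / 2 * \1_(`]0, 2^-1]%classic) t.

Lemma half_cut_bound t : 0 <= half_cut t <= 2^-1.
Proof.
have aux (x : R) : 0 < x -> x <= 2^-1 -> 0 <= x / 2 * 1 <= 2^-1 by move=> x0 x1; apply/andP; lra.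
rewrite /half_cut indicE; have [|_] := boolP (t \in _); last by rewrite mulr0 lexx/= invr_ge0 ler0n.
by rewrite inE/= in_itv/= => /andP[]; exact: aux.
Qed.

Lemma measurable_half_cut : measurable_fun setT half_cut.
Proof. by apply: measurable_funM; [exact: measurable_funM|exact: measurable_indic]. Qed.

Lemma half_cut_expR_bound t : half_cut t * expR t <= 1.
Proof.
rewrite /half_cut indicE; have [|_] := boolP (t \in _); last by rewrite mulr0 mul0r.
rewrite inE/= in_itv/= => /andP[t0 t1]; rewrite mulr1.
have h := expR_ge1Dx (- t); have e0 := expR_gt0 t.
have eE : expR t * expR (- t) = 1 by rewrite expRN divff// gt_eqF.
move: h e0 eE; move: (expR t) (expR (- t)) => u u' h e0 eE; nra.
Qed.

Lemma half_cutN_expR_bound t : half_cut (- t) * expR t <= 1.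
Proof.
have /andP[k0 k1] := half_cut_bound (- t).
have [t0|t0] := leP 0 t.
  rewrite /half_cut indicE memNset ?mulr0 ?mul0r//=.
  by rewrite in_itv/= oppr_gt0 ltNge t0.
rewrite (le_trans (ler_pM k0 (expR_ge0 t) k1 (_ : _ <= 1)))//.
  by rewrite expR_le1 ltW.
by rewrite mulr1 invf_le1// ler1n.
Qed.

(** For |t| <= 1/2 the error is t / 2 times 1 + t - exp(t), at most |t|^3. For |t| > 1/2 the
    truncation vanishes, and |t| <= 4 |t|^3 together with t^2 / 2 <= |t|^3 give the constant 5 = 4 +
    1. *)
Lemma half_cut_error t :
  `|t + t ^+ 2 / 2 - (half_cut t - half_cut (- t)) * (1 + expR t)| <= 5 * tcut t.
Proof.
have half (x : R) : `|x| <= 2^-1 -> half_cut x - half_cut (- x) = x / 2.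
  move=> /ler_normlP[x1 x2]; rewrite /half_cut !indicE.
  have [x0|x0|->] := ltgtP x 0; last by rewrite oppr0 !mul0r subrr.
  - rewrite memNset/= ?in_itv/=; last by rewrite ltNge (ltW x0).
    rewrite mem_set/= ?in_itv/= ?oppr_gt0 ?x0//.
    by rewrite mulr0 mulr1 add0r mulNr opprK.
  - rewrite mem_set/= ?in_itv/= ?x0//.
    rewrite memNset/= ?in_itv/= ?oppr_gt0; last by rewrite ltNge (ltW x0).
    by rewrite mulr0 mulr1 subr0.
have far (x : R) : 2^-1 < `|x| -> half_cut x = 0.
  move=> h; rewrite /half_cut indicE; have [|_] := boolP (x \in _); last by rewrite mulr0.
  rewrite inE/= in_itv/= => /andP[x0 x1]; move: h.
  by rewrite gtr0_norm// ltNge x1.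
have [t1|t1] := boolP (`|t| <= 2^-1).
  rewrite half//.
  have -> : t + t ^+ 2 / 2 - t / 2 * (1 + expR t) = t / 2 * (1 + t - expR t) by field.
  have e2 : `|1 + t - expR t| <= 2 * `|t| ^+ 2.
    rewrite distrC real_normK ?num_real// ger0_norm ?subr_ge0 ?expR_ge1Dx//.
    have h := expR_ge1Dx (- t); have e0 := expR_gt0 t.
    have eE : expR t * expR (- t) = 1 by rewrite expRN divff// gt_eqF.
    move/ler_normlP : t1 => [t1 t2].
    move: h e0 eE; move: (expR t) (expR (- t)) => u u' h e0 eE; nra.
  rewrite (_ : tcut t = `|t| ^+ 3); last first.
    rewrite /tcut min_l// -[t ^+ 2]real_normK ?num_real//.
    by rewrite exprS ler_piMl ?sqr_ge0// (le_trans t1)// invf_le1// ler1n.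
  rewrite normrM.
  rewrite normrM (ger0_norm (_ : 0 <= 2^-1)) ?invr_ge0//.
  have t0 := normr_ge0 t.
  move: `|1 + t - _| `|t| e2 t0 {t1} => y x e2 x0.
  have : x / 2 * y <= x / 2 * (2 * x ^+ 2) by rewrite ler_wpM2l// divr_ge0.
  by have := exprn_ge0 3 x0; rewrite !exprS expr0; lra.
rewrite -ltNge in t1.
rewrite !far ?normrN// subrr mul0r subr0.
apply: (le_trans (ler_normD _ _)); rewrite normrM (ger0_norm (sqr_ge0 t)).
rewrite (ger0_norm (_ : 0 <= 2^-1)) ?invr_ge0//.
rewrite -[t ^+ 2]real_normK ?num_real// /tcut -[t ^+ 2]real_normK ?num_real//.
have aux (x y : R) : 2^-1 < x -> (y = x ^+ 3 \/ y = x ^+ 2) -> x + x ^+ 2 / 2 <= 5 * y.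
  by move=> x0 [->|->]; rewrite !exprS ?expr0; nra.
by apply: aux => //; rewrite minEle; case: ifP; [left|right].
Qed.

Section mean.
Variables (m : {sigma_finite_measure set T -> \bar R}) (q r : T -> R).
Hypotheses (q0 : forall p, 0 <= q p) (iq : m.-integrable setT (EFin \o q)).
Hypotheses (mr : measurable_fun setT r).
Hypothesis r2 : m.-integrable setT (EFin \o (fun p => r p ^+ 2 * q p)).
Hypothesis rev : forall k : R -> R, measurable_fun setT k -> (forall t, 0 <= k t) ->
  (\int[m]_p (k (r p) * expR (r p) * q p)%:E = \int[m]_p (k (- r p) * q p)%:E)%E.

Let mq : measurable_fun setT q. Proof. exact: integrable_meas iq. Qed.

Let bounded_integrable (f : T -> R) : measurable_fun setT f -> (forall p, `|f p| <= 1) ->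
  m.-integrable setT (EFin \o (fun p => f p * q p)).
Proof.
move=> mf f1; apply: (integrable_dom _ _ iq); first exact: measurable_funM.
by move=> p; rewrite normrM (ger0_norm (q0 p)) ler_piMl.
Qed.

(* By reversibility [(k(r) - k(-r)) * (1 + expR r)] has mean 0 for every bounded [k];
   [k = half_cut] makes it agree with [r + r ^+ 2 / 2] up to third order at 0. *)
Lemma reversible_mean :
  `|\int[m]_p (r p * q p) + (\int[m]_p (r p ^+ 2 * q p)) / 2| <=
  5 * \int[m]_p (tcut (r p) * q p).
Proof.
have mN : measurable_fun setT (fun t : R => - t) by exact: oppr_measurable.
have mk := measurable_half_cut.
have mkN : measurable_fun setT (fun t : R => half_cut (- t)) by exact: measurableT_comp.
have k0 t : 0 <= half_cut t by case/andP : (half_cut_bound t).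
have k1 t : `|half_cut t| <= 1.
  have /andP[a1 a2] := half_cut_bound t; by rewrite ger0_norm// (le_trans a2)// invf_le1// ler1n.
have me : measurable_fun setT (fun p => expR (r p)) by exact: measurableT_comp.
have i1 : m.-integrable setT (EFin \o (fun p => half_cut (r p) * q p)).
  by apply: bounded_integrable => [|p]; [exact: (measurableT_comp mk)|exact: k1].
have i2 : m.-integrable setT (EFin \o (fun p => half_cut (- r p) * q p)).
  by apply: bounded_integrable => [|p]; [exact: (measurableT_comp mkN)|exact: k1].
have i3 : m.-integrable setT (EFin \o (fun p => half_cut (r p) * expR (r p) * q p)).
  apply: bounded_integrable => [|p]; first by apply: measurable_funM => //; exact: (measurableT_comp mk).
  by rewrite (ger0_norm (mulr_ge0 (k0 _) (expR_ge0 _))) half_cut_expR_bound.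
have i4 : m.-integrable setT (EFin \o (fun p => half_cut (- r p) * expR (r p) * q p)).
  apply: bounded_integrable => [|p].
    by apply: measurable_funM => //; exact: (measurableT_comp mkN).
  by rewrite (ger0_norm (mulr_ge0 (k0 _) (expR_ge0 _))) half_cutN_expR_bound.
have e1 : \int[m]_p (half_cut (r p) * expR (r p) * q p) = \int[m]_p (half_cut (- r p) * q p).
  by rewrite /Rintegral rev.
have e2 : \int[m]_p (half_cut (- r p) * expR (r p) * q p) = \int[m]_p (half_cut (r p) * q p).
  rewrite /Rintegral (rev mkN)//; congr fine.
  by apply: eq_integral => p _; rewrite opprK.
pose F p := (half_cut (r p) - half_cut (- r p)) * (1 + expR (r p)) * q p.
have FE p : F p = (half_cut (r p) * q p - half_cut (- r p) * q p) +
    (half_cut (r p) * expR (r p) * q p - half_cut (- r p) * expR (r p) * q p).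
  by rewrite /F; ring.
have i12 := integrableB measurableT i1 i2.
have i34 := integrableB measurableT i3 i4.
have iF : m.-integrable setT (EFin \o F).
  by rewrite (funext FE); exact: (integrableD measurableT i12 i34).
have F0 : \int[m]_p F p = 0.
  rewrite (funext FE) RintegralD// !RintegralB// e1 e2.
  move: (Rintegral _ _ _) (Rintegral _ _ _) => u v; ring.
have ir : m.-integrable setT (EFin \o (fun p => r p * q p)) by exact: integrable_first_moment.
have ir2 := integrable_scale 2^-1 r2.
have irr := integrableD measurableT ir ir2.
have -> : \int[m]_p (r p * q p) + (\int[m]_p (r p ^+ 2 * q p)) / 2 =
    \int[m]_p ((r p * q p + 2^-1 * (r p ^+ 2 * q p)) - F p).
  rewrite RintegralB//.
  rewrite F0 subr0 RintegralD// RintegralZl//.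
  by congr (_ + _); exact: mulrC.
have iE := integrableB measurableT irr iF.
have it : m.-integrable setT (EFin \o (fun p => tcut (r p) * q p)) by exact: integrable_tcut.
apply: le_trans (le_normr_Rintegral _ _) _ => //.
rewrite -RintegralZl//; apply: le_Rintegral => //.
- by apply: (@integrable_norm _ _ _ m); exact: iE.
- exact: integrable_scale.
move=> p _; rewrite (_ : _ - _ = (r p + r p ^+ 2 / 2 -
  (half_cut (r p) - half_cut (- r p)) * (1 + expR (r p))) * q p); last by rewrite /F; field.
by rewrite normrM (ger0_norm (q0 p)) mulrA ler_wpM2r// half_cut_error.
Qed.

End mean.

Section limit.
Local Notation lebesgue := (@lebesgue_measure R).
Variables (m : {sigma_finite_measure set T -> \bar R}) (q r : nat -> T -> R).
Hypotheses (q0 : forall n p, 0 <= q n p).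
Hypothesis (iq : forall n, m.-integrable setT (EFin \o q n)).
Hypotheses (mr : forall n, measurable_fun setT (r n)).
Hypothesis (q1 : forall n, \int[m]_p q n p = 1).
Hypothesis r2 : forall n, m.-integrable setT (EFin \o (fun p => r n p ^+ 2 * q n p)).
Hypothesis rev : forall n (k : R -> R), measurable_fun setT k -> (forall t, 0 <= k t) ->
  (\int[m]_p (k (r n p) * expR (r n p) * q n p)%:E = \int[m]_p (k (- r n p) * q n p)%:E)%E.
Variables (a : R^nat) (e theta : R).
Hypotheses (a0 : forall n, 0 < a n) (na : n%:R * a n @[n --> \oo] --> e).
Hypothesis sqr_cvg : (\int[m]_p (r n p ^+ 2 * q n p)) / a n @[n --> \oo] --> theta.
Hypothesis tcut_cvg : (\int[m]_p (tcut (r n p) * q n p)) / a n @[n --> \oo] --> (0 : R).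

(** No limit of the first moments is assumed: n times the mean differs from -n / 2 times the second
    moment by at most 5 n times the [tcut] integral, which vanishes. *)
Theorem reversible_central_limit (f : R -> R) (M : R) : 0 < e * theta ->
  continuous f -> (forall x, `|f x| <= M) ->
  iter n (avg m (q n) (r n)) f 0 @[n --> \oo] -->
  avg lebesgue (@normal_pdf R (- (e * theta / 2)) (Num.sqrt (e * theta))) id f 0.
Proof.
move=> v0 cf fM.
have split n (x : R) : n%:R * x = (n%:R * a n) * (x / a n) by field; rewrite gt_eqF.
have c2 : n%:R * (\int[m]_p (r n p ^+ 2 * q n p)) @[n --> \oo] --> e * theta.
  rewrite (_ : (fun n => _) = fun n => (n%:R * a n) * (\int[m]_p (r n p ^+ 2 * q n p) / a n)).
    by apply: cvgM; [exact: na|exact: sqr_cvg].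
  by apply/funext => n; exact: split.
have c3 : n%:R * (\int[m]_p (tcut (r n p) * q n p)) @[n --> \oo] --> (0 : R).
  rewrite (_ : (fun n => _) = fun n => (n%:R * a n) * (\int[m]_p (tcut (r n p) * q n p) / a n)).
    by rewrite -(mulr0 e); apply: cvgM; [exact: na|exact: tcut_cvg].
  by apply/funext => n; exact: split.
apply: (central_limit q0 iq mr q1 r2 v0 _ c2 c3 cf fM).
pose u n := n%:R * (\int[m]_p (r n p * q n p) + (\int[m]_p (r n p ^+ 2 * q n p)) / 2).
have u0 : u n @[n --> \oo] --> (0 : R).
  apply/norm_cvg0P.
  have t5 : 5 * (n%:R * (\int[m]_p (tcut (r n p) * q n p))) @[n --> \oo] --> (0 : R).
    by rewrite -(mulr0 5); apply: cvgM => //; exact: cvg_cst.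
  apply: (squeeze_cvgr _ (cvg_cst _) t5); apply: nearW => n; rewrite normr_ge0/=.
  rewrite /u normrM (ger0_norm (ler0n _ _)) mulrCA ler_wpM2l//.
  exact: (reversible_mean (q0 n) (iq n) (mr n) (r2 n) (rev n)).
rewrite (_ : (fun n => _) = fun n => u n - n%:R * (\int[m]_p (r n p ^+ 2 * q n p)) / 2).
  rewrite -[X in _ --> X]add0r; apply: cvgD => //; apply: cvgN.
  by apply: cvgM => //; exact: cvg_cst.
by apply/funext => n; rewrite /u; ring.
Qed.

End limit.

End reversible.

(** * The limit theorem *)

Section weighted_moments.
Context {R : realType}.
Local Notation lebesgue := (@lebesgue_measure R).
Variables (p1 dn : R -> R) (beta eps : R).
Hypotheses (mp1 : measurable_fun setT p1) (mdn : measurable_fun setT dn).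
Hypotheses (dn0 : forall x, 0 <= dn x) (eps0 : 0 < eps).
Hypothesis idn : lebesgue.-integrable setT (EFin \o dn).
Local Notation wt := (weight p1 beta).

Lemma weight_ge1 x : 1 <= wt x.
Proof. by rewrite /weight lerDl powR_ge0. Qed.

Let wt0 x : 0 <= wt x. Proof. exact: le_trans (weight_ge1 x). Qed.

Lemma measurable_weight : measurable_fun setT wt.
Proof. by apply: measurable_funD => //; exact: (measurableT_comp (measurable_abs_powR beta)). Qed.

Let le_of_powR (t : R) : 1 <= t -> 1 <= t `^ (2 + eps).
Proof.
move=> t1; apply: (@le_trans _ _ (t `^ 0)); first by rewrite powRr0.
by apply: ler_powR => //; rewrite addr_ge0 ?ler0n ?(ltW eps0).
Qed.

Hypothesis i3 : lebesgue.-integrable setT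
  (EFin \o (fun x => `|p1 x ^+ 3| `^ (2 + eps) * wt x * dn x)).

(** Where |p1| <= 1 the weight is at most 2; elsewhere |p1^3|^(2 + eps) is at least 1, so the
    weighted moment of p1^3 dominates. *)
Lemma weight_integrable : 0 <= beta ->
  lebesgue.-integrable setT (EFin \o (fun x => wt x * dn x)).
Proof.
move=> beta0; apply: (@integrable_dom _ (measurableTypeR R) _ lebesgue _
  (fun x => 2 * dn x + `|p1 x ^+ 3| `^ (2 + eps) * wt x * dn x)).
- by apply: measurable_funM => //; exact: measurable_weight.
- move=> x; rewrite ger0_norm ?mulr_ge0// -mulrDl ler_wpM2r//.
  have [h|/ltW h] := leP `|p1 x| 1.
    rewrite /weight; apply: (@le_trans _ _ 2); last first.
      by rewrite lerDl mulr_ge0 ?powR_ge0// addr_ge0 ?powR_ge0.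
    have := @ge0_ler_powR _ _ beta0 `|p1 x| 1 _ _ h; rewrite powR1 !nnegrE => k.
    by rewrite (_ : 2 = 1 + 1)// lerD2l k.
  apply: (@le_trans _ _ (`|p1 x ^+ 3| `^ (2 + eps) * wt x)); last by rewrite lerDr.
  by rewrite ler_peMl// le_of_powR// normrX exprn_ege1.
- by have := integrableD measurableT (integrable_scale 2 idn) i3; exact.
Qed.

Lemma weighted_sqr_integrable (f : R -> R) : 0 <= beta -> measurable_fun setT f ->
  lebesgue.-integrable setT (EFin \o (fun x => `|f x| `^ (2 + eps) * wt x * dn x)) ->
  lebesgue.-integrable setT (EFin \o (fun x => f x ^+ 2 * wt x * dn x)).
Proof.
move=> beta0 mf i_f; apply: (@integrable_dom _ (measurableTypeR R) _ lebesgue _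
  (fun x => wt x * dn x + `|f x| `^ (2 + eps) * wt x * dn x)).
- apply: measurable_funM => //; apply: measurable_funM; last exact: measurable_weight.
  exact: measurable_funX.
- move=> x; rewrite (ger0_norm (mulr_ge0 (mulr_ge0 (sqr_ge0 _) (wt0 x)) (dn0 x))) -mulrDl ler_wpM2r//.
  rewrite -{2}(mul1r (wt x)) -mulrDl ler_wpM2r// -real_normK ?num_real//.
  have [h|/ltW h] := leP `|f x| 1.
    by rewrite (le_trans (exprn_ile1 _ _ h))// lerDl powR_ge0.
  rewrite -powR_mulrn// (le_trans (ler_powR h (_ : 2 <= 2 + eps)))//.
    by rewrite lerDl ltW.
  by rewrite lerDr.
- by have := integrableD measurableT (weight_integrable beta0) i_f; exact.
Qed.

Lemma unweighted_integrable (f : R -> R) : measurable_fun setT f -> (forall x, 0 <= f x) ->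
  lebesgue.-integrable setT (EFin \o (fun x => f x * wt x * dn x)) ->
  lebesgue.-integrable setT (EFin \o (fun x => f x * dn x)).
Proof.
move=> mf f0; apply: (@integrable_dom _ (measurableTypeR R) _ lebesgue _
  (fun x => f x * wt x * dn x)).
  exact: measurable_funM.
by move=> x; rewrite ger0_norm ?mulr_ge0// ler_wpM2r// ler_peMr// weight_ge1.
Qed.

End weighted_moments.

Section limit_variance.
Context {R : realType}.
Local Notation lebesgue := (@lebesgue_measure R).
Variables (mu : probability R R) (dn u p3 : R -> R) (kc kl : R).

Lemma sqr_limit_moments (al ga : R) :
  mu.-integrable setT (EFin \o (fun z => z ^+ 6)) ->
  mu.-integrable setT (EFin \o (fun z => z ^+ 4)) ->
  mu.-integrable setT (EFin \o (fun z => z ^+ 2)) ->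
  \int[mu]_w ((w ^+ 3 * al - ga * w) ^+ 2) =
  (\int[mu]_w (w ^+ 6)) * al ^+ 2 - 2 * (\int[mu]_w (w ^+ 4)) * (al * ga)
  + (\int[mu]_w (w ^+ 2)) * ga ^+ 2.
Proof.
move=> i6 i4 i2.
rewrite (_ : (fun w => _) = fun w => al ^+ 2 * w ^+ 6 + (- (2 * (al * ga))) * w ^+ 4
  + ga ^+ 2 * w ^+ 2); last by apply/funext => w; ring.
have j6 := integrable_scale (al ^+ 2) i6.
have j4 := integrable_scale (- (2 * (al * ga))) i4.
have j2 := integrable_scale (ga ^+ 2) i2.
have j64 := integrableD measurableT j6 j4.
by rewrite RintegralD// RintegralD// !RintegralZl//; ring.
Qed.

Hypotheses (mu_ : measurable_fun setT u) (mp3 : measurable_fun setT p3).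
Hypotheses (mdn : measurable_fun setT dn) (dn0 : forall x, 0 <= dn x).
Hypothesis iu : lebesgue.-integrable setT (EFin \o (fun x => u x ^+ 2 * dn x)).
Hypothesis ip3 : lebesgue.-integrable setT (EFin \o (fun x => p3 x ^+ 2 * dn x)).

Lemma limit_variance (m6 m4 : R) :
  \int[lebesgue]_x ((m6 * (kc * u x - p3 x / 12) ^+ 2
      - 2 * m4 * ((kc * u x - p3 x / 12) * (kl * u x)) + (kl * u x) ^+ 2) * dn x) =
  let A := \int[lebesgue]_x (p3 x ^+ 2 * dn x) in
  let B := \int[lebesgue]_x (u x ^+ 2 * dn x) in
  let C := \int[lebesgue]_x (u x * p3 x * dn x) in
  m6 * (A / 144 + kc ^+ 2 * B - 6^-1 * kc * C)
  + m4 * (6^-1 * kl * C - 2 * kc * kl * B) + kl ^+ 2 * B.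
Proof.
have iup : lebesgue.-integrable setT (EFin \o (fun x => u x * p3 x * dn x)).
  apply: (@integrable_dom _ (measurableTypeR R) _ lebesgue _
    (fun x => u x ^+ 2 * dn x + p3 x ^+ 2 * dn x)).
  - by apply: measurable_funM => //; exact: measurable_funM.
  - move=> x; rewrite normrM (ger0_norm (dn0 x)) -mulrDl ler_wpM2r//.
    have aux (a b : R) : `|a * b| <= a ^+ 2 + b ^+ 2.
      by rewrite ler_norml; apply/andP; split; nra.
    exact: aux.
  - by have := integrableD measurableT iu ip3; exact.
pose cA := m6 / 144; pose cB := m6 * kc ^+ 2 - 2 * m4 * kc * kl + kl ^+ 2.
pose cC := - (m6 * kc / 6) + m4 * kl / 6.
rewrite (_ : (fun x => _) = fun x => cA * (p3 x ^+ 2 * dn x) + cB * (u x ^+ 2 * dn x)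
  + cC * (u x * p3 x * dn x)); last by apply/funext => x; rewrite /cA /cB /cC; field.
have jA := integrable_scale cA ip3.
have jB := integrable_scale cB iu.
have jC := integrable_scale cC iup.
have jAB := integrableD measurableT jA jB.
by rewrite RintegralD// RintegralD// !RintegralZl// /cA /cB /cC; field.
Qed.

End limit_variance.

Section product_sigma_finite.
Context {d1 d2 : measure_display} {T1 : measurableType d1} {T2 : measurableType d2} {R : realType}.
Variables (m : {sigma_finite_measure set T1 -> \bar R}) (P : probability T2 R).

Lemma product_sigma_finite : sigma_finite setT (m \x P)%E.
Proof.
have [F FT Foo] := sigma_finiteT m.
exists (fun n => F n `*` setT); first by rewrite -setX_bigcupl -FT setXTT.
move=> k; have [mF Fk] := Foo k; split; first exact: measurableX.
by rewrite product_measure1E// [X in (_ * X)%E](@probability_setT _ _ _ P) mule1.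
Qed.

(* The canonical sigma-finite structure on a product measure is only inferred
   for products of (sub)probabilities. *)
Definition product_law : {sigma_finite_measure set (T1 * T2)%type -> \bar R} :=
  HB.pack (m \x P)%E (Measure_isSigmaFinite.Build _ _ _ (m \x P)%E product_sigma_finite).

End product_sigma_finite.

Section locally_balanced_limit.
Context {R : realType}.
Local Notation lebesgue := (@lebesgue_measure R).
Variables (mu : probability R R) (b c c1 psi psi1 phi p1 p2 p3 : R -> R).
Variables (M kc kl C H gamma beta xi eps : R) (K1 K2 K3 K4 : R -> R).
Hypotheses (mb : measurable_fun setT b) (bM : forall u, `|b u| <= M * `|u|) (M0 : 0 <= M).
Hypotheses (bE : forall u, b u = u / 2 + c u).
Hypotheses (cN : forall x, c (- x) = c x) (dc : forall x : R, is_derive x 1 c (c1 x)).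
Hypotheses (dc0 : is_derive (0 : R) 1 c1 kc) (c10 : c1 0 = 0).
Hypotheses (c1M : forall t, `|c1 t| <= M * `|t|).
Hypotheses (cM : forall u v, `|c v - c u| <= M * `|v - u|).
Hypothesis expR_psi : forall x, expR (psi x) = (expR (b x) + expR (b (- x))) / 2.
Hypotheses (psiN : forall x, psi (- x) = psi x) (psiM : forall u, `|psi u| <= M * `|u|).
Hypotheses (dpsi : forall x : R, is_derive x 1 psi (psi1 x)).
Hypotheses (dpsi0 : is_derive (0 : R) 1 psi1 kl) (psi10 : psi1 0 = 0).
Hypothesis psi1M : forall t, `|psi1 t| <= M * `|t|.
Hypothesis muN : forall A : set R, measurable A -> mu ((fun z => - z) @^-1` A) = mu A.
Hypothesis mu2 : (\int[mu]_z (z ^+ 2)%:E = 1)%E.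
Hypothesis ixi : mu.-integrable setT (EFin \o (fun z => `|z| `^ xi)).
Hypothesis tailC : forall a : R,
  (\int[mu]_z (expR (b (a * z)) * `|z| `^ xi)%:E
     <= (C * (1 + `|a| `^ beta))%:E * \int[mu]_z (expR (b (a * z)))%:E)%E
  /\ (\int[mu]_z (expR (b (a * z)))%:E < +oo)%E.
Hypotheses (H0 : 0 < H) (gamma0 : 0 < gamma) (beta0 : 0 <= beta) (eps0 : 0 < eps) (C0 : 0 <= C).
Hypotheses (xi6 : 6 < xi) (xiH : 2 + 2 * H <= xi) (xig : 2 + 2 * gamma <= xi).
Hypotheses (dphi : forall x : R, is_derive x 1 phi (p1 x)).
Hypotheses (dp1 : forall x : R, is_derive x 1 p1 (p2 x)).
Hypotheses (dp2 : forall x : R, is_derive x 1 p2 (p3 x)) (cp3 : continuous p3).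
Hypothesis dens1 : (\int[lebesgue]_x (expR (phi x))%:E = 1)%E.
Local Notation holder := (holder H gamma).
Hypothesis g1 : forall x d, `|p3 (x + d) - p3 x| <= K1 x * holder d.
Hypothesis g2 : forall x d, `|p2 (x + d) * p1 (x + d) - p2 x * p1 x| <= K2 x * holder d.
Hypothesis g3 : forall x d, `|p1 (x + d) ^+ 3 - p1 x ^+ 3| <= K3 x * holder d.
Hypothesis g4 : forall x d, `|p2 (x + d) * `|p1 (x + d)| `^ (1 + beta)
  - p2 x * `|p1 x| `^ (1 + beta)| <= K4 x * holder d.
Local Notation wt := (weight p1 beta).
Local Notation dn := (fun x => expR (phi x)).
Let moment_ok (f K : R -> R) :=
  lebesgue.-integrable setT (EFin \o (fun x => `|f x| `^ (2 + eps) * wt x * dn x)) /\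
  lebesgue.-integrable setT (EFin \o (fun x => K x ^+ 2 * wt x * dn x)).
Hypothesis h1 : moment_ok p3 K1.
Hypothesis h2 : moment_ok (fun x => p2 x * p1 x) K2.
Hypothesis h3 : moment_ok (fun x => p1 x ^+ 3) K3.
Hypothesis h4 : moment_ok (fun x => p2 x * `|p1 x| `^ (1 + beta)) K4.

Let mphi : measurable_fun setT phi.
Proof. by apply: continuous_measurable_fun => x; exact: is_derive_continuous (dphi x). Qed.
Let mp1 : measurable_fun setT p1.
Proof. by apply: continuous_measurable_fun => x; exact: is_derive_continuous (dp1 x). Qed.
Let mp2 : measurable_fun setT p2.
Proof. by apply: continuous_measurable_fun => x; exact: is_derive_continuous (dp2 x). Qed.
Let mp3 : measurable_fun setT p3.
Proof. exact: continuous_measurable_fun. Qed.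
Let mdn : measurable_fun setT dn.
Proof. exact: measurableT_comp. Qed.
Let dn0 x : 0 <= dn x. Proof. exact: expR_ge0. Qed.

Let idn : lebesgue.-integrable setT (EFin \o dn).
Proof.
apply/integrableP; split; first exact/measurable_EFinP.
under eq_integral do rewrite /= ger0_norm ?expR_ge0//.
by rewrite dens1 ltry.
Qed.

Let mf2 : measurable_fun setT (fun x => p2 x * p1 x).
Proof. exact: measurable_funM. Qed.
Let mf3 : measurable_fun setT (fun x => p1 x ^+ 3).
Proof. exact: measurable_funX. Qed.
Let mf4 : measurable_fun setT (fun x => p2 x * `|p1 x| `^ (1 + beta)).
Proof. by apply: measurable_funM => //; exact: (measurableT_comp (measurable_abs_powR _)). Qed.

Let wsi (f : R -> R) := @weighted_sqr_integrable R p1 _ beta eps mp1 mdn dn0 eps0 idn (proj1 h3) f beta0.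

Let env2 (x : R) := 1 + (p3 x ^+ 2 + K1 x ^+ 2) + ((p2 x * p1 x) ^+ 2 + K2 x ^+ 2)
  + ((p1 x ^+ 3) ^+ 2 + K3 x ^+ 2) + ((p2 x * `|p1 x| `^ (1 + beta)) ^+ 2 + K4 x ^+ 2).

Let env2_ge0 x : 0 <= env2 x.
Proof. by rewrite /env2 !addr_ge0 ?sqr_ge0. Qed.

Let ienv2 : lebesgue.-integrable setT (EFin \o (fun x => env2 x * wt x * dn x)).
Proof.
have i0 := weight_integrable mp1 mdn dn0 eps0 idn (proj1 h3) beta0.
have two (f K : R -> R) : measurable_fun setT f -> moment_ok f K ->
    lebesgue.-integrable setT (EFin \o (fun x => (f x ^+ 2 + K x ^+ 2) * wt x * dn x)).
  move=> mf [i_f iK]; have := integrableD measurableT (wsi mf i_f) iK.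
  apply: eq_integrable => // x _ /=; rewrite -EFinD; congr (_%:E).
  by rewrite -!mulrDl.
have add (f h : R -> R) :
    lebesgue.-integrable setT (EFin \o (fun x => f x * wt x * dn x)) ->
    lebesgue.-integrable setT (EFin \o (fun x => h x * wt x * dn x)) ->
    lebesgue.-integrable setT (EFin \o (fun x => (f x + h x) * wt x * dn x)).
  move=> i_f ih; have := integrableD measurableT i_f ih.
  apply: eq_integrable => // x _ /=; rewrite -EFinD; congr (_%:E).
  by rewrite -!mulrDl.
have i0' : lebesgue.-integrable setT (EFin \o (fun x => 1 * wt x * dn x)).
  by have := i0; under [X in _ -> _.-integrable _ (EFin \o X)]eq_fun do rewrite mul1r.
exact: (add _ _ (add _ _ (add _ _ (add _ _ i0' (two _ _ mp3 h1)) (two _ _ mf2 h2))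
  (two _ _ mf3 h3)) (two _ _ mf4 h4)).
Qed.

Let env_bound x : envelope p1 p2 p3 beta K1 K2 K3 K4 x ^+ 2 <= 32 * env2 x.
Proof.
(* Five nested uses of this inequality reach the innermost square, whence 32 = 2^5. *)
have sq (a d : R) : (a + d) ^+ 2 <= 2 * (a ^+ 2 + d ^+ 2).
  by have := sqr_ge0 (a - d); nra.
have na (a : R) : `|a| ^+ 2 = a ^+ 2 by rewrite real_normK ?num_real.
rewrite /envelope /env2.
rewrite -(na (p3 x)) -(na (p2 x * p1 x)) -(na (p1 x ^+ 3)) -(na (p2 x * `|p1 x| `^ (1 + beta))).
move: `|p3 x| `|p2 x * p1 x| `|p1 x ^+ 3| `|p2 x * `|p1 x| `^ (1 + beta)| => a1 a2 a3 a4.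
move: (K1 x) (K2 x) (K3 x) (K4 x) => d1 d2 d3 d4.
have e4 := sq (1 + (a1 + d1) + (a2 + d2) + (a3 + d3)) (a4 + d4).
have e3 := sq (1 + (a1 + d1) + (a2 + d2)) (a3 + d3).
have e2 := sq (1 + (a1 + d1)) (a2 + d2).
have e1 := sq 1 (a1 + d1); rewrite expr1n in e1.
have := sq a1 d1; have := sq a2 d2; have := sq a3 d3; have := sq a4 d4.
have := sqr_ge0 a2; have := sqr_ge0 a3; have := sqr_ge0 a4.
have := sqr_ge0 d2; have := sqr_ge0 d3; have := sqr_ge0 d4.
move: e1 e2 e3 e4; lra.
Qed.

Local Notation Lam := (fun a => ln (tilt_mass mu b a)).
Let M' := (M + 1) * (1 + C).

Let MM' : M <= M'.
Proof. by rewrite /M'; move: M0 C0; nra. Qed.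
Let M'0 : 0 <= M'. Proof. exact: le_trans MM'. Qed.

Let c1M' t : `|c1 t| <= M' * `|t|.
Proof. by rewrite (le_trans (c1M t))// ler_wpM2r. Qed.
Let cM' u v : `|c v - c u| <= M' * `|v - u|.
Proof. by rewrite (le_trans (cM u v))// ler_wpM2r. Qed.

Let LamM a a' : `|Lam a - Lam a'| <=
  M' * (`|a ^+ 2 - a' ^+ 2| * (1 + Num.max `|a| `|a'| `^ beta)).
Proof.
apply: (le_trans (ln_tilt_mass_bound mb bM expR_psi psiN psiM dpsi psi1M muN xi6 beta0 C0
  ixi tailC a a')).
apply: ler_wpM2r; first by rewrite mulr_ge0// addr_ge0// powR_ge0.
by rewrite ler_wpM2r ?addr_ge0// lerDl.
Qed.

Let Lam_cvg (a a' r : R^nat) (L : R) := @ln_tilt_mass_cvg _ _ _ _ _ _ _ _ _ _ mb bM expR_psi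
  psiN psiM dpsi dpsi0 psi10 psi1M muN xi6 beta0 C0 ixi mu2 tailC a a' r L.

Let iB := integrable_tilt_bfun mb tailC.
Let iBxi := integrable_tilt_bfun_xi mb tailC.
Let Bxi := tilt_bfun_xi mb tailC.

Local Notation ratio s := (joint_ratio mu b phi p1 s).
Local Notation density s := (joint_density mu b phi p1 s).

Let ratioE s x w : ratio s (x, w) = log_ratio phi p1 c Lam s x (s * w).
Proof.
rewrite /joint_ratio /log_mh /log_ratio /trapezoid/=.
have -> : x - (x + s * w) = - (s * w) by ring.
have -> : x + s * w - x = s * w by ring.
rewrite mulrN !bE cN.
move: (ln _) (ln _) (c _) (c _) (phi _) (phi x) => u1 u2 u3 u4 u5 u6.
by field.
Qed.

Let L (x w : R) := w ^+ 3 * (kc * (p1 x * p2 x) - p3 x / 12) - kl * (p1 x * p2 x) * w.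

Let ratio_bound : exists D : R -> R, [/\ forall x, 0 <= D x,
  lebesgue.-integrable setT (EFin \o (fun x => D x * wt x * dn x)) &
  forall s x w, 0 < s <= 1 -> ratio s (x, w) ^+ 2 <=
    s ^+ 6 * (D x * (1 + w ^+ 6 + s `^ (xi - 6) * `|w| `^ xi))].
Proof.
have [A A0 hA] := log_ratio_sqr_bound dphi dp1 dp2 cN dc M'0 c1M' cM' LamM H0 gamma0 beta0
  xi6 xiH xig g1 g2 g3 g4.
exists (fun x => A * 32 * env2 x); split.
- by move=> x; rewrite !mulr_ge0.
- have := integrable_scale (A * 32) ienv2.
  apply: eq_integrable => // x _ /=; congr (_%:E); ring.
- move=> s x w s01; rewrite ratioE; apply: (le_trans (hA s x w s01)).
  case/andP: s01 => s0 _.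
  have w60 : 0 <= w ^+ 6 by rewrite (exprM w 2 3) exprn_ge0// sqr_ge0.
  have t0 : 0 <= s `^ (xi - 6) * `|w| `^ xi by rewrite mulr_ge0 ?powR_ge0.
  have e0 := ler_wpM2l A0 (env_bound x); rewrite (mulrA A 32) in e0.
  rewrite ler_wpM2l ?exprn_ge0 ?(ltW s0)//.
  by apply: ler_wpM2r; [rewrite !addr_ge0|exact: e0].
Qed.

Let ratio_cvg (s : R^nat) x w : (forall n, 0 < s n) -> s n @[n --> \oo] --> (0 : R) ->
  ratio (s n) (x, w) / s n ^+ 3 @[n --> \oo] --> L x w.
Proof.
move=> s0 sc.
rewrite (_ : (fun n => _) = fun n => log_ratio phi p1 c Lam (s n) x (s n * w) / s n ^+ 3).
  exact: (log_ratio_cvg dphi dp1 dp2 cp3 cN dc dc0 c10 Lam_cvg s0 sc).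
by apply/funext => n; rewrite ratioE.
Qed.

Definition limit_var : R :=
  let A := \int[lebesgue]_x (p3 x ^+ 2 * dn x) in
  let B := \int[lebesgue]_x ((p1 x * p2 x) ^+ 2 * dn x) in
  let C := \int[lebesgue]_x (p1 x * p2 x * p3 x * dn x) in
  let m6 := \int[mu]_z (z ^+ 6) in
  let m4 := \int[mu]_z (z ^+ 4) in
  m6 * (A / 144 + kc ^+ 2 * B - 6^-1 * kc * C)
  + m4 * (6^-1 * kl * C - 2 * kc * kl * B) + kl ^+ 2 * B.

Let imom k : (k <= 6)%N -> mu.-integrable setT (EFin \o (fun z => z ^+ k)).
Proof.
move=> k6; apply: (integrable_le_xi ixi (c1 := 1) (c2 := 1)).
  exact: measurable_funX.
move=> z; rewrite normrX mul1r; apply: ler_exp_powR => //.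
by apply: le_trans (ltW xi6); rewrite ler_nat.
Qed.

Lemma limit_varE : \int[lebesgue]_x ((\int[mu]_w (L x w ^+ 2)) * dn x) = limit_var.
Proof.
have e2 : \int[mu]_z (z ^+ 2) = 1 by rewrite /Rintegral mu2.
have iu : lebesgue.-integrable setT (EFin \o (fun x => (p1 x * p2 x) ^+ 2 * dn x)).
  apply: (unweighted_integrable mdn dn0 (p1 := p1) (beta := beta) (f := fun x => (p1 x * p2 x) ^+ 2)).
  - by apply: measurable_funX; exact: measurable_funM.
  - by move=> x; exact: sqr_ge0.
  - have := wsi mf2 (proj1 h2); apply: eq_integrable => // x _ /=; congr (_%:E).
    by rewrite (mulrC (p1 x)).
have ip3 : lebesgue.-integrable setT (EFin \o (fun x => p3 x ^+ 2 * dn x)).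
  apply: (unweighted_integrable mdn dn0 (p1 := p1) (beta := beta) (f := fun x => p3 x ^+ 2)).
  - exact: measurable_funX.
  - by move=> x; exact: sqr_ge0.
  - exact: wsi mp3 (proj1 h1).
have m12 : measurable_fun setT (fun x => p1 x * p2 x) by exact: measurable_funM.
apply: etrans (limit_variance kc kl m12 mp3 mdn dn0 iu ip3 _ _).
apply: eq_Rintegral => x _; congr (_ * _).
rewrite sqr_limit_moments; [|exact: imom|exact: imom|exact: imom].
by rewrite e2 mul1r.
Qed.

Section sequence.
Variable s : R^nat.
Hypotheses (s01 : forall n, 0 < s n <= 1) (s_cvg0 : s n @[n --> \oo] --> (0 : R)).

Let s0 n : 0 < s n. Proof. by case/andP : (s01 n). Qed.

Lemma ratio_sqr_limit :
  (forall n, (lebesgue \x mu)%E.-integrable setT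
    (EFin \o (fun p => ratio (s n) p ^+ 2 * density (s n) p))) /\
  (\int[(lebesgue \x mu)%E]_p (ratio (s n) p ^+ 2 * density (s n) p)) / s n ^+ 6
    @[n --> \oo] --> limit_var.
Proof.
have [D [D0 iD hD]] := ratio_bound.
rewrite -limit_varE.
by apply: (joint_sqr_limit mb bM xi6 beta0 C0 ixi iB iBxi Bxi mphi mp1 s01 s_cvg0 D0 iD) =>
  [n x w|x w]; [exact: hD|exact: ratio_cvg].
Qed.

Lemma ratio_central_limit (e : R) (f : R -> R) (B : R) : 0 < e * limit_var ->
  n%:R * s n ^+ 6 @[n --> \oo] --> e -> continuous f -> (forall x, `|f x| <= B) ->
  iter n (avg (product_law lebesgue mu) (density (s n)) (ratio (s n))) f 0 @[n --> \oo] -->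
  avg lebesgue (@normal_pdf R (- (e * limit_var / 2)) (Num.sqrt (e * limit_var))) id f 0.
Proof.
move=> v0 ne cf fB.
have [i2 c2] := ratio_sqr_limit.
have [D [D0 iD hD]] := ratio_bound.
have s60 n : 0 < s n ^+ 6 by exact: exprn_gt0.
apply: (reversible_central_limit (m := product_law lebesgue mu) (q := fun n => density (s n))
  (r := fun n => ratio (s n)) _ _ _ _ i2 _ s60 ne c2 _ v0 cf fB).
- move=> n p; exact: (joint_density_ge0 phi p1 mb bM xi6 ixi iB).
- move=> n; exact: (integrable_joint_density mb bM xi6 ixi iB mphi mp1 dens1).
- move=> n; exact: (measurable_joint_ratio mu mb mphi mp1).
- move=> n; exact: (Rintegral_joint_density mb bM xi6 ixi iB mphi mp1 dens1).
- move=> n k mk k0; exact: (reversibility mb bM xi6 ixi iB mphi mp1 muN (s n) mk k0).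
- apply: (joint_tcut_limit mb bM xi6 beta0 C0 ixi iB iBxi Bxi mphi mp1 s01 s_cvg0 D0 iD (L := L)).
    by move=> n x w; exact: hD.
  by move=> x w; exact: ratio_cvg.
Qed.

End sequence.

(** The sign is read off the integral of [L x w ^+ 2]; the polynomial expression does not show
    it. *)
Lemma limit_var_ge0 : 0 <= limit_var.
Proof.
rewrite -limit_varE; apply: Rintegral_ge0 => x _.
rewrite mulr_ge0//; apply: Rintegral_ge0 => w _; exact: sqr_ge0.
Qed.

Theorem locally_balanced_limits : 0 <= limit_var /\ forall s : R^nat,
  (forall n, 0 < s n <= 1) -> s n @[n --> \oo] --> (0 : R) ->
  [/\ forall n, (lebesgue \x mu)%E.-integrable setT
       (EFin \o (fun p => ratio (s n) p ^+ 2 * density (s n) p)),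
     (\int[(lebesgue \x mu)%E]_p (ratio (s n) p ^+ 2 * density (s n) p)) / s n ^+ 6
       @[n --> \oo] --> limit_var &
     forall (e : R) (f : R -> R) (B : R), 0 < e * limit_var ->
       n%:R * s n ^+ 6 @[n --> \oo] --> e -> continuous f -> (forall x, `|f x| <= B) ->
       iter n (avg (product_law lebesgue mu) (density (s n)) (ratio (s n))) f 0 @[n --> \oo] -->
       avg lebesgue (@normal_pdf R (- (e * limit_var / 2)) (Num.sqrt (e * limit_var))) id f 0].
Proof.
split=> [|s s01 sc]; first exact: limit_var_ge0.
have [si sl] := ratio_sqr_limit s01 sc; split=> // e f B; exact: ratio_central_limit.
Qed.

End locally_balanced_limit.

(** The signed counterpart of [ge0_joint_integral]: test functions of the sum may change sign, so
    Fubini with an integrable majorant replaces Tonelli. *)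
Lemma bounded_joint_integral (R : realType) (mu : probability R R) (b phi p1 : R -> R)
  (M xi : R) (s : R) (G : R * R -> R) (B : R) : measurable_fun setT b ->
  (forall u, `|b u| <= M * `|u|) -> 6 < xi ->
  mu.-integrable setT (EFin \o (fun z => `|z| `^ xi)) ->
  (forall a, mu.-integrable setT (EFin \o (fun z => expR (b (a * z))))) ->
  measurable_fun setT phi -> measurable_fun setT p1 ->
  (\int[@lebesgue_measure R]_x (expR (phi x))%:E = 1)%E ->
  measurable_fun setT G -> (forall p, `|G p| <= B) ->
  (\int[lebesgue_measure]_x ((expR (phi x))%:E *
      \int[mu]_w (G (x, w) * prop_density mu b p1 s x w)%:E) =
   \int[lebesgue_measure \x mu]_p (G p * joint_density mu b phi p1 s p)%:E)%E.
Proof.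
move=> mb bM xi6 ixi iB mphi mp1 dens1 mG GB.
have iG : (lebesgue_measure \x mu)%E.-integrable setT
    (EFin \o (fun p => G p * joint_density mu b phi p1 s p)).
  apply: (integrable_dom _ _ (integrable_scale B
    (integrable_joint_density mb bM xi6 ixi iB mphi mp1 dens1 s))).
    apply: measurable_funM => //.
    exact: (integrable_meas (integrable_joint_density mb bM xi6 ixi iB mphi mp1 dens1 s)).
  have q0 p := joint_density_ge0 phi p1 mb bM xi6 ixi iB s p.
  by move=> p; rewrite normrM (ger0_norm (q0 p)) ler_wpM2r.
rewrite -(integral12_prod_meas1 iG); apply: eq_integral => x _; rewrite /fubini_F.
have ip : mu.-integrable setT (EFin \o (prop_density mu b p1 s x)).
  have := integrable_scale (tilt_mass mu b (s * p1 x))^-1 (iB (s * p1 x)).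
  apply: eq_integrable => // w _ /=; rewrite /prop_density; congr (_%:E); exact: mulrC.
have ig : mu.-integrable setT (EFin \o (fun w => G (x, w) * prop_density mu b p1 s x w)).
  apply: (integrable_dom _ _ (integrable_scale B ip)).
    apply: measurable_funM; last exact: integrable_meas ip.
    exact: (measurableT_comp mG (measurable_pair1 x)).
  have q0 w := prop_density_ge0 p1 mb bM xi6 ixi iB s x w.
  by move=> w; rewrite normrM (ger0_norm (q0 w)) ler_wpM2r.
rewrite -integralZl//; apply: eq_integral => w _.
by rewrite -EFinM /joint_density/= mulrCA.
Qed.

(** * From the integrals of the statement to the joint law *)

Section metropolis_hastings.
Context {R : realType}.
Variables (phi g : R -> R) (mu : probability R R) (M xi : R).
Hypothesis gpos : forall t, 0 < t -> 0 < g t.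
Local Notation b := (bfun g).
Local Notation p1 := (derive1n 1 phi).

Lemma Zs_tilt_mass s x : Zs phi g mu s x = tilt_mass mu b (s * p1 x).
Proof.
rewrite /Zs /tilt_mass /Rintegral; congr fine; apply: eq_integral => z _.
by rewrite expR_bfun// mulrAC.
Qed.

Lemma proposalE s x w :
  g (expR (s * w * p1 x)) / Zs phi g mu s x = prop_density mu b p1 s x w.
Proof. by rewrite Zs_tilt_mass /prop_density expR_bfun// mulrAC. Qed.

Lemma rhoE s x w : rho phi g mu s x (x + s * w) = joint_ratio mu b phi p1 s (x, w).
Proof. by rewrite /rho /joint_ratio /log_mh !Zs_tilt_mass. Qed.

Lemma pairE_inner s (h : R -> R -> R) : pairE phi g mu s (fun x y => (h x y)%:E) =
  (\int[lebesgue_measure]_x ((expR (phi x))%:E *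
      \int[mu]_w (h x (x + s * w) * prop_density mu b p1 s x w)%:E))%E.
Proof.
apply: eq_integral => x _; congr (_ * _)%E; apply: eq_integral => w _.
by rewrite proposalE EFinM.
Qed.

Hypotheses (mb : measurable_fun setT b) (bM : forall u, `|b u| <= M * `|u|).
Hypotheses (xi6 : 6 < xi).
Hypothesis ixi : mu.-integrable setT (EFin \o (fun z => `|z| `^ xi)).
Hypothesis iB : forall a, mu.-integrable setT (EFin \o (fun z => expR (b (a * z)))).
Hypotheses (mphi : measurable_fun setT phi) (mp1 : measurable_fun setT p1).
Hypothesis dens1 : (\int[@lebesgue_measure R]_x (expR (phi x))%:E = 1)%E.
Local Notation density := (joint_density mu b phi p1).
Local Notation ratio := (joint_ratio mu b phi p1).

Lemma pairE_rho_sqr s : pairE phi g mu s (fun x y => (rho phi g mu s x y ^+ 2)%:E) =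
  (\int[lebesgue_measure \x mu]_p (ratio s p ^+ 2 * density s p)%:E)%E.
Proof.
pose G p := ratio s p ^+ 2.
have mG : measurable_fun setT G.
  by apply: measurable_funX; exact: (measurable_joint_ratio mu mb mphi mp1).
have G0 p : 0 <= G p by exact: sqr_ge0.
have GE x w : rho phi g mu s x (x + s * w) ^+ 2 = G (x, w) by rewrite rhoE.
rewrite pairE_inner.
apply: etrans (esym (ge0_joint_integral mb bM xi6 ixi iB mphi mp1 s mG G0)).
clearbody G.
by apply: eq_integral => x _; congr (_ * _)%E; apply: eq_integral => w _; rewrite GE.
Qed.

(** Each round of the recursion is one integral over the joint law; the iterates stay bounded and
    measurable, so the iterated integral agrees with the integral over the product. *)
Lemma sumE_iter_avg s k (f : R -> R) t : bdd_meas f ->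
  sumE phi g mu s k f t =
  iter k (avg (product_law lebesgue_measure mu) (density s) (ratio s)) f t.
Proof.
move=> bf; elim: k t => // k IH t; rewrite iterS/=.
set F := iter k _ f in IH *.
have bF : bdd_meas F.
  apply: (iter_avg_bdd_meas _ _ _ _ bf).
  - exact: (joint_density_ge0 phi p1 mb bM xi6 ixi iB).
  - exact: (integrable_joint_density mb bM xi6 ixi iB mphi mp1 dens1).
  - exact: (measurable_joint_ratio mu mb mphi mp1).
have mr : measurable_fun setT (ratio s) by exact: (measurable_joint_ratio mu mb mphi mp1).
case: bF => mF [B FB].
pose G p := F (t + ratio s p).
have mG : measurable_fun setT G by apply: (measurableT_comp mF); exact: measurable_funD.
have GB p : `|G p| <= B by exact: FB.
have GE x w : sumE phi g mu s k f (t + rho phi g mu s x (x + s * w)) = G (x, w).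
  by rewrite IH rhoE.
rewrite pairE_inner /avg /Rintegral; congr fine.
apply: etrans (bounded_joint_integral s mb bM xi6 ixi iB mphi mp1 dens1 mG GB).
clearbody G.
by apply: eq_integral => x _; congr (_ * _)%E; apply: eq_integral => w _; rewrite GE.
Qed.

End metropolis_hastings.

(** With k = b''(0), the coefficients 1/4 + g''(1) and 1/2 + g''(1) become k and k + 1/4, the second
    derivatives at 0 of [bfun_even] and [bfun_sym]. *)
Lemma theta2E (R : realType) (phi g : R -> R) (mu : probability R R) :
  frakg g = derive1n 2 (bfun g) 0 - 4^-1 ->
  theta2 phi g mu = limit_var mu phi (derive1n 1 phi) (derive1n 2 phi) (derive1n 3 phi)
    (derive1n 2 (bfun g) 0) (derive1n 2 (bfun g) 0 + 4^-1).
Proof.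
move=> gE; rewrite /theta2 gE; set k := derive1n 2 (bfun g) 0.
transitivity (moment mu 6 * (Aphi phi / 144 + k ^+ 2 * Bphi phi - 6^-1 * k * Cphi phi)
  + moment mu 4 * (6^-1 * (k + 4^-1) * Cphi phi - 2 * k * (k + 4^-1) * Bphi phi)
  + (k + 4^-1) ^+ 2 * Bphi phi); last by [].
move: (moment mu 6) (moment mu 4) (Aphi phi) (Bphi phi) (Cphi phi) k => m6 m4 A B C k /=.
by field.
Qed.

Theorem theorem2 (R : realType) (phi g : R -> R) (mu : probability R R)
  (sigma : nat -> R) :
  (* pi = exp(phi) is a probability density on R *)
  (\int[lebesgue_measure]_x (dens phi x)%:E = 1)%E ->
  (* g is a (normalised) balancing function, positive on (0, oo) so that b is defined *)
  balancing g -> (forall t, 0 < t -> 0 < g t) ->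
  (* mu is a centred symmetric probability distribution *)
  (forall A : set R, measurable A -> mu ((fun z => - z) @^-1` A) = mu A) ->
  (\int[mu]_z z%:E = 0)%E ->
  Assumption1 phi g mu ->
  (forall n, 0 < sigma n) -> sigma n @[n --> \oo] --> 0 ->
  [/\ 0 <= theta2 phi g mu,
      ((sigma n ^- 6)%:E *
         pairE phi g mu (sigma n) (fun x y => (rho phi g mu (sigma n) x y ^+ 2)%:E))%E
        @[n --> \oo] --> (theta2 phi g mu)%:E &
      forall ell : R, 0 < theta2 phi g mu -> 0 < ell ->
        ((n%:R) `^ (6^-1) * sigma n) @[n --> \oo] --> ell ->
        let v := ell ^+ 6 * theta2 phi g mu in
        forall f : R -> R, continuous f -> (exists M, forall x, `|f x| <= M) ->
          sumE phi g mu (sigma n) n f 0 @[n --> \oo] -->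
          fine (\int[lebesgue_measure]_x
                  (f x * normal_pdf (- (v / 2)) (Num.sqrt v) x)%:E)%E].
Proof.
move=> dens1 bal gpos muN _ [H [gamma [beta [eps [/andP[H0 _] gamma0 beta0 eps0]]]]] /=.
set wt := fun x => _; set xi := Num.max _ _.
move=> [[dphi dp1 dp2 cp3 _] hf [db db1 _ _ [M hM]] [mu2 ixi [C [C0 tailC]]]].
have b1M x : `|derive1n 1 (bfun g) x| <= M by have [h _ _] := hM x.
have b2M x : `|derive1n 2 (bfun g) x| <= M by have [_ h _] := hM x.
have M0 : 0 <= M by exact: le_trans (b1M 0).
(* [M + 1] is a common constant for [bfun], [bfun_even] and [bfun_sym]; the extra 1 covers the
   subtracted slope 1/2 and the logistic correction. *)
have MM : M <= M + 1 by rewrite lerDl.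
have up (u t : R) : u <= M * `|t| -> u <= (M + 1) * `|t|.
  by move=> h; rewrite (le_trans h)// ler_wpM2r.
have xi6 : 6 < xi by rewrite /xi lt_max ltrDl mulr_gt0.
have xiH : 2 + 2 * H <= xi by rewrite /xi !le_max lexx orbT.
have xig : 2 + 2 * gamma <= xi by rewrite /xi !le_max lexx !orbT.
have Dphi (x : R) : is_derive x 1 phi (derive1n 1 phi x) by exact: derivable_is_derive1.
have Dp1 (x : R) : is_derive x 1 (derive1n 1 phi) (derive1n 2 phi x) by exact: derivable_is_derive1.
have Dp2 (x : R) : is_derive x 1 (derive1n 2 phi) (derive1n 3 phi x) by exact: derivable_is_derive1.
have mb := measurable_bfun db.
have bM u := up _ u (bfun_bound bal db b1M u).
have [i1 [K1 [j1 g1]]] := hf _ (or_introl erefl).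
have [i2 [K2 [j2 g2]]] := hf _ (or_intror (or_introl erefl)).
have [i3 [K3 [j3 g3]]] := hf _ (or_intror (or_intror (or_introl erefl))).
have [i4 [K4 [j4 g4]]] := hf _ (or_intror (or_intror (or_intror erefl))).
have mphi : measurable_fun setT phi.
  by apply: continuous_measurable_fun => x; exact: is_derive_continuous (Dphi x).
have mp1 : measurable_fun setT (derive1n 1 phi).
  by apply: continuous_measurable_fun => x; exact: is_derive_continuous (Dp1 x).
have iB := integrable_tilt_bfun mb tailC.
have bE u : bfun g u = u / 2 + bfun_even g u by rewrite /bfun_even addrC subrK.
have c10 : derive1n 1 (bfun g) 0 - 2^-1 = 0 by rewrite (bfun_derive0 bal gpos db) subrr.
have c1M t := up _ t (bfun_even_derive_bound bal gpos db db1 b2M t).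
pose kc := derive1n 2 (bfun g) 0.
have [lv0 lim] := @locally_balanced_limits R mu (bfun g) (bfun_even g)
  (fun x => derive1n 1 (bfun g) x - 2^-1) (bfun_sym g) (bfun_sym1 g) phi _ _ _
  (M + 1) kc (kc + 4^-1) C H gamma beta xi eps K1 K2 K3 K4 mb bM (addr_ge0 M0 ler01) bE
  (bfun_evenN bal gpos) (bfun_even_derive db) (bfun_even_derive2 db1)
  c10 c1M (bfun_even_lipschitz db b1M) (expR_bfun_sym bal gpos) (bfun_symN bal gpos)
  (bfun_sym_bound bal db b1M) (bfun_sym_derive db) (bfun_sym_derive2 db1)
  (bfun_sym10 bal gpos db) (bfun_sym_derive_bound bal gpos db db1 b2M) muN mu2 ixi tailC H0 gamma0
  beta0 eps0 (ltW C0) xi6 xiH xig Dphi Dp1 Dp2 cp3 dens1 g1 g2 g3 g4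
  (conj i1 j1) (conj i2 j2) (conj i3 j3) (conj i4 j4).
rewrite -(theta2E phi mu (frakgE bal gpos db db1)) in lv0 lim *.
move=> sigma0 sigma_cvg0.
have sigma1 : \forall n \near \oo, sigma n <= 1.
  move/cvgr0Pnorm_le : sigma_cvg0 => /(_ 1 ltr01); apply: filterS => n.
  by apply: le_trans; exact: ler_norm.
(* The uniform bounds hold for s <= 1; since [sigma] tends to 0, the cap changes only finitely many
   terms. *)
pose s n := Num.min (sigma n) 1.
have s01 n : 0 < s n <= 1 by rewrite /s lt_min ge_min sigma0 ltr01 lexx orbT.
have sE : \forall n \near \oo, s n = sigma n.
  by apply: filterS sigma1 => n h; rewrite /s min_l.
have s_cvg0 : s n @[n --> \oo] --> (0 : R).
  by apply: cvg_trans sigma_cvg0; apply: near_eq_cvg; apply: filterS sE.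
have [iS ls clt] := lim s s01 s_cvg0.
split; first exact: lv0.
  apply: (@cvg_trans _ ((fun n => ((\int[(lebesgue_measure \x mu)%E]_p
    (joint_ratio mu (bfun g) phi (derive1n 1 phi) (s n) p ^+ 2 *
     joint_density mu (bfun g) phi (derive1n 1 phi) (s n) p)) / s n ^+ 6)%:E) @ \oo)); last first.
    by apply: cvg_EFin => //; exact: nearW.
  apply: near_eq_cvg; apply: filterS sE => n sn.
  rewrite (pairE_rho_sqr gpos mb bM xi6 ixi iB mphi mp1) -sn.
  by rewrite -(fineK (integrable_fin_num measurableT (iS n))) -EFinM mulrC.
move=> ell th0 ell0 nsc f cf [B fB]; set v := ell ^+ 6 * _.
have ne : n%:R * s n ^+ 6 @[n --> \oo] --> ell ^+ 6.
  apply: cvg_trans (cvg_exprn (k := 6) nsc); apply: near_eq_cvg; apply: filterS sE => n sn.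
  rewrite sn exprMn; congr (_ * _).
  by rewrite -powR_mulrn ?powR_ge0// -powRrM mulVf ?powRr1.
have vp : 0 < v by rewrite mulr_gt0// exprn_gt0.
have bf : bdd_meas f by split; [exact: continuous_measurable_fun|exists B].
have := clt _ f B vp ne cf fB; rewrite -/v => h.
have -> : fine (\int[lebesgue_measure]_x (f x * normal_pdf (- (v / 2)) (Num.sqrt v) x)%:E)%E =
    avg lebesgue_measure (normal_pdf (- (v / 2)) (Num.sqrt v)) id f 0.
  by apply: eq_Rintegral => x _; rewrite add0r.
apply: cvg_trans h; apply: near_eq_cvg; apply: filterS sE => n sn.
rewrite -sn; exact/esym/(sumE_iter_avg gpos mb bM xi6 ixi iB mphi mp1 dens1 _ _ _ bf).
Qed.
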